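(* Let $\mu_{\rm general}$ be an $L$-wise graphical model with arbitrary alphabets in the indicator basis, with globally centered parameters $\underline\theta^*$, as described in the context; let $\gamma$ be its maximum interaction strength, let $\widehat\gamma>0$ with $\widehat\gamma\ge\max_{u\in\mathcal V}\|\underline\theta^*_u\|_1$, and let $\alpha>0$ satisfy $\alpha\le\min_{c\in\mathbb S}\big(\sum_{\underline s_c\in\mathcal A_c}(\theta^*_{\underline s_c})^2\big)^{1/2}$, where $\mathbb S$ is the structure of the model. Let $\delta\in(0,1)$ and let $\underline\sigma^{(1)},\dots,\underline\sigma^{(n)}$ be i.i.d. samples from $\mu_{\rm general}$ with $$n\ \ge\ 2^{14}q^{2L}\,\frac{\widehat\gamma^2(1+\widehat\gamma)^2e^{4\gamma(L+1)}}{\alpha^4}\,\log\Big(\frac{4Lq^{2L}p^{2L-1}}{\delta}\Big).$$ Then the structure is perfectly recovered by the algorithm SUPRISE (see context), i.e. $\widehat{\mathbb S}=\mathbb S$, with probability at least $1-\delta$. Moreover the total computational complexity scales as $\widetilde{\mathcal O}(p^L)$ for fixed $L,q,\alpha,\gamma,\widehat\gamma,\delta$.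
   Context: Model. $\mathcal V=\{1,\dots,p\}$; $\sigma_i\in\mathcal A_i$, a finite alphabet of size $q_i\le q$. For $s_i,\sigma_i\in\mathcal A_i$ let $\Phi_{s_i,\sigma_i}=1-\frac1{q_i}$ if $\sigma_i=s_i$ and $-\frac1{q_i}$ otherwise. $R$ is the set of nonempty $r\subseteq\mathcal V$ with $|r|\le L$, and $\mathcal A_r=\prod_{i\in r}\mathcal A_i$. The factors are the pairs $(r,\underline s_r)$ with $r\in R$, $\underline s_r\in\mathcal A_r$ (abbreviated $\underline s_r$), with basis functions $\prod_{i\in r}\Phi_{s_i,\sigma_i}$, and $$\mu_{\rm general}(\underline\sigma)=\frac1Z\exp\Big(\sum_{r\in R}\sum_{\underline s_r\in\mathcal A_r}\theta^*_{\underline s_r}\prod_{i\in r}\Phi_{s_i,\sigma_i}\Big).$$ To remove the degeneracy of the parametrization, the parameters are required to be globally centered: for each $r\in R$ and $i\in r$, $\sum_{s_i\in\mathcal A_i}\theta^*_{\underline s_r}=0$ (for all values of the other letters). For $u\in\mathcal V$, $\underline\theta_u$ collects the $\theta_{\underline s_r}$ with $r\ni u$, and $\mathcal Y_u$ is the linear space of $\underline\theta_u$ with $\sum_{s_i\in\mathcal A_i}\theta_{\underline s_r}=0$ for all $r\in R$ with $r\ni u$ and all $i\in r$. Interaction strength: $\gamma=\max_{u\in\mathcal V}\max_{\underline\sigma}\big|\sum_{r\in R,\,r\ni u}\sum_{\underline s_r}\theta^*_{\underline s_r}\prod_{i\in r}\Phi_{s_i,\sigma_i}\big|$. Structure: $\mathbb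 S$ is the set of inclusion-maximal elements of $\{r\in R\mid\theta^*_{\underline s_r}\ne0\text{ for some }\underline s_r\in\mathcal A_r\}$. Algorithm SUPRISE. Let $\rho_{\rm NPC}$ be the minimum over $u\in\mathcal V$ and $r\in R$ with $r\ni u$ of the infimum, over nonzero arrays $x:\mathcal A_r\to\mathbb R$ that sum to zero in each variable $i\in r$, of $\mathbb E_{\sigma_u}\big[\sum_{\underline s_{r\setminus u}}x(\sigma_u,\underline s_{r\setminus u})^2\big]/\sum_{\underline s_r}x(\underline s_r)^2$, with $\sigma_u$ distributed according to its marginal under $\mu_{\rm general}$. Let $\epsilon=\rho_{\rm NPC}\,\alpha^2e^{-\gamma(2L-1)}/(20(1+\widehat\gamma)q^{L-1})$. Start with $R^0=R$. For $t=0,\dots,L-1$: (1) for each $u\in\mathcal V$ let $\widehat{\underline\theta}{}^t_u$ be any $\epsilon$-minimizer of $\mathcal S_n(\underline\theta_u)=\frac1n\sum_{m=1}^n\exp\big(-\sum_{r\ni u}\sum_{\underline s_r}\theta_{\underline s_r}\prod_{i\in r}\Phi_{s_i,\sigma_i^{(m)}}\big)$ over the feasible set of $\underline\theta_u\in\mathcal Y_u$ with $\|\underline\theta_u\|_1\le\widehat\gamma$ and $\theta_{\underline s_r}=0$ for $r\notin R^t$ (a feasible point whose value is at most $\epsilon$ above that of every feasible point); (2) for each inclusion-maximal $c\in R^t$ and $\underline s_c\in\mathcal A_c$ set $\widehat\theta_{\underline s_c}^{{\rm avg}(t)}=|c|^{-1}\sum_{u\in c}(\widehat{\underline\theta}{}_u^t)_{\underline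 s_c}$; (3) $R^{t+1}$ is obtained from $R^t$ by removing every inclusion-maximal $c\in R^t$ with $\big(\sum_{\underline s_c}(\widehat\theta_{\underline s_c}^{{\rm avg}(t)})^2\big)^{1/2}<\alpha/2$. Output $\widehat{\mathbb S}$: the set of inclusion-maximal elements of $R^L$. Complexity is the number of elementary arithmetic operations when $n$ is the smallest integer allowed by the bound; $\widetilde{\mathcal O}$ hides polylogarithmic factors in $p$. *)

(* Defs.v *)
From HB Require Import structures.
From mathcomp Require Import all_boot all_order all_algebra.
From mathcomp Require Import all_classical all_reals all_analysis.

Set Implicit Arguments.
Unset Strict Implicit.
Unset Printing Implicit Defensive.

Import Order.TTheory GRing.Theory Num.Theory.
Local Open Scope ring_scope.

(* The vertices are 'I_p, and vertex i has the alphabet 'I_(qs i). *)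
Definition config p (qs : 'I_p -> nat) : finType :=
  {dffun forall i : 'I_p, 'I_(qs i)}.

(* The product of the alphabets of the vertices in r. *)
Definition letters p (qs : 'I_p -> nat) (r : {set 'I_p}) : finType :=
  {dffun forall i : {i : 'I_p | i \in r}, 'I_(qs (val i))}.

(* Only the coordinates theta r with r \in factor_sets L (and, for the
   parameters attached to a vertex u, with u \in r) are ever used. *)
Definition param (R : realType) p (qs : 'I_p -> nat) :=
  forall r : {set 'I_p}, letters qs r -> R.

Definition factor_sets p (L : nat) : {set {set 'I_p}} :=
  [set r : {set 'I_p} | (0 < #|r| <= L)%N].

Definition centered_indicator (R : realType) k (s sigma : 'I_k) : R :=
  if sigma == s then 1 - k%:R^-1 else - k%:R^-1.

Definition basis_fun (R : realType) p (qs : 'I_p -> nat) (r : {set 'I_p})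
    (s : letters qs r) (sigma : config qs) : R :=
  \prod_(i : {i : 'I_p | i \in r}) centered_indicator R (s i) (sigma (val i)).

Definition energy (R : realType) p (qs : 'I_p -> nat) (L : nat)
    (theta : param R qs) (sigma : config qs) : R :=
  \sum_(r in factor_sets p L) \sum_(s : letters qs r)
     theta r s * basis_fun R s sigma.

Definition local_energy (R : realType) p (qs : 'I_p -> nat) (L : nat)
    (theta : param R qs) (u : 'I_p) (sigma : config qs) : R :=
  \sum_(r in factor_sets p L | u \in r) \sum_(s : letters qs r)
     theta r s * basis_fun R s sigma.

Definition partition_function (R : realType) p (qs : 'I_p -> nat) (L : nat)
    (theta : param R qs) : R :=
  \sum_(sigma : config qs) expR (energy L theta sigma).

Definition mu_general (R : realType) p (qs : 'I_p -> nat) (L : nat)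
    (theta : param R qs) (sigma : config qs) : R :=
  expR (energy L theta sigma) / partition_function L theta.

(* x sums to zero in each of its variables: for each i \in r and each value s
   of the other letters, the sum over the letter at i vanishes. *)
Definition centered (R : realType) p (qs : 'I_p -> nat) (r : {set 'I_p})
    (x : letters qs r -> R) : Prop :=
  forall (i : {i : 'I_p | i \in r}) (s : letters qs r),
    \sum_(s' : letters qs r | [forall j, (j != i) ==> (s' j == s j)]) x s' = 0.

Definition globally_centered (R : realType) p (qs : 'I_p -> nat) (L : nat)
    (theta : param R qs) : Prop :=
  forall r, r \in factor_sets p L -> centered (theta r).

Definition l1norm (R : realType) p (qs : 'I_p -> nat) (L : nat)
    (u : 'I_p) (theta : param R qs) : R :=
  \sum_(r in factor_sets p L | u \in r) \sum_(s : letters qs r) `|theta r s|.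

Definition l2norm (R : realType) p (qs : 'I_p -> nat) (r : {set 'I_p})
    (x : letters qs r -> R) : R :=
  Num.sqrt (\sum_(s : letters qs r) x s ^+ 2).

(* The maximum is over nonnegative values, so the neutral element 0 is harmless. *)
Definition interaction_strength (R : realType) p (qs : 'I_p -> nat) (L : nat)
    (theta : param R qs) : R :=
  \big[Num.max/0]_(u : 'I_p) \big[Num.max/0]_(sigma : config qs)
     `|local_energy L theta u sigma|.

Definition structure (R : realType) p (qs : 'I_p -> nat) (L : nat)
    (theta : param R qs) : {set {set 'I_p}} :=
  [set c | maxset (fun r => (r \in factor_sets p L) &&
                            [exists s : letters qs r, theta r s != 0]) c].

(* Expectation over sigma_u of the sum of x (sigma_u, s_{r\u})^2. *)
Definition npc_numerator (R : realType) p (qs : 'I_p -> nat) (L : nat)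
    (theta : param R qs) (u : 'I_p) (r : {set 'I_p}) (x : letters qs r -> R) : R :=
  \sum_(sigma : config qs) mu_general L theta sigma *
    \sum_(s : letters qs r |
           [forall j, (val j == u) ==> (s j == sigma (val j))]) x s ^+ 2.

(* Computed in the extended reals, so that a set r carrying no nonzero centered
   array (some alphabet of size 1) does not affect the minimum. *)
Definition rho_NPC (R : realType) p (qs : 'I_p -> nat) (L : nat)
    (theta : param R qs) : \bar R :=
  \big[Order.min/+oo%E]_(u : 'I_p)
   \big[Order.min/+oo%E]_(r in factor_sets p L | u \in r)
    ereal_inf [set (npc_numerator L theta u x / \sum_(s : letters qs r) x s ^+ 2)%:E
              | x in [set x : letters qs r -> R |
                        centered x /\ exists s, x s != 0]]%classic.

(* rho_NPC is finite unless all alphabets have size 1; then the value of the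
   tolerance is immaterial, because 0 is the only feasible point. *)
Definition suprise_eps (R : realType) p (qs : 'I_p -> nat) (L q : nat)
    (theta : param R qs) (alpha gammahat : R) : R :=
  fine (rho_NPC L theta) * alpha ^+ 2 *
    expR (- (interaction_strength L theta * (2 * L%:R - 1))) /
    (20 * (1 + gammahat) * q%:R ^+ (L - 1)%N).

Definition screening_objective (R : realType) p (qs : 'I_p -> nat) (L n : nat)
    (w : {ffun 'I_n -> config qs}) (u : 'I_p) (theta : param R qs) : R :=
  n%:R^-1 * \sum_(m < n) expR (- local_energy L theta u (w m)).

Definition feasible (R : realType) p (qs : 'I_p -> nat) (L : nat) (gammahat : R)
    (Rt : {set {set 'I_p}}) (u : 'I_p) (theta : param R qs) : Prop :=
  [/\ forall r, r \in factor_sets p L -> u \in r -> centered (theta r),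
      l1norm L u theta <= gammahat &
      forall r, r \in factor_sets p L -> u \in r -> r \notin Rt ->
        forall s, theta r s = 0].

Definition eps_minimizer (R : realType) p (qs : 'I_p -> nat) (L n : nat)
    (w : {ffun 'I_n -> config qs}) (gammahat eps : R)
    (Rt : {set {set 'I_p}}) (u : 'I_p) (theta : param R qs) : Prop :=
  feasible L gammahat Rt u theta /\
  forall theta', feasible L gammahat Rt u theta' ->
    screening_objective L w u theta <= screening_objective L w u theta' + eps.

Definition maximal_sets p (Rt : {set {set 'I_p}}) : {set {set 'I_p}} :=
  [set c | maxset (fun r => r \in Rt) c].

Definition theta_avg (R : realType) p (qs : 'I_p -> nat)
    (thetahat : 'I_p -> param R qs) : param R qs :=
  fun c s => #|c|%:R^-1 * \sum_(u in c) thetahat u c s.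

(* Rs t is the family R^t and thetahat t u is the estimate for u in iteration t;
   the choice of the eps-minimizers makes this a relation. *)
Definition suprise_run (R : realType) p (qs : 'I_p -> nat) (L n : nat)
    (w : {ffun 'I_n -> config qs}) (alpha gammahat eps : R)
    (Rs : nat -> {set {set 'I_p}}) (thetahat : nat -> 'I_p -> param R qs)
    (Shat : {set {set 'I_p}}) : Prop :=
  [/\ Rs 0%N = factor_sets p L,
      forall t, (t < L)%N -> forall u,
        eps_minimizer L w gammahat eps (Rs t) u (thetahat t u),
      forall t, (t < L)%N ->
        Rs t.+1 = Rs t :\:
          [set c in maximal_sets (Rs t) |
             l2norm (theta_avg (thetahat t) (r := c)) < alpha / 2] &
      Shat = maximal_sets (Rs L)].

Definition suprise_output (R : realType) p (qs : 'I_p -> nat) (L n : nat)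
    (w : {ffun 'I_n -> config qs}) (alpha gammahat eps : R)
    (Shat : {set {set 'I_p}}) : Prop :=
  exists (Rs : nat -> {set {set 'I_p}}) (thetahat : nat -> 'I_p -> param R qs),
    suprise_run L w alpha gammahat eps Rs thetahat Shat.

(* Probability of the event E for n i.i.d. samples from mu_general. *)
Definition prob_samples (R : realType) p (qs : 'I_p -> nat) (L : nat)
    (theta : param R qs) (n : nat) (E : {ffun 'I_n -> config qs} -> Prop) : R :=
  \sum_(w : {ffun 'I_n -> config qs} | `[< E w >])
     \prod_(m < n) mu_general L theta (w m).

Definition sample_bound (R : realType) (L q p : nat)
    (alpha gamma gammahat delta : R) : R :=
  2 ^+ 14 * q%:R ^+ (2 * L)%N *
  (gammahat ^+ 2 * (1 + gammahat) ^+ 2 * expR (4 * gamma * (L%:R + 1)) /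
     alpha ^+ 4) *
  ln (4 * L%:R * q%:R ^+ (2 * L)%N * p%:R ^+ (2 * L - 1)%N / delta).

(* A unit-cost random access machine with arithmetic on naturals and exact real
   arithmetic, in structured form.  A program is uniform: it contains no real
   constants, and gets the problem through its initial store.
   Arrays are named by constants of the program text; indices are computed.
   Subtraction is truncated, and division and modulo are %/ and %%. *)
Inductive nexp : Type :=
  | NConst of nat
  | NGet of nat & nexp
  | NAdd of nexp & nexp
  | NSub of nexp & nexp
  | NMul of nexp & nexp
  | NDiv of nexp & nexp
  | NMod of nexp & nexp.

Inductive rexp : Type :=
  | ROfNat of nexp
  | RGet of nat & nexp
  | RAdd of rexp & rexp
  | RSub of rexp & rexp
  | RMul of rexp & rexp
  | RDiv of rexp & rexp
  | RExp of rexp.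

Inductive test : Type :=
  | NLess of nexp & nexp
  | RLess of rexp & rexp.

Inductive cmd : Type :=
  | CSkip
  | CSetN of nat & nexp & nexp
  | CSetR of nat & nexp & rexp
  | CSeq of cmd & cmd
  | CIf of test & cmd & cmd
  | CWhile of test & cmd.

Record store (R : realType) : Type := Store {
  narr : nat -> nat -> nat;
  rarr : nat -> nat -> R
}.

Fixpoint neval (R : realType) (st : store R) (e : nexp) : nat :=
  match e with
  | NConst k => k
  | NGet a i => narr st a (neval st i)
  | NAdd e1 e2 => (neval st e1 + neval st e2)%N
  | NSub e1 e2 => (neval st e1 - neval st e2)%N
  | NMul e1 e2 => (neval st e1 * neval st e2)%N
  | NDiv e1 e2 => (neval st e1 %/ neval st e2)%N
  | NMod e1 e2 => (neval st e1 %% neval st e2)%N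
  end.

Fixpoint reval (R : realType) (st : store R) (e : rexp) : R :=
  match e with
  | ROfNat i => (neval st i)%:R
  | RGet a i => rarr st a (neval st i)
  | RAdd e1 e2 => reval st e1 + reval st e2
  | RSub e1 e2 => reval st e1 - reval st e2
  | RMul e1 e2 => reval st e1 * reval st e2
  | RDiv e1 e2 => reval st e1 / reval st e2
  | RExp e1 => expR (reval st e1)
  end.

Definition teval (R : realType) (st : store R) (b : test) : bool :=
  match b with
  | NLess e1 e2 => (neval st e1 < neval st e2)%N
  | RLess e1 e2 => reval st e1 < reval st e2
  end.

(* Every arithmetic operation, comparison, memory access and constant has
   cost 1. *)
Fixpoint ncost (e : nexp) : nat :=
  match e with
  | NConst _ => 1
  | NGet _ i => (ncost i).+1
  | NAdd e1 e2 | NSub e1 e2 | NMul e1 e2 | NDiv e1 e2 | NMod e1 e2 =>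
      (ncost e1 + ncost e2).+1
  end.

Fixpoint rcost (e : rexp) : nat :=
  match e with
  | ROfNat i => (ncost i).+1
  | RGet _ i => (ncost i).+1
  | RAdd e1 e2 | RSub e1 e2 | RMul e1 e2 | RDiv e1 e2 =>
      (rcost e1 + rcost e2).+1
  | RExp e1 => (rcost e1).+1
  end.

Definition tcost (b : test) : nat :=
  match b with
  | NLess e1 e2 => (ncost e1 + ncost e2).+1
  | RLess e1 e2 => (rcost e1 + rcost e2).+1
  end.

Definition upd (T : Type) (f : nat -> nat -> T) (a i : nat) (v : T) :
    nat -> nat -> T :=
  fun b j => if (b == a) && (j == i) then v else f b j.

(* exec c st st' k: the program c, started in st, halts in st' after exactly k
   operations. *)
Inductive exec (R : realType) : cmd -> store R -> store R -> nat -> Prop :=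
  | ExecSkip st : exec CSkip st st 1
  | ExecSetN a i e st :
      exec (CSetN a i e) st
        (Store (upd (narr st) a (neval st i) (neval st e)) (rarr st))
        (ncost i + ncost e).+1
  | ExecSetR a i e st :
      exec (CSetR a i e) st
        (Store (narr st) (upd (rarr st) a (neval st i) (reval st e)))
        (ncost i + rcost e).+1
  | ExecSeq c1 c2 st st1 st2 k1 k2 :
      exec c1 st st1 k1 -> exec c2 st1 st2 k2 ->
      exec (CSeq c1 c2) st st2 (k1 + k2)%N
  | ExecIfTrue b c1 c2 st st' k :
      teval st b -> exec c1 st st' k ->
      exec (CIf b c1 c2) st st' (tcost b + k).+1
  | ExecIfFalse b c1 c2 st st' k :
      ~~ teval st b -> exec c2 st st' k ->
      exec (CIf b c1 c2) st st' (tcost b + k).+1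
  | ExecWhileFalse b c st :
      ~~ teval st b -> exec (CWhile b c) st st (tcost b).+1
  | ExecWhileTrue b c st st1 st2 k1 k2 :
      teval st b -> exec c st st1 k1 -> exec (CWhile b c) st1 st2 k2 ->
      exec (CWhile b c) st st2 (tcost b + k1 + k2).+1.

(* Input: natural array 0 holds p, L, n; array 1 holds the alphabet sizes;
   array 2 holds the letter of sample m at vertex i in cell m * p + i; real
   array 0 holds alpha, gammahat, eps.  All other cells are 0. *)
Definition suprise_input (R : realType) p (qs : 'I_p -> nat) (L n : nat)
    (w : {ffun 'I_n -> config qs}) (alpha gammahat eps : R) : store R :=
  Store
    (fun a j =>
       match a with
       | 0%N => nth 0%N [:: p; L; n] j
       | 1%N => nth 0%N [seq qs i | i <- enum 'I_p] j
       | 2%N => nth 0%N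
                  [seq nat_of_ord (w m i) | m <- enum 'I_n, i <- enum 'I_p] j
       | _ => 0%N
       end)
    (fun a j =>
       match a with
       | 0%N => nth 0 [:: alpha; gammahat; eps] j
       | _ => 0
       end).

(* {i_1 < ... < i_k} is coded by the number with the base-(p+1) digits
   i_1 + 1, ..., i_k + 1, least significant first. *)
Definition set_code p (c : {set 'I_p}) : nat :=
  foldr (fun (i : 'I_p) k => i.+1 + p.+1 * k)%N 0%N (enum c).

(* As set_code, with the letter s_i interleaved after each vertex i; letters are
   digits in base max_i qs i. *)
Definition factor_code p (qs : 'I_p -> nat) (r : {set 'I_p})
    (s : letters qs r) : nat :=
  foldr (fun (i : {i : 'I_p | i \in r}) k =>
           (val i).+1 + p.+1 * (s i + (\max_(j < p) qs j) * k))%N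
    0%N (enum {: {i : 'I_p | i \in r}}).

(* The final store records the whole run, and not only its output: natural
   array 3 holds the indicator of the output family, natural array 4 those of
   the families R^t, and real array 1 all the estimates. *)
Definition decode_output (R : realType) p (L : nat) (st : store R) :
    {set {set 'I_p}} :=
  [set c in factor_sets p L | narr st 3 (set_code c) != 0%N].

Definition decode_families (R : realType) p (L : nat) (st : store R) (t : nat) :
    {set {set 'I_p}} :=
  [set c in factor_sets p L | narr st 4 (set_code c * L.+1 + t) != 0%N].

Definition decode_estimates (R : realType) p (qs : 'I_p -> nat) (L : nat)
    (st : store R) (t : nat) (u : 'I_p) : param R qs :=
  fun r s => rarr st 1 ((factor_code s * p + u) * L + t).

(* Main.v *)
(** Recovery.  At a vertex u of a maximal set c of R^t, resampling the vertices
    of c one after the other bounds the second moment of the local energy of an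
    error D from below by a constant times the squared l2 norm of D on c.  Since
    [expR (- z) - 1 + z >= z ^+ 2 / (2 + `|z|)], the excess of the screening
    objective at D controls the empirical second moment of that energy up to the
    empirical gradient at theta, which has mean zero.  By Bernstein's inequality
    and a union bound, gradients and second moments concentrate simultaneously at
    all vertices; then all averaged estimates on maximal sets have l2 error below
    alpha / 2, so that round t removes exactly the maximal sets outside the
    support of theta.

    Complexity.  The feasible set is, up to gammahat, the convex hull of the l1
    balls of centered arrays on the single sets r.  A greedy Frank-Wolfe method,
    whose step adds the best atom of a finite net of these balls, reaches the
    tolerance after a number K of steps that does not depend on p.  A step tries
    boundedly many atoms on each of at most (p + 1)^L sets and evaluates each on
    the n = O(log p) samples. *)
Require Import Defs.
From mathcomp Require Import all_boot all_order all_algebra.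
From mathcomp Require Import all_classical all_reals all_analysis.
From mathcomp Require Import zify ring lra.
Set Implicit Arguments.
Unset Strict Implicit.
Unset Printing Implicit Defensive.
Import Order.TTheory GRing.Theory Num.Theory.
Import numFieldNormedType.Exports.
Local Open Scope ring_scope.

(** * Centered arrays and basis functions *)

(** The tolerance contains [rho_NPC], a minimum over the whole model, whereas the sample bound and
    the number of greedy steps may depend only on [gamma], [q], [L] and the given norms. Hence the
    marginal bound [expR (- (2 * gamma)) / q], which replaces [rho_NPC] in [floor_npc] and
    [eps_floor]. If no factor set carries a nonzero centered array, [rho_NPC] is infinite, the
    tolerance is 0 and zero is the only feasible point; this case is carried along separately.

    Concentration is asked of the gradient at [theta] and of the products of basis functions,
    coordinate by coordinate. Duality with the l1 norm extends it to every error, so one event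
    serves all rounds and all choices of minimizers.

    In units of the lower bound of the second moment, the tolerance costs [alpha ^ 2 / 10] and the
    two deviations [alpha ^ 2 / 16] each, together less than [alpha ^ 2 / 4]. The denominators 64
    that this requires meet the 4 of Bernstein's exponent in [64 ^ 2 * 4 = 2 ^ 14].

    The complexity claim concerns every sample, so the program must produce a genuine run by
    deterministic minimization. *)

Section DepFun.
Variables (R : realType) (I : finType) (T : I -> finType).
Local Notation cfg := {dffun forall i : I, T i}.
Implicit Types (s : cfg) (F : cfg -> R).

Definition updf s i (v : T i) : cfg := [ffun j => eqtype.dfwith s v j].

Lemma updf_in s i (v : T i) : updf s v i = v.
Proof. by rewrite ffunE dfwith_in. Qed.

Lemma updf_out s i (v : T i) j : j != i -> updf s v j = s j.
Proof. by move=> ji; rewrite ffunE dfwith_out // eq_sym. Qed.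

Lemma agree_updf s i (v : T i) :
  [forall j, (j != i) ==> (updf s v j == s j)].
Proof. by apply/forallP => j; apply/implyP => ji; rewrite updf_out. Qed.

Lemma sum_fiber s i F :
  \sum_(s' : cfg | [forall j, (j != i) ==> (s' j == s j)]) F s' =
  \sum_(a : T i) F (updf s a).
Proof.
rewrite (reindex_onto (fun a => updf s a) (fun s' : cfg => s' i)) /=.
  by apply: eq_bigl => a; rewrite updf_in eqxx andbT agree_updf.
move=> s' /forallP h; apply/ffunP => j.
have [->|ji] := eqVneq j i; first by rewrite updf_in.
by rewrite updf_out //; apply/esym/eqP; have := h j; rewrite ji.
Qed.

(** The first hypothesis makes [P] a union of lines in direction [i], so the sum splits into whole
    lines. In this form a centered factor annihilates whatever does not depend on its variable. *)
Lemma sum_fibers0 i (P : pred cfg) F :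
  (forall s s', (forall j, j != i -> s' j = s j) -> P s' = P s) ->
  (forall s, P s ->
     \sum_(s' : cfg | [forall j, (j != i) ==> (s' j == s j)]) F s' = 0) ->
  \sum_(s | P s) F s = 0.
Proof.
move=> invP fib0.
pose cls s := [set s' : cfg | [forall j, (j != i) ==> (s' j == s j)]].
rewrite (partition_big cls predT) //= big1 // => S _.
have [s0 /andP[Ps0 /eqP <-]|] := pickP (fun s => P s && (cls s == S)); last first.
  by move=> h; rewrite big_pred0.
rewrite -[RHS](fib0 s0 Ps0); apply: eq_bigl => s.
have clsE : (cls s == cls s0) = [forall j, (j != i) ==> (s j == s0 j)].
  apply/eqP/forallP => [e | h].
    have : s \in cls s0 by rewrite -e inE; apply/forallP => j; rewrite eqxx implybT.
    by rewrite inE => /forallP.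
  apply/setP => s'; rewrite !inE; apply: eq_forallb => j.
  by have [//|ji] := eqVneq j i; have := h j; rewrite ji /= => /eqP ->.
rewrite clsE; apply/andP/idP => [[]//|h]; split => //.
rewrite (invP s0 s) // => j ji; apply/eqP.
by move/forallP: h => /(_ j); rewrite ji.
Qed.

End DepFun.

Section Model.
Variables (R : realType) (p : nat) (qs : 'I_p -> nat).
Implicit Types (r c : {set 'I_p}) (u : 'I_p) (sigma : config qs)
  (theta : param R qs).

Lemma ci_norm_le1 k (a b : 'I_k) : `|centered_indicator R a b| <= 1.
Proof.
have k0 : 0 <= (k%:R^-1 : R) by rewrite invr_ge0 ler0n.
have k1 : (k%:R^-1 : R) <= 1.
  by rewrite invf_le1 ?ltr0n ?ler1n; case: k a b k0 => [[]|].
rewrite /centered_indicator; case: ifP => _; rewrite ler_norml; lra.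
Qed.

Lemma sum_ci k (b : 'I_k) : \sum_(a : 'I_k) centered_indicator R a b = 0.
Proof.
have k0 : (k%:R : R) != 0 by rewrite pnatr_eq0; case: k b => [[]|].
rewrite (eq_bigr (fun a => (a == b)%:R - k%:R^-1)); last first.
  by move=> a _; rewrite /centered_indicator eq_sym; case: eqP => //; rewrite sub0r.
rewrite sumrB (bigD1 b) //= eqxx big1 ?addr0; last by move=> a /negbTE ->.
by rewrite sumr_const card_ord -[X in _ - X]mulr_natr mulVf // subrr.
Qed.

Lemma ci_sym k (a b : 'I_k) :
  centered_indicator R a b = centered_indicator R b a.
Proof. by rewrite /centered_indicator eq_sym. Qed.

Lemma basis_norm_le1 r (s : letters qs r) sigma : `|basis_fun R s sigma| <= 1.
Proof.
rewrite /basis_fun normr_prod.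
by apply: prodr_ile1 => i _; rewrite normr_ge0 ci_norm_le1.
Qed.

Definition restr sigma r : letters qs r := [ffun i => sigma (val i)].

Definition glue r (s : letters qs r) sigma : config qs :=
  [ffun j => match boolP (j \in r) with
             | AltTrue h => s (exist _ j h)
             | _ => sigma j
             end].

Lemma glue_in r (s : letters qs r) sigma (j : {i | i \in r}) :
  glue s sigma (val j) = s j.
Proof.
rewrite ffunE; case: j => j hj /=.
case: {-}_ / boolP => [h|]; last by rewrite hj.
by rewrite (bool_irrelevance h hj).
Qed.

Lemma glue_out r (s : letters qs r) sigma j :
  j \notin r -> glue s sigma j = sigma j.
Proof. by move=> hj; rewrite ffunE; case: {-}_ / boolP => // h; rewrite h in hj. Qed.

(** Outside [r] the configurations of the sum coincide with [sigma], because [A] lies in [r]; gluing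
    onto [sigma] therefore inverts the restriction. *)
Lemma sum_restr r (A : {set 'I_p}) sigma (F : letters qs r -> R) :
  A \subset r ->
  \sum_(sigma' : config qs | [forall j, (j \notin A) ==> (sigma' j == sigma j)])
     F (restr sigma' r) =
  \sum_(s : letters qs r |
      [forall j, (val j \notin A) ==> (s j == sigma (val j))]) F s.
Proof.
move=> Ar.
rewrite (reindex_onto (fun s => glue s sigma) (fun sigma' => restr sigma' r)) /=.
  have glueK s : restr (glue s sigma) r = s.
    by apply/ffunP => j; rewrite ffunE glue_in.
  apply: eq_big => [s|s _]; rewrite glueK ?eqxx ?andbT //.
  apply/forallP/forallP => h j.
    by have := h (val j); rewrite glue_in.
  have [hj|hj] := boolP (j \in r).
    by have := h (exist _ j hj); rewrite -(glue_in s sigma).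
  by rewrite glue_out // eqxx implybT.
move=> s' /forallP h; apply/ffunP => j.
have [hj|hj] := boolP (j \in r).
  by rewrite -[j]/(val (exist (fun i => i \in r) j hj)) glue_in ffunE.
rewrite glue_out //; apply/esym/eqP.
have := h j; suff -> : j \notin A by [].
by apply: contra hj; apply: (fintype.subsetP Ar).
Qed.

Lemma centered_sum0 r (x : letters qs r -> R) (i : {i | i \in r})
    (g : letters qs r -> R) :
  centered x ->
  (forall s s' : letters qs r, (forall j, j != i -> s' j = s j) -> g s' = g s) ->
  \sum_s x s * g s = 0.
Proof.
move=> cx gi; apply: (@sum_fibers0 R _ _ i predT) => // s _.
rewrite (eq_bigr (fun s' => x s' * g s)) -?mulr_suml ?cx ?mul0r // => s' /forallP h.
congr (_ * _); apply: gi => j ji; apply/eqP; by have := h j; rewrite ji.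
Qed.

(** On a centered array the constant [- 1 / q_i] in the factor at [i] is invisible, since nothing
    else in the product depends on the letter at [i]. Each factor can thus be replaced by an
    indicator, and the product of the indicators selects one entry. *)
Lemma centered_lookup r (x : letters qs r -> R) sigma :
  centered x -> \sum_(s : letters qs r) x s * basis_fun R s sigma = x (restr sigma r).
Proof.
move=> cx.
pose ind (i : {i | i \in r}) (s : letters qs r) : R := (s i == sigma (val i))%:R.
pose phi (i : {i | i \in r}) (s : letters qs r) : R :=
  centered_indicator R (s i) (sigma (val i)).
(* The factors are replaced one vertex at a time: [l1] lists the vertices that already carry
   indicators, [l2] those that still carry centered ones. *)
suff H (l1 l2 : seq {i | i \in r}) : uniq (l1 ++ l2) ->
    \sum_s x s * ((\prod_(i <- l1) ind i s) * \prod_(i <- l2) phi i s) =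
    \sum_s x s * \prod_(i <- l1 ++ l2) ind i s.
  have := H [::] (index_enum _) (index_enum_uniq _).
  under eq_bigr do rewrite big_nil mul1r.
  move=> ->; rewrite (bigD1 (restr sigma r)) //= big1 ?mulr1; last first.
    by move=> i _; rewrite /ind ffunE eqxx.
  rewrite big1 ?addr0 // => s sne.
  have [i hi|h] := pickP (fun i => s i != sigma (val i)).
    by rewrite (bigD1 i) //= /ind (negbTE hi) mul0r mulr0.
  by case/eqP: sne; apply/ffunP => i; rewrite ffunE; have /negbFE/eqP := h i.
elim: l2 l1 => [|i l2 IH] l1 U.
  by under eq_bigr do rewrite big_nil mulr1; rewrite cats0.
rewrite -cat_rcons -IH ?cat_rcons //.
have il1 : i \notin l1.
  by move: U; rewrite cat_uniq => /and3P[_ /hasPn /(_ i (mem_head _ _))].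
have il2 : i \notin l2.
  by move: U; rewrite cat_uniq /= => /and3P[_ _ /andP[]].
pose g s := (\prod_(j <- l1) ind j s) * \prod_(j <- l2) phi j s.
have g0 : \sum_s x s * g s = 0.
  apply: (centered_sum0 (i := i)) => // s s' h; congr (_ * _).
    rewrite big_seq [RHS]big_seq; apply: eq_bigr => j jl; rewrite /ind h //.
    by apply: contraNneq il1 => <-.
  rewrite big_seq [RHS]big_seq; apply: eq_bigr => j jl; rewrite /phi h //.
  by apply: contraNneq il2 => <-.
rewrite -[RHS]subr0 -[X in _ - X](mulr0 (qs (val i))%:R^-1).
rewrite -[X in _ - _ * X]g0 mulr_sumr -sumrB.
apply: eq_bigr => s _; rewrite big_cons -cats1 big_cat big_seq1 /= /g.
have -> : phi i s = ind i s - (qs (val i))%:R^-1.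
  by rewrite /phi /ind /centered_indicator eq_sym; case: eqP => // _; rewrite sub0r.
by ring.
Qed.

Lemma local_energy_bound L theta u sigma :
  `|local_energy L theta u sigma| <= l1norm L u theta.
Proof.
apply: (le_trans (ler_norm_sum _ _ _)); apply: ler_sum => r _.
apply: (le_trans (ler_norm_sum _ _ _)); apply: ler_sum => s _.
by rewrite normrM ler_piMr ?basis_norm_le1.
Qed.

End Model.

(** * The Gibbs measure *)

Section Gibbs.
Variables (R : realType) (p : nat) (qs : 'I_p -> nat) (L : nat).
Variable theta : param R qs.
Arguments theta : clear implicits.
Implicit Types (r c : {set 'I_p}) (u : 'I_p) (sigma : config qs).
Local Notation gamma := (interaction_strength L theta).
Local Notation mu := (mu_general L theta).

Lemma local_energy_le_strength u sigma :
  `|local_energy L theta u sigma| <= gamma.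
Proof.
by apply: (bigmax_sup u) => //; apply: (bigmax_sup sigma).
Qed.

Lemma strength_ge0 : 0 <= gamma.
Proof. exact: bigmax_ge_id. Qed.

Lemma basis_fun_eq (r : {set 'I_p}) (s : letters qs r) sigma sigma' :
  (forall j, j \in r -> sigma' j = sigma j) ->
  basis_fun R s sigma' = basis_fun R s sigma.
Proof. by move=> h; apply: eq_bigr => i _; rewrite h // (valP i). Qed.

Lemma energy_split u sigma :
  energy L theta sigma = local_energy L theta u sigma +
    \sum_(r in factor_sets p L | u \notin r) \sum_(s : letters qs r)
      theta r s * basis_fun R s sigma.
Proof. exact: bigID. Qed.

Lemma energy_rest_eq u sigma sigma' : (forall j, j != u -> sigma' j = sigma j) ->
  \sum_(r in factor_sets p L | u \notin r) \sum_(s : letters qs r)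
      theta r s * basis_fun R s sigma' =
  \sum_(r in factor_sets p L | u \notin r) \sum_(s : letters qs r)
      theta r s * basis_fun R s sigma.
Proof.
move=> h; apply: eq_bigr => r /andP[_ ur]; apply: eq_bigr => s _.
by rewrite (@basis_fun_eq r s sigma) // => j jr; apply: h; apply: contraNneq ur => <-.
Qed.

(** Changing the letter of a single vertex affects only the sets through it, hence a difference of
    two local energies, each at most [gamma] in absolute value. The vertices of [l] are changed one
    after the other. *)
Lemma energy_agree (l : seq 'I_p) sigma sigma' :
  (forall j, j \notin l -> sigma' j = sigma j) ->
  energy L theta sigma <= energy L theta sigma' + 2 * gamma * (size l)%:R.
Proof.
elim: l sigma => [|u l IH] sigma h /=.
  have -> : sigma' = sigma by apply/ffunP => j; apply: h.
  by rewrite mulr0 addr0.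
pose tau := updf sigma (sigma' u).
have le1 : energy L theta tau <= energy L theta sigma' + 2 * gamma * (size l)%:R.
  apply: IH => j jl; have [->|ju] := eqVneq j u; first by rewrite updf_in.
  by rewrite updf_out // h // inE negb_or ju.
move: le1; rewrite -(natr1 (size l)) (energy_split u sigma) (energy_split u tau) mulrDr mulr1.
rewrite (energy_rest_eq (u := u) (sigma := sigma)) => [|j ju]; last by rewrite updf_out.
have /ler_normlP[_ a] := local_energy_le_strength u sigma.
have /ler_normlP[b _] := local_energy_le_strength u tau.
lra.
Qed.

Lemma mu_agree (A : {set 'I_p}) sigma sigma' :
  (forall j, j \notin A -> sigma' j = sigma j) ->
  expR (- (2 * gamma * #|A|%:R)) * mu sigma <= mu sigma'.
Proof.
move=> h; rewrite /mu_general mulrA; apply: ler_wpM2r.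
  by rewrite invr_ge0; apply: sumr_ge0 => s _; apply: expR_ge0.
rewrite -expRD ler_expR addrC lerBlDr cardE.
by apply: energy_agree => j jA; apply: h; rewrite mem_enum in jA.
Qed.

Hypothesis qpos : forall i, (0 < qs i)%N.

Lemma partition_gt0 : 0 < partition_function L theta.
Proof.
rewrite /partition_function (bigD1 ([ffun i => Ordinal (qpos i)] : config qs)) //=.
by apply: ltr_wpDr; [apply: sumr_ge0 => s _; apply: expR_ge0 | apply: expR_gt0].
Qed.

Lemma mu_gt0 sigma : 0 < mu sigma.
Proof. by rewrite divr_gt0 ?expR_gt0 ?partition_gt0. Qed.

Lemma mu_ge0 sigma : 0 <= mu sigma.
Proof. exact/ltW/mu_gt0. Qed.

Lemma sum_mu : \sum_sigma mu sigma = 1.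
Proof. by rewrite -mulr_suml divff // gt_eqF ?partition_gt0. Qed.

Variable q : nat.
Hypothesis qle : forall i, (qs i <= q)%N.

Lemma card_agree (A : {set 'I_p}) sigma :
  (#|[pred s : config qs | [forall j, (j \notin A) ==> (s j == sigma j)]]|
     <= q ^ #|A|)%N.
Proof.
pose f (s : config qs) : {ffun {i : 'I_p | i \in A} -> 'I_q} :=
  [ffun i => widen_ord (qle (val i)) (s (val i))].
have -> : (q ^ #|A| = #|{: {ffun {i : 'I_p | i \in A} -> 'I_q}}|)%N.
  by rewrite card_ffun card_ord card_sig.
rewrite -(card_in_image (f := f)) ?max_card // => s s' /forallP hs /forallP hs' /ffunP e.
apply/ffunP => j; have [jA|jA] := boolP (j \in A); last first.
  by have := hs j; have := hs' j; rewrite jA /= => /eqP -> /eqP ->.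
by apply/val_inj; have := congr1 val (e (exist _ j jA)); rewrite !ffunE.
Qed.

Lemma q_gt0 u : (0 < q)%N.
Proof. exact: leq_trans (qpos u) (qle u). Qed.

(** Each of the at most [q ^ #|A|] configurations of the fiber has a weight comparable to that of
    [sigma] by [mu_agree]. So the weights may be replaced by fiber sums at the price of a constant
    factor. *)
Lemma mu_fiber (A : {set 'I_p}) (sigma : config qs) :
  (0 < q)%N ->
  expR (- (2 * gamma * #|A|%:R)) / q%:R ^+ #|A| *
   (\sum_(s : config qs | [forall j, (j \notin A) ==> (s j == sigma j)]) mu s)
  <= mu sigma.
Proof.
move=> q0; have qA0 : 0 < (q%:R ^+ #|A| : R) by rewrite exprn_gt0 ?ltr0n.
rewrite mulrAC ler_pdivrMr // mulr_sumr.
apply: (@le_trans _ _ (\sum_(s : config qs |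
   [forall j, (j \notin A) ==> (s j == sigma j)]) mu sigma)).
  apply: ler_sum => s /forallP h; apply: mu_agree => j jA.
  by apply/esym/eqP; have := h j; rewrite jA.
rewrite sumr_const -[X in X <= _]mulr_natr ler_wpM2l ?mu_ge0 // -natrX ler_nat.
exact: card_agree.
Qed.

Lemma npc_lower (Rt : {set {set 'I_p}}) (D : param R qs) u c :
  (0 < q)%N -> Rt \subset factor_sets p L ->
  (forall r, r \in factor_sets p L -> u \in r -> centered (D r)) ->
  (forall r, r \in factor_sets p L -> u \in r -> r \notin Rt -> forall s, D r s = 0) ->
  c \in maximal_sets Rt -> u \in c ->
  expR (- (2 * gamma * #|c :\ u|%:R)) / q%:R ^+ #|c :\ u| *
    npc_numerator L theta u (D c) <=
  \sum_sigma mu sigma * local_energy L D u sigma ^+ 2.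
Proof.
move=> q0 RtF cD D0; rewrite inE => /maxsetP[cRt cmax] uc.
have cF : c \in factor_sets p L by apply: (fintype.subsetP RtF).
set A := c :\ u; set k := _ / _.
have k0 : 0 <= k by rewrite divr_ge0 ?expR_ge0 ?exprn_ge0 ?ler0n.
pose ag (s s' : config qs) := [forall j, (j \notin A) ==> (s' j == s j)].
have agC s s' : ag s s' = ag s' s.
  by apply: eq_forallb => j; rewrite eq_sym.
have E sigma : local_energy L D u sigma =
    \sum_(r in factor_sets p L | u \in r) D r (restr sigma r).
  by apply: eq_bigr => r /andP[rF ur]; rewrite centered_lookup //; apply: cD.
(* The weights are replaced by fiber sums and the double sum is exchanged, so that [mu] weights the
   outer configuration while the letters of [A] are summed freely. *)
apply: (@le_trans _ _ (\sum_s' local_energy L D u s' ^+ 2 *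
    (k * \sum_(s | ag s' s) mu s))); last first.
  apply: ler_sum => s _; rewrite mulrC; apply: ler_wpM2r; first exact: sqr_ge0.
  exact: mu_fiber.
have -> : \sum_s' local_energy L D u s' ^+ 2 * (k * \sum_(s | ag s' s) mu s) =
   k * \sum_s mu s * \sum_(s' | ag s s') local_energy L D u s' ^+ 2.
  under eq_bigr do rewrite mulrCA mulr_sumr.
  rewrite -mulr_sumr; congr (_ * _).
  under [RHS]eq_bigr do rewrite mulr_sumr.
  rewrite (exchange_big_dep predT) //=; apply: eq_bigr => s _.
  by apply: eq_big => s'; rewrite ?(agC s) // => _; rewrite mulrC.
rewrite ler_wpM2l //; apply: ler_sum => sigma _; rewrite ler_wpM2l ?mu_ge0 //.
have -> : \sum_(s : letters qs c | [forall j, (val j == u) ==> (s j == sigma (val j))])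
            D c s ^+ 2 = \sum_(s' | ag sigma s') D c (restr s' c) ^+ 2.
  rewrite (@sum_restr _ _ _ c A sigma (fun s => D c s ^+ 2)) ?subsetDl //.
  apply: eq_bigl => s; apply: eq_forallb => j.
  by rewrite !inE (valP j) andbT negbK.
pose G s := \sum_(r in factor_sets p L | (u \in r) && (r != c)) D r (restr s r).
have EG s : local_energy L D u s = D c (restr s c) + G s.
  rewrite E (bigD1 c) ?cF //=; congr (_ + _).
  by apply: eq_bigl => r; rewrite andbA.
(* A set [r] through [u] other than [c] misses some [i] of [c], and [i] differs from [u], hence is a
   free variable. Summing over its letter kills the entry of [D c] and leaves the entry of [D r]
   unchanged. *)
have orth : \sum_(s' | ag sigma s') D c (restr s' c) * G s' = 0.
  under eq_bigr do rewrite mulr_sumr.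
  rewrite exchange_big /= big1 // => r /andP[rF /andP[ur rc]].
  have [rRt|rRt] := boolP (r \in Rt); last first.
    by rewrite big1 // => s _; rewrite (D0 r) // mulr0.
  have [i ic ir] : exists2 i, i \in c & i \notin r.
    apply/subsetPn; apply: contraNN rc => cr; apply/eqP; exact: cmax.
  have iA : i \in A by rewrite !inE ic andbT; apply: contraNneq ir => ->.
  apply: (sum_fibers0 (i := i)) => [s s' h|s _].
    apply: eq_forallb => j; have [->|ji] := eqVneq j i; first by rewrite iA.
    by rewrite h.
  rewrite (eq_bigr (fun s' => D c (restr s' c) * D r (restr s r))); last first.
    move=> s' /forallP h; congr (_ * D r _); apply/ffunP => j; rewrite !ffunE.
    apply/eqP; have := h (val j); case: eqVneq => //= ji.
    by rewrite -ji (valP j) in ir.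
  rewrite -mulr_suml.
  have -> : \sum_(s' : config qs | [forall j, (j != i) ==> (s' j == s j)])
       D c (restr s' c) = 0; last by rewrite mul0r.
  rewrite -[RHS](@cD c cF uc (exist _ i ic) (restr s c)).
  transitivity (\sum_(s' : letters qs c |
      [forall j, (val j \notin [set i]) ==> (s' j == s (val j))]) D c s').
    rewrite -(@sum_restr _ _ _ c [set i] s) ?finset.sub1set //.
    by apply: eq_bigl => s'; apply: eq_forallb => j; rewrite inE.
  by apply: eq_bigl => s'; apply: eq_forallb => j; rewrite inE ffunE.
have -> : \sum_(s' | ag sigma s') local_energy L D u s' ^+ 2 =
   \sum_(s' | ag sigma s') D c (restr s' c) ^+ 2 + \sum_(s' | ag sigma s') G s' ^+ 2.
  transitivity (\sum_(s' | ag sigma s') D c (restr s' c) ^+ 2 +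
    (\sum_(s' | ag sigma s') D c (restr s' c) * G s') *+ 2 +
    \sum_(s' | ag sigma s') G s' ^+ 2); last by rewrite orth mul0rn addr0.
  by rewrite -sumrMnl -!big_split; apply: eq_bigr => s _; rewrite EG sqrrD.
by rewrite lerDl; apply: sumr_ge0 => s _; exact: sqr_ge0.
Qed.

(** Forcing the letter at [u] to be [a] loses at most the factor [expR (- (2 * gamma))] of the
    weight, and at most [q] configurations are sent to the same one. *)
Lemma marginal_lower u (a : 'I_(qs u)) :
  expR (- (2 * gamma)) / q%:R <= \sum_(sigma : config qs | sigma u == a) mu sigma.
Proof.
have q0 := q_gt0 u.
rewrite ler_pdivrMr ?ltr0n //.
have -> : expR (- (2 * gamma)) = expR (- (2 * gamma)) * \sum_sigma mu sigma.
  by rewrite sum_mu mulr1.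
rewrite mulr_sumr.
apply: (@le_trans _ _ (\sum_sigma mu (updf sigma a))).
  apply: ler_sum => s _.
  have := @mu_agree [set u] s (updf s a); rewrite cards1 mulr1; apply => j.
  by rewrite inE => ju; rewrite updf_out.
rewrite (partition_big (fun s => updf s a) (fun s : config qs => s u == a)) /=; last first.
  by move=> s _; rewrite updf_in.
rewrite mulr_suml; apply: ler_sum => s /eqP su.
apply: (@le_trans _ _ (\sum_(i : config qs | updf i a == s) mu s)).
  by apply: ler_sum => i /eqP ->.
rewrite sumr_const -[X in X <= _]mulr_natr ler_wpM2l ?mu_ge0 // ler_nat.
apply: leq_trans (_ : q ^ #|[set u]| <= q)%N; last by rewrite cards1.
apply: leq_trans (card_agree [set u] s); apply: subset_leq_card.
apply/fintype.subsetP => i hi; have /eqP es : updf i a == s := hi.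
change (is_true [forall j, (j \notin [set u]) ==> (i j == s j)]).
apply/forallP => j; rewrite inE; apply/implyP => ju.
by rewrite -es updf_out.
Qed.

(** After an exchange of the sums, the entry at [s] is weighted by the probability that [u] carries
    its letter in [s]. *)
Lemma npc_numerator_lower u r (x : letters qs r -> R) : u \in r ->
  expR (- (2 * gamma)) / q%:R * (\sum_s x s ^+ 2) <= npc_numerator L theta u x.
Proof.
move=> ur; rewrite /npc_numerator; under [leRHS]eq_bigr do rewrite mulr_sumr.
rewrite (exchange_big_dep predT) //= mulr_sumr; apply: ler_sum => s _.
rewrite -mulr_suml ler_wpM2r ?sqr_ge0 //.
apply: (le_trans (marginal_lower (s (exist _ u ur)))).
rewrite le_eqVlt; apply/orP; left; apply/eqP; apply: eq_bigl => sigma.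
apply/eqP/forallP => [e j|/(_ (exist _ u ur))/=]; last by rewrite eqxx => /eqP.
apply/implyP => ju; have -> : j = exist _ u ur by apply/val_inj/eqP.
by rewrite /= e.
Qed.

(** One nonzero centered array makes [rho_NPC] finite: its own quotient bounds it from above, the
    marginals bound it from below. Only then does [fine] return the actual minimum. *)
Lemma rho_bounds u r (x : letters qs r -> R) :
  r \in factor_sets p L -> u \in r -> centered x -> (exists s, x s != 0) ->
  expR (- (2 * gamma)) / q%:R <= fine (rho_NPC L theta) /\
  fine (rho_NPC L theta) * (\sum_s x s ^+ 2) <= npc_numerator L theta u x.
Proof.
move=> rF ur cx xn0.
have sq0 (r' : {set 'I_p}) (y : letters qs r' -> R) : (exists s, y s != 0) -> 0 < \sum_s y s ^+ 2.
  move=> [s ys]; rewrite (bigD1 s) //=; apply: ltr_wpDr.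
    by apply: sumr_ge0 => ? _; apply: sqr_ge0.
  by rewrite exprn_even_gt0.
have lo : ((expR (- (2 * gamma)) / q%:R)%:E <= rho_NPC L theta)%E.
  apply: le_bigmin; first by rewrite leey.
  move=> v _; apply: le_bigmin; first by rewrite leey.
  move=> r' /andP[r'F vr']; apply: le_ereal_inf_tmp => _ [y [cy yn0] <-].
  by rewrite lee_fin ler_pdivlMr ?sq0 // npc_numerator_lower.
have hi : (rho_NPC L theta <= (npc_numerator L theta u x / \sum_s x s ^+ 2)%:E)%E.
  apply: (bigmin_inf u) => //; apply: (bigmin_inf r); rewrite ?rF //.
  by apply: ge_ereal_inf; eexists; last exact: lexx; exists x.
have fin : rho_NPC L theta \is a fin_num.
  rewrite fin_numE; apply/andP; split; apply/eqP => e; move: lo hi; rewrite e //.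
split; first by rewrite -lee_fin fineK.
by rewrite -ler_pdivlMr ?sq0 // -lee_fin fineK.
Qed.

(** The screening effect: the exponential cancels from the Gibbs weight exactly the sets through
    [u]. What remains does not see the letter at [u], over which the basis function sums to zero. *)
Lemma gradient_mean0 u r (s : letters qs r) : u \in r ->
  \sum_sigma mu sigma * (expR (- local_energy L theta u sigma) * basis_fun R s sigma) = 0.
Proof.
move=> ur.
pose rest sigma := \sum_(r in factor_sets p L | u \notin r) \sum_(s : letters qs r)
      theta r s * basis_fun R s sigma.
rewrite (eq_bigr (fun sigma => (partition_function L theta)^-1 *
    (expR (rest sigma) * basis_fun R s sigma))); last first.
  move=> sigma _; rewrite /mu_general (energy_split u) expRD expRN -/(rest sigma).
  have : expR (local_energy L theta u sigma) != 0 by rewrite gt_eqF ?expR_gt0.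
  by move=> h; field; rewrite h gt_eqF ?partition_gt0.
rewrite -mulr_sumr [X in _ * X](@sum_fibers0 R _ _ u predT) ?mulr0 // => sigma _.
pose u' : {i | i \in r} := exist _ u ur.
rewrite sum_fiber.
rewrite (eq_bigr (fun a => expR (rest sigma) *
   (\prod_(i | i != u') centered_indicator R (s i) (sigma (val i))) *
   centered_indicator R (s u') a)).
  rewrite -mulr_sumr (eq_bigr (fun a => centered_indicator R a (s u'))).
    by rewrite sum_ci mulr0.
  by move=> a _; rewrite ci_sym.
move=> a _; rewrite -mulrA; congr (expR _ * _).
  by apply: energy_rest_eq => j ju; rewrite updf_out.
rewrite /basis_fun (bigD1 u') //= updf_in mulrC; congr (_ * _).
by apply: eq_bigr => i iu; rewrite updf_out.
Qed.

End Gibbs.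

(** * Exponential inequalities *)

Section Inequalities.
Variable R : realType.
Implicit Types x z : R.

Lemma le_of_derive_ge0 (f df : R -> R) (a b : R) : a <= b ->
  (forall x, is_derive x 1 f (df x)) ->
  (forall x, a <= x -> x <= b -> 0 <= df x) -> f a <= f b.
Proof.
move=> ab fd dge.
have [c] := MVT_segment ab (fun x _ => fd x)
  (derivable_within_continuous (fun x _ => @ex_derive _ _ _ _ _ _ _ (fd x))).
rewrite in_itv /= => /andP[ac cb] e; rewrite -subr_ge0 e mulr_ge0 ?dge ?subr_ge0 //.
Qed.

(** The function [(1 + y + y ^ 2) * expR (- y)] has derivative [y * (1 - y) * expR (- y)], so on
    [y <= 1] its minimum is the value 1 at 0. *)
Lemma expR_le_quadratic x : x <= 1 -> expR x <= 1 + x + x ^+ 2.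
Proof.
move=> x1.
pose f (y : R) : R := (1 + y + y ^+ 2) * expR (- y).
pose df (y : R) : R := y * (1 - y) * expR (- y).
have fd (y : R) : is_derive y 1 f (df y).
  apply: is_derive_eq.
  by rewrite /df /GRing.scale /=; ring.
have f0 : f 0 = 1 by rewrite /f oppr0 expR0; ring.
suff : 1 <= f x by rewrite /f expRN ler_pdivlMr ?expR_gt0 // mul1r.
rewrite -f0; have [x0|x0] := leP 0 x.
  apply: (le_of_derive_ge0 x0 fd) => y y0 yx.
  by rewrite !mulr_ge0 ?expR_ge0 // subr_ge0 (le_trans yx).
pose g y := - f y; rewrite -lerN2 -/(g 0) -/(g x).
apply: (@le_of_derive_ge0 g (fun y => - df y) _ _ (ltW x0)) => y xy y0.
rewrite /df -!mulNr !mulr_ge0 ?expR_ge0 ?oppr_ge0 // subr_ge0; lra.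
Qed.

Lemma expR_le_taylor2 x : expR x <= 1 + x + x ^+ 2 * expR `|x|.
Proof.
have [x1|x1] := leP x 1.
  apply: le_trans (expR_le_quadratic x1) _.
  rewrite lerD2l; apply: ler_peMr; first exact: sqr_ge0.
  by rewrite -[X in X <= _]expR0 ler_expR.
rewrite ger0_norm; last lra.
have : expR x <= x ^+ 2 * expR x.
  by apply: ler_peMl; [exact: expR_ge0 | rewrite expr2; nra].
lra.
Qed.

(** For [z >= 0], clearing the denominator and multiplying by [expR z] turns the claim into
    [2 + z + (z - 2) * expR z >= 0], which holds at 0 and has a nonnegative derivative. For [z < 0]
    the Taylor polynomial of order two is a lower bound of the exponential and already gives the
    denominator 2. *)
Lemma screening_residual z : z ^+ 2 / (2 + `|z|) <= expR (- z) - 1 + z.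
Proof.
have d0 : 0 < 2 + `|z| by have := normr_ge0 z; lra.
rewrite ler_pdivrMr //; have [z0|z0] := leP 0 z.
  rewrite ger0_norm //.
  pose f (y : R) : R := 2 + y + (y - 2) * expR y.
  pose df (y : R) : R := 1 + (y - 1) * expR y.
  have fd (y : R) : is_derive y 1 f (df y).
    apply: is_derive_eq.
    by rewrite /df /GRing.scale /=; ring.
  have : f 0 <= f z.
    apply: (le_of_derive_ge0 z0 fd) => y y0 yz; rewrite /df.
    have := expR_ge1Dx (- y); have := expR_gt0 y; have := expRxMexpNx_1 y.
    by move: (expR y) (expR (- y)) => a b ab a0 b1; nra.
  rewrite /f expR0; have := expR_gt0 z; have := expRxMexpNx_1 z.
  move: (expR z) (expR (- z)) => a b ab a0 h.
  have b0 : 0 < b by rewrite -(pmulr_rgt0 _ a0) ab.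
  have : 0 <= (2 + z) * b + (z - 2).
    rewrite -(pmulr_rge0 _ a0); nra.
  by nra.
rewrite ltr0_norm //.
have ey (y : R) : 0 <= y -> 1 + y + y ^+ 2 / 2 <= expR y.
  move=> y0; pose f (x : R) : R := expR x - (1 + x + x ^+ 2 / 2).
  have fd (x : R) : is_derive x 1 f (expR x - (1 + x)).
    apply: is_derive_eq.
    by rewrite /GRing.scale /=; field.
  have : f 0 <= f y.
    by apply: (le_of_derive_ge0 y0 fd) => x _ _; rewrite subr_ge0 expR_ge1Dx.
  rewrite /f expR0; lra.
have := ey (- z); rewrite oppr_ge0 ltW // => /(_ isT).
move: (expR (- z)) => a; nra.
Qed.

End Inequalities.

(** * Bernstein's inequality for independent samples from a finite law *)

Section Bernstein.
Variables (R : realType) (T : finType) (mu : T -> R).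
Hypotheses (mu0 : forall t, 0 <= mu t) (mu1 : \sum_t mu t = 1).

Definition iid n (w : {ffun 'I_n -> T}) : R := \prod_(m < n) mu (w m).

Lemma iid_ge0 n (w : {ffun 'I_n -> T}) : 0 <= iid w.
Proof. exact: prodr_ge0. Qed.

Lemma iid_prod n (g : T -> R) :
  \sum_(w : {ffun 'I_n -> T}) iid w * \prod_(m < n) g (w m) = (\sum_t mu t * g t) ^+ n.
Proof.
transitivity (\prod_(m < n) \sum_t mu t * g t); last by rewrite prodr_const card_ord.
by rewrite bigA_distr_bigA /=; apply: eq_bigr => w _; rewrite -big_split.
Qed.

Lemma sum_iid n : \sum_(w : {ffun 'I_n -> T}) iid w = 1.
Proof.
rewrite -[RHS](expr1n _ n) -mu1 -[in RHS](eq_bigr _ (fun t _ => mulr1 (mu t))) -iid_prod.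
by apply: eq_bigr => w _; rewrite big1 ?mulr1.
Qed.

Variables (X : T -> R) (B V e : R).
Hypotheses (V0 : 0 < V) (e0 : 0 < e) (eBV : e * B <= 2 * V).

(** The condition [e * B <= 2 * V] says that [lam * B <= 1] for [lam = e / (2 * V)], the range in
    which the exponential lies below its quadratic bound. The linear term then averages to zero. *)
Lemma mgf_bound (Y : T -> R) : (forall t, `|Y t| <= B) -> \sum_t mu t * Y t = 0 ->
  \sum_t mu t * Y t ^+ 2 <= V ->
  \sum_t mu t * expR (e / (2 * V) * Y t) <= expR ((e / (2 * V)) ^+ 2 * V).
Proof.
move=> YB Y0 YV; set lam := e / (2 * V).
have V20 : 0 < 2 * V by rewrite mulr_gt0.
have lam0 : 0 <= lam by rewrite divr_ge0 // ltW.
apply: (@le_trans _ _ (\sum_t mu t * (1 + lam * Y t + (lam * Y t) ^+ 2))).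
  apply: ler_sum => t _; apply: ler_wpM2l => //; apply: expR_le_quadratic.
  rewrite /lam mulrAC ler_pdivrMr // mul1r; apply: le_trans eBV.
  by apply: ler_wpM2l; [exact: ltW | apply: le_trans (ler_norm _) (YB t)].
have -> : \sum_t mu t * (1 + lam * Y t + (lam * Y t) ^+ 2) =
   \sum_t mu t + lam * (\sum_t mu t * Y t) + lam ^+ 2 * \sum_t mu t * Y t ^+ 2.
  by rewrite !mulr_sumr -!big_split; apply: eq_bigr => t _ /=; ring.
rewrite mu1 Y0 mulr0 addr0; apply: le_trans (expR_ge1Dx _).
by rewrite lerD2l ler_wpM2l // sqr_ge0.
Qed.

(** Exponential Markov inequality. The choice [lam = e / (2 * V)] minimizes the exponent
    [- lam * e + lam ^ 2 * V] per sample, whose minimum is [- e ^ 2 / (4 * V)]. *)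
Lemma bernstein1 n (Y : T -> R) : (forall t, `|Y t| <= B) -> \sum_t mu t * Y t = 0 ->
  \sum_t mu t * Y t ^+ 2 <= V ->
  \sum_(w : {ffun 'I_n -> T} | n%:R * e < \sum_(m < n) Y (w m)) iid w
    <= expR (- (n%:R * e ^+ 2 / (4 * V))).
Proof.
move=> YB Y0 YV; pose lam := e / (2 * V).
have lam0 : 0 < lam by rewrite divr_gt0 // mulr_gt0.
apply: (@le_trans _ _ (\sum_(w : {ffun 'I_n -> T})
    expR (- (lam * (n%:R * e))) * (iid w * \prod_(m < n) expR (lam * Y (w m))))).
  rewrite big_mkcond /=; apply: ler_sum => w _.
  have -> : expR (- (lam * (n%:R * e))) * (iid w * \prod_(m < n) expR (lam * Y (w m)))
     = iid w * expR (lam * (\sum_(m < n) Y (w m) - n%:R * e)).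
    by rewrite mulrBr expRD mulr_sumr expR_sum; ring.
  case: ifP => h; last by rewrite mulr_ge0 ?iid_ge0 ?expR_ge0.
  rewrite ler_peMr ?iid_ge0 // -[X in X <= _]expR0 ler_expR mulr_ge0 ?subr_ge0 //; exact: ltW.
rewrite -mulr_sumr (iid_prod n (fun t => expR (lam * Y t))).
apply: (@le_trans _ _ (expR (- (lam * (n%:R * e))) * expR (lam ^+ 2 * V) ^+ n)).
  rewrite ler_wpM2l ?expR_ge0 // lerXn2r ?nnegrE ?expR_ge0 ?mgf_bound //.
  by apply: sumr_ge0 => t _; rewrite mulr_ge0 ?expR_ge0.
rewrite -expRM_natl -expRD ler_expR /lam le_eqVlt; apply/orP; left; apply/eqP.
by field; rewrite gt_eqF.
Qed.

Lemma bernstein n : (forall t, `|X t| <= B) -> \sum_t mu t * X t = 0 ->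
  \sum_t mu t * X t ^+ 2 <= V ->
  \sum_(w : {ffun 'I_n -> T} | n%:R * e < `|\sum_(m < n) X (w m)|) iid w
    <= 2 * expR (- (n%:R * e ^+ 2 / (4 * V))).
Proof.
move=> XB X0 XV.
have h1 := bernstein1 n XB X0 XV.
have h2 := @bernstein1 n (fun t => - X t).
have {}h2 := h2 (fun t => ltac:(by rewrite normrN)).
have {}h2 := h2 ltac:(by under eq_bigr do rewrite mulrN; rewrite sumrN X0 oppr0).
have {}h2 := h2 ltac:(by under eq_bigr do rewrite sqrrN).
rewrite mulr2n mulrDl mul1r; apply: le_trans (lerD h1 h2).
rewrite big_mkcond [X in _ <= X + _]big_mkcond [X in _ <= _ + X]big_mkcond /=.
rewrite -big_split /=; apply: ler_sum => w _.
rewrite sumrN; have w0 := iid_ge0 w.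
case: ifP => [|_]; last by apply: addr_ge0; case: ifP.
rewrite lter_normr => /orP[->|->].
  by rewrite lerDl; case: ifP.
by rewrite lerDr; case: ifP.
Qed.

End Bernstein.

(** * Empirical gradients and second moments *)

Section Factors.
Variables (R : realType) (p : nat) (qs : 'I_p -> nat) (L : nat).

Definition mfactor : finType := {r : {set 'I_p} & letters qs r}.

Definition at_vertex (u : 'I_p) : pred mfactor :=
  [pred f | (tag f \in factor_sets p L) && (u \in tag f)].

Definition fbasis (f : mfactor) (sigma : config qs) : R :=
  basis_fun R (tagged f) sigma.

Definition fcoef (D : param R qs) (f : mfactor) : R := D (tag f) (tagged f).

Lemma sum_factor (u : 'I_p) (G : mfactor -> R) :
  \sum_(r in factor_sets p L | u \in r) \sum_(s : letters qs r) G (Tagged (fun r => letters qs r) s) =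
  \sum_(f | at_vertex u f) G f.
Proof.
rewrite (sig_big_dep (fun r => (r \in factor_sets p L) && (u \in r)) (fun r s => true)
   (fun (r : {set 'I_p}) (s : letters qs r) => G (Tagged (fun r => letters qs r) s))) /=.
by apply: eq_big => [[r s]|[r s] _] //=; rewrite andbT.
Qed.

Lemma local_energyE (D : param R qs) u sigma :
  local_energy L D u sigma = \sum_(f | at_vertex u f) fcoef D f * fbasis f sigma.
Proof. by rewrite -sum_factor. Qed.

Lemma l1normE (D : param R qs) u :
  l1norm L u D = \sum_(f | at_vertex u f) `|fcoef D f|.
Proof. by rewrite -sum_factor. Qed.

Lemma fbasis_norm_le1 f sigma : `|fbasis f sigma| <= 1.
Proof. exact: basis_norm_le1. Qed.

(** Duality of the l1 and the maximum norm: finitely many coordinates control all directions [D] at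
    once, including errors that depend on the sample. *)
Lemma gradient_dual n (a : 'I_n -> R) (w : 'I_n -> config qs) (D : param R qs) u (e : R) :
  (forall f, at_vertex u f -> `|\sum_(m < n) a m * fbasis f (w m)| <= e) ->
  `|\sum_(m < n) a m * local_energy L D u (w m)| <= e * l1norm L u D.
Proof.
move=> h; under eq_bigr do rewrite local_energyE mulr_sumr.
rewrite exchange_big /= l1normE mulr_sumr.
apply: (le_trans (ler_norm_sum _ _ _)); apply: ler_sum => f fu.
under eq_bigr do rewrite mulrCA.
by rewrite -mulr_sumr normrM mulrC ler_wpM2r // h.
Qed.

Variable mu : config qs -> R.

Definition fcov (f g : mfactor) : R := \sum_sigma mu sigma * (fbasis f sigma * fbasis g sigma).

Lemma local_energy_sqr (D : param R qs) u sigma :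
  local_energy L D u sigma ^+ 2 = \sum_(f | at_vertex u f) \sum_(g | at_vertex u g)
     fcoef D f * fcoef D g * (fbasis f sigma * fbasis g sigma).
Proof.
rewrite expr2 local_energyE mulr_suml; apply: eq_bigr => f _.
by rewrite mulr_sumr; apply: eq_bigr => g _; ring.
Qed.

(** The same duality for a quadratic form: its largest entry times the square of the l1 norm. *)
Lemma second_moment_dual n (w : 'I_n -> config qs) (D : param R qs) u (e : R) :
  (forall f g, at_vertex u f -> at_vertex u g ->
     `|\sum_(m < n) (fbasis f (w m) * fbasis g (w m) - fcov f g)| <= e) ->
  `|\sum_(m < n) (local_energy L D u (w m) ^+ 2
       - \sum_sigma mu sigma * local_energy L D u sigma ^+ 2)| <= e * l1norm L u D ^+ 2.
Proof.
move=> h.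
have -> : \sum_sigma mu sigma * local_energy L D u sigma ^+ 2 =
    \sum_(f | at_vertex u f) \sum_(g | at_vertex u g) fcoef D f * fcoef D g * fcov f g.
  under eq_bigr do rewrite local_energy_sqr mulr_sumr.
  rewrite exchange_big /=; apply: eq_bigr => f _.
  under eq_bigr do rewrite mulr_sumr.
  rewrite exchange_big /=; apply: eq_bigr => g _.
  by rewrite mulr_sumr; apply: eq_bigr => s _; ring.
have -> : \sum_(m < n) (local_energy L D u (w m) ^+ 2 -
     \sum_(f | at_vertex u f) \sum_(g | at_vertex u g) fcoef D f * fcoef D g * fcov f g) =
   \sum_(f | at_vertex u f) \sum_(g | at_vertex u g) fcoef D f * fcoef D g *
      \sum_(m < n) (fbasis f (w m) * fbasis g (w m) - fcov f g).
  transitivity (\sum_(m < n) \sum_(f | at_vertex u f) \sum_(g | at_vertex u g)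
     fcoef D f * fcoef D g * (fbasis f (w m) * fbasis g (w m) - fcov f g)).
    apply: eq_bigr => m _; rewrite local_energy_sqr -sumrB; apply: eq_bigr => f _.
    by rewrite -sumrB; apply: eq_bigr => g _; rewrite mulrBr.
  rewrite exchange_big /=; apply: eq_bigr => f _.
  by rewrite exchange_big /=; apply: eq_bigr => g _; rewrite mulr_sumr.
have -> : e * l1norm L u D ^+ 2 = \sum_(f | at_vertex u f) \sum_(g | at_vertex u g)
    `|fcoef D f| * `|fcoef D g| * e.
  rewrite expr2 l1normE mulrC -mulrA mulr_suml; apply: eq_bigr => f _.
  by rewrite mulr_suml mulr_sumr; apply: eq_bigr => g _; ring.
apply: (le_trans (ler_norm_sum _ _ _)); apply: ler_sum => f fu.
apply: (le_trans (ler_norm_sum _ _ _)); apply: ler_sum => g gu.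
by rewrite !normrM ler_wpM2l ?mulr_ge0 // h.
Qed.

Variable q : nat.
Hypothesis qle : forall i, (qs i <= q)%N.

Lemma card_letters (r : {set 'I_p}) : (#|letters qs r| <= q ^ #|r|)%N.
Proof.
pose f (s : letters qs r) : {ffun {i : 'I_p | i \in r} -> 'I_q} :=
  [ffun i => widen_ord (qle (val i)) (s i)].
have -> : (q ^ #|r| = #|{: {ffun {i : 'I_p | i \in r} -> 'I_q}}|)%N.
  by rewrite card_ffun card_ord card_sig.
rewrite -(card_in_image (f := f)) ?max_card // => s s' _ _ /ffunP e.
by apply/ffunP => j; apply/val_inj; have := congr1 val (e j); rewrite !ffunE.
Qed.

(** Such a set is [u] together with the values of a map from [L - 1] positions to the vertices. *)
Lemma card_sets_at u :
  (#|[set r in factor_sets p L | u \in r]| <= p ^ (L - 1))%N.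
Proof.
pose f (t : {ffun 'I_(L - 1) -> 'I_p}) : {set 'I_p} := u |: [set t i | i in [set: 'I_(L - 1)]].
have -> : (p ^ (L - 1) = #|{: {ffun 'I_(L - 1) -> 'I_p}}|)%N.
  by rewrite card_ffun !card_ord.
apply: (@leq_trans #|f @: [set: {ffun 'I_(L - 1) -> 'I_p}]|); last first.
  by apply: leq_trans (leq_imset_card _ _) _; rewrite cardsT.
apply: subset_leq_card; apply/fintype.subsetP => r.
rewrite !inE => /andP[/andP[r0 rL] ur].
have szr : (#|r :\ u| <= L - 1)%N by move: rL; rewrite (cardsD1 u r) ur; lia.
(* Positions beyond the size of [r :\ u] take the default value [u], which is in the set anyway. *)
apply/imsetP; exists [ffun i : 'I_(L - 1) => nth u (enum (r :\ u)) i] => //.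
apply/setP => j; rewrite !inE; have [->|ju] /= := eqVneq j u; first by [].
apply/idP/imsetP => [jr|[i _ ji]].
  have jE : j \in enum (r :\ u) by rewrite mem_enum !inE ju.
  have il : (index j (enum (r :\ u)) < L - 1)%N.
    by apply: leq_trans szr; rewrite cardE index_mem.
  by exists (Ordinal il); rewrite ?inE // ffunE nth_index.
move: ji; rewrite ffunE => ji.
have [il|il] := ltnP i (size (enum (r :\ u))).
  have : j \in enum (r :\ u) by rewrite ji mem_nth.
  by rewrite mem_enum !inE => /andP[].
by rewrite ji nth_default // eqxx in ju.
Qed.

Lemma card_at_vertex u : (0 < q)%N -> (#|at_vertex u| <= p ^ (L - 1) * q ^ L)%N.
Proof.
move=> q0.
have -> : #|at_vertex u| = (\sum_(r in factor_sets p L | u \in r) #|letters qs r|)%N.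
  rewrite -sum1_card.
  under [RHS]eq_bigr do rewrite -sum1_card.
  rewrite (sig_big_dep (fun r => (r \in factor_sets p L) && (u \in r)) (fun r s => true)
   (fun (r : {set 'I_p}) (s : letters qs r) => 1%N)) /=.
  by apply: eq_bigl => [[r s]]; rewrite /= andbT.
apply: leq_trans (_ : \sum_(r in factor_sets p L | u \in r) q ^ L <= _)%N.
  apply: leq_sum => r /andP[]; rewrite inE => /andP[_ rL] _.
  by apply: leq_trans (card_letters r) _; rewrite leq_pexp2l.
rewrite sum_nat_const leq_mul2r; apply/orP; right.
apply: leq_trans _ (card_sets_at u); apply: eq_leq; apply: eq_card => r.
by rewrite inE; congr (_ && _); rewrite inE.
Qed.

End Factors.

(** * Recovery from concentration *)

(** The tolerance with [rho_NPC] replaced by its lower bound from the marginals. It does not depend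
    on [p], and through it the number of greedy steps does not either. *)
Definition eps_floor (R : realType) (L q : nat) (alpha gamma gammahat : R) : R :=
  expR (- (2 * gamma)) / q%:R * alpha ^+ 2 * expR (- (gamma * (2 * L%:R - 1))) /
    (20 * (1 + gammahat) * q%:R ^+ (L - 1)%N).

Lemma eps_floor_gt0 (R : realType) (L q : nat) (alpha gamma gammahat : R) :
  (0 < q)%N -> 0 < alpha -> 0 < gammahat -> 0 < eps_floor L q alpha gamma gammahat.
Proof.
move=> q0 a0 g0; rewrite divr_gt0 ?mulr_gt0 ?invr_gt0 ?expR_gt0 ?exprn_gt0 ?ltr0n //.
by rewrite addr_gt0.
Qed.

Section Recovery.
Variables (R : realType) (L q p : nat) (qs : 'I_p -> nat) (theta : param R qs).
Arguments theta : clear implicits.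
Variables (alpha gammahat : R) (n : nat).
Hypotheses (L0 : (0 < L)%N) (p0 : (0 < p)%N) (qsq : forall i, (0 < qs i <= q)%N).
Hypothesis theta_cent : globally_centered L theta.
Hypotheses (gh0 : 0 < gammahat) (theta_l1 : forall u, l1norm L u theta <= gammahat).
Hypothesis alpha0 : 0 < alpha.
Hypothesis theta_l2 : forall c, c \in structure L theta -> alpha <= l2norm (theta c).
Local Notation gamma := (interaction_strength L theta).
Local Notation mu := (mu_general L theta).
Local Notation eps := (suprise_eps L q theta alpha gammahat).

Let qpos i : (0 < qs i)%N. Proof. by have /andP[] := qsq i. Qed.
Let qle i : (qs i <= q)%N. Proof. by have /andP[] := qsq i. Qed.
Let q0 : (0 < q)%N. Proof. exact: q_gt0 qpos _ qle (Ordinal p0). Qed.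
Let qR0 : 0 < q%:R :> R. Proof. by rewrite ltr0n. Qed.
Let g0 : 0 <= gamma. Proof. exact: strength_ge0. Qed.

(** The guaranteed ratio between the second moment of the local energy of an error and its squared
    l2 norm on a maximal set: the factor of [npc_lower] for [L - 1] resampled vertices, times the
    marginal bound. *)
Definition floor_npc : R := expR (- (2 * gamma * L%:R)) / q%:R ^+ L.
(** Both tolerances are fixed by the requirement that, after the inequality of [estimate_close] is
    solved for the second moment, each contributes [floor_npc * alpha ^ 2 / 16]. *)
Definition tol_gradient : R :=
  floor_npc * alpha ^+ 2 / (64 * gammahat * (1 + gammahat) * expR gamma).
Definition tol_hessian : R := floor_npc * alpha ^+ 2 / (64 * gammahat ^+ 2).

(** In the first alternative the tolerances may exceed 1, outside the range of Bernstein's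
    inequality as applied here. But then feasibility alone is enough: two feasible points differ by
    at most [2 * gammahat < alpha / 2] in l1 norm. *)
Definition concentrated (w : 'I_n -> config qs) : Prop :=
  4 * gammahat < alpha \/
  (forall u f, at_vertex L u f ->
     `|\sum_(m < n) expR (- local_energy L theta u (w m)) * fbasis R f (w m)|
       <= n%:R * tol_gradient) /\
  (forall u f g, at_vertex L u f -> at_vertex L u g ->
     `|\sum_(m < n) (fbasis R f (w m) * fbasis R g (w m) - fcov mu f g)|
       <= n%:R * tol_hessian).

Let pexp : R := expR (- (2 * gamma * (L%:R - 1))) / q%:R ^+ (L - 1)%N.

Lemma floor_npc_gt0 : 0 < floor_npc.
Proof. by rewrite divr_gt0 ?expR_gt0 ?exprn_gt0. Qed.

Let gh1 : 0 < 1 + gammahat. Proof. by have := gh0; lra. Qed.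

Lemma tol_gradient_gt0 : 0 < tol_gradient.
Proof.
by rewrite divr_gt0 // !mulr_gt0 ?invr_gt0 ?exprn_gt0 ?expR_gt0 ?ltr0n.
Qed.

Lemma tol_hessian_gt0 : 0 < tol_hessian.
Proof. by rewrite divr_gt0 // !mulr_gt0 ?invr_gt0 ?exprn_gt0 ?expR_gt0 ?ltr0n. Qed.

Let pexpE : pexp * (expR (- (2 * gamma)) / q%:R) = floor_npc.
Proof.
rewrite /pexp /floor_npc mulrACA -expRD -invfM -exprSr subn1 prednK //.
by congr (expR _ / _); ring.
Qed.

(** A nonzero centered array on some factor set gives the first case through [rho_bounds]. Without
    one, all infima are over empty sets, [rho_NPC] is infinite, and [fine] turns it into 0. *)
Lemma eps_lower_or_trivial :
  eps_floor L q alpha gamma gammahat <= eps \/ (eps = 0 /\ forall u r (x : letters qs r -> R),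
     r \in factor_sets p L -> u \in r -> centered x -> forall s, x s = 0).
Proof.
have den0 : 0 < 20 * (1 + gammahat) * q%:R ^+ (L - 1)%N :> R.
  by rewrite !mulr_gt0 ?exprn_gt0.
have [[u [r [x [rF ur cx xn0]]]]|no] := pselect (exists u r (x : letters qs r -> R),
    [/\ r \in factor_sets p L, u \in r, centered x & exists s, x s != 0]).
  left; have [lo _] := rho_bounds theta qpos qle rF ur cx xn0.
  rewrite ler_pM2r ?invr_gt0 // ler_pM2r ?expR_gt0 // ler_pM2r //.
  by rewrite exprn_gt0.
have triv u r (x : letters qs r -> R) : 
     r \in factor_sets p L -> u \in r -> centered x -> forall s, x s = 0.
  move=> rF ur cx s; apply/eqP; apply: contra_notT no => xs.
  by exists u, r, x; split => //; exists s.
right; split=> //.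
suff e : rho_NPC L theta = +oo%E by rewrite /suprise_eps e /= !mul0r.
apply/eqP; rewrite -leye_eq; apply: le_bigmin => // u _.
apply: le_bigmin => // r /andP[rF ur].
apply: le_ereal_inf_tmp => y [x [cx [s xs]] _]; move: xs.
by rewrite (triv u r x rF ur cx s) eqxx.
Qed.

Lemma eps_ge0_or_trivial :
  (0 < eps) \/ (eps = 0 /\ forall u r (x : letters qs r -> R),
     r \in factor_sets p L -> u \in r -> centered x -> forall s, x s = 0).
Proof.
have [lo|] := eps_lower_or_trivial; [left | by right].
by apply: lt_le_trans lo; exact: eps_floor_gt0.
Qed.

(** Since [Rt] contains the support, [theta] is feasible, and the objective at [th] exceeds that at
    [theta] by at most the tolerance. Expanding the excess leaves a gradient term, small by
    concentration, and a quadratic term that dominates the empirical second moment of the energy of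
    [D]. This is close to the true second moment, which [npc_lower] compares with the error on
    [c]. *)
Lemma estimate_close (w : {ffun 'I_n -> config qs}) (Rt : {set {set 'I_p}}) u
    (th : param R qs) c :
  (0 < n)%N -> concentrated w -> Rt \subset factor_sets p L ->
  (forall r, r \in factor_sets p L -> r \notin Rt -> forall s, theta r s = 0) ->
  eps_minimizer L w gammahat eps Rt u th ->
  c \in maximal_sets Rt -> u \in c ->
  \sum_s (th c s - theta c s) ^+ 2 < alpha ^+ 2 / 4.
Proof.
move=> n0 conc RtF thRt [[cth l1th thR] min] cmax uc.
have gh := gh0; have nR0 : 0 < n%:R :> R by rewrite ltr0n.
have cRt : c \in Rt by move: cmax; rewrite inE => /maxsetP[].
have cF : c \in factor_sets p L by apply: (fintype.subsetP RtF).
pose D : param R qs := fun r s => th r s - theta r s.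
have cD r : r \in factor_sets p L -> u \in r -> centered (D r).
  by move=> rF ur i s; rewrite /D sumrB cth // theta_cent // subr0.
have D0 r : r \in factor_sets p L -> u \in r -> r \notin Rt -> forall s, D r s = 0.
  by move=> rF ur rR s; rewrite /D thR // thRt // subr0.
have l1D : l1norm L u D <= 2 * gammahat.
  rewrite mulr2n mulrDl mul1r; apply: le_trans (lerD l1th (theta_l1 u)).
  rewrite !l1normE -big_split; apply: ler_sum => f _; exact: ler_normB.
have l1D0 : 0 <= l1norm L u D by rewrite l1normE; apply: sumr_ge0.
(* In the case [4 * gammahat < alpha] the l2 norm on [c] is bounded by the l1 norm at [u]. *)
case: conc => [big|[cg ch]].
  apply: (@le_lt_trans _ _ ((2 * gammahat) ^+ 2)).
    apply: (@le_trans _ _ (l1norm L u D ^+ 2)); last first.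
      by rewrite lerXn2r // nnegrE mulr_ge0 // ltW.
    have lc : \sum_s `|D c s| <= l1norm L u D.
      rewrite /l1norm (bigD1 c) ?cF //= lerDl; apply: sumr_ge0 => r _.
      by apply: sumr_ge0 => s _; exact: normr_ge0.
    have : (\sum_s `|D c s|) ^+ 2 <= l1norm L u D ^+ 2.
      by rewrite lerXn2r // nnegrE; apply: sumr_ge0.
    apply: le_trans; rewrite expr2 mulr_suml; apply: ler_sum => s _.
    rewrite -/(D c s) -real_normK ?num_real // expr2 ler_wpM2l //.
    by rewrite (bigD1 s) //= lerDl; apply: sumr_ge0.
  have -> : alpha ^+ 2 / 4 = (alpha / 2) ^+ 2 by field.
  have lt2 : 2 * gammahat < alpha / 2 by rewrite ltr_pdivlMr //; move: big; lra.
  by rewrite !expr2; apply: ltr_pM => //; rewrite mulr_ge0 // ltW.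
have feas : feasible L gammahat Rt u theta.
  split=> [r rF _||r rF _]; [exact: theta_cent | exact: theta_l1 | exact: thRt].
have ED sigma : local_energy L th u sigma =
    local_energy L theta u sigma + local_energy L D u sigma.
  rewrite !local_energyE -big_split; apply: eq_bigr => f _.
  by rewrite /= /fcoef /D; ring.
set X := \sum_s _.
have X0 : 0 <= X by apply: sumr_ge0 => s _; exact: sqr_ge0.
have [Xe|Xn] := eqVneq X 0.
  by rewrite Xe divr_gt0 ?exprn_gt0.
have xn0 : exists s, D c s != 0.
  apply: contra_neqP Xn => no; rewrite /X big1 // => s _.
  have [Ds|Ds] := eqVneq (D c s) 0; first by rewrite -/(D c s) Ds expr0n.
  by case: no; exists s.
have [rlo rhi] := rho_bounds theta qpos qle cF uc (cD c cF uc) xn0.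
set rho := fine _ in rlo rhi.
have rho0 : 0 < rho by apply: lt_le_trans rlo; rewrite divr_gt0 ?expR_gt0.
pose z (m : 'I_n) := local_energy L D u (w m).
pose E2 := \sum_sigma mu sigma * local_energy L D u sigma ^+ 2.
have E2lo : pexp * (rho * X) <= E2.
  apply: le_trans (npc_lower theta qpos qle q0 RtF cD D0 cmax uc).
  have cu : (#|c :\ u| <= L - 1)%N.
    by move: cF; rewrite inE (cardsD1 u c) uc => /andP[_ h]; rewrite -ltnS subn1 prednK.
  apply: ler_pM => //; first by rewrite divr_ge0 ?expR_ge0 ?exprn_ge0 ?ler0n.
    by rewrite mulr_ge0 // ltW.
  rewrite /pexp ler_pM ?expR_ge0 ?invr_ge0 ?exprn_ge0 ?ler0n //.
    rewrite ler_expR lerN2; apply: ler_wpM2l; first by rewrite mulr_ge0.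
    by rewrite lerBrDr natr1 ler_nat -(prednK L0) ltnS -subn1.
  rewrite lef_pV2 ?posrE ?exprn_gt0 // ler_weXn2l // ler1n //.
have S0 : n%:R * eps >= - (n%:R * tol_gradient * (2 * gammahat)) +
    expR (- gamma) / (2 + 2 * gammahat) *
     (n%:R * E2 - n%:R * tol_hessian * (2 * gammahat) ^+ 2).
  have := min _ feas; rewrite /screening_objective -lerBlDl -mulrBr.
  rewrite ler_pdivrMl // -sumrB => S1.
  apply: le_trans S1.
  (* For each sample, the difference of the exponentials is [a * (expR (- z) - 1)], with [a] the
     exponential at [theta]. Splitting off the linear part leaves the residual; there
     [a >= expR (- gamma)] and the denominator is at most [2 + 2 * gammahat]. *)
  have S2 : \sum_(m < n) (- (expR (- local_energy L theta u (w m)) * z m) +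
       expR (- gamma) / (2 + 2 * gammahat) * z m ^+ 2) <=
      \sum_(m < n) (expR (- local_energy L th u (w m)) -
          expR (- local_energy L theta u (w m))).
    apply: ler_sum => m _; rewrite ED opprD expRD -/(z m).
    set a := expR (- local_energy L theta u (w m)).
    have a1 : expR (- gamma) <= a.
      rewrite ler_expR lerN2; apply: le_trans (ler_norm _) _.
      exact: local_energy_le_strength.
    have a0 : 0 < a by exact: expR_gt0.
    have zm : `|z m| <= 2 * gammahat by apply: le_trans (local_energy_bound _ _ _ _) l1D.
    have := screening_residual (z m).
    have : z m ^+ 2 / (2 + 2 * gammahat) <= z m ^+ 2 / (2 + `|z m|).
      apply: ler_wpM2l; first exact: sqr_ge0.
      rewrite lef_pV2 ?posrE; [lra | lra |]. 
      by have := normr_ge0 (z m); lra.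
    have : 0 <= z m ^+ 2 / (2 + 2 * gammahat) by rewrite divr_ge0 ?sqr_ge0 //; lra.
    rewrite -mulrA [(2 + _)^-1 * _]mulrC.
    set v := z m ^+ 2 / (2 + 2 * gammahat); set v' := _ / _.
    move=> v0 vv' v'e.
    have : expR (- gamma) * v <= a * v by apply: ler_wpM2r.
    have : a * v <= a * (expR (- z m) - 1 + z m).
      by apply: ler_wpM2l; [exact: ltW | exact: le_trans v'e].
    by lra.
  apply: le_trans S2; rewrite big_split /= sumrN -mulr_sumr.
  have G1 := gradient_dual D (cg u).
  have G2 := second_moment_dual D (ch u).
  apply: lerD.
    rewrite lerN2; apply: le_trans (ler_norm _) _; apply: le_trans G1 _.
    by apply: ler_wpM2l l1D; rewrite mulr_ge0 ?ler0n // ltW ?tol_gradient_gt0.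
  apply: ler_wpM2l; first by rewrite divr_ge0 ?expR_ge0 //; lra.
  have G4 : n%:R * tol_hessian * l1norm L u D ^+ 2 <= n%:R * tol_hessian * (2 * gammahat) ^+ 2.
    apply: ler_wpM2l; first by rewrite mulr_ge0 ?ler0n // ltW ?tol_hessian_gt0.
    by rewrite lerXn2r // nnegrE mulr_ge0 // ltW.
  move: G2; rewrite sumrB sumr_const card_ord -[_ *+ n]mulr_natl ler_norml => /andP[G3 _].
  by move: G3 G4; rewrite -/E2 /z; lra.
have {S0} S1 : expR (- gamma) / (2 + 2 * gammahat) * (E2 - tol_hessian * (2 * gammahat) ^+ 2)
    <= eps + tol_gradient * (2 * gammahat).
  by rewrite -(ler_pM2l nR0); nra.
have S2 : E2 <= 2 * (1 + gammahat) * expR gamma * (eps + tol_gradient * (2 * gammahat)) +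
     tol_hessian * (2 * gammahat) ^+ 2.
  rewrite -lerBlDr; set Y := E2 - _ in S1 *.
  have -> : Y = 2 * (1 + gammahat) * expR gamma * (expR (- gamma) / (2 + 2 * gammahat) * Y).
    rewrite expRN; field.
    by apply/andP; split; rewrite gt_eqF ?expR_gt0 //; lra.
  by apply: ler_wpM2l S1; rewrite mulr_ge0 ?expR_ge0 // mulr_ge0 // ltW.
have T1 : 2 * (1 + gammahat) * expR gamma * (tol_gradient * (2 * gammahat)) =
    floor_npc * alpha ^+ 2 / 16.
  rewrite /tol_gradient; field.
  by rewrite !gt_eqF ?expR_gt0 //; lra.
have T2 : tol_hessian * (2 * gammahat) ^+ 2 = floor_npc * alpha ^+ 2 / 16.
  by rewrite /tol_hessian; field; rewrite gt_eqF.
have T0 : 2 * (1 + gammahat) * expR gamma * eps = pexp * rho * alpha ^+ 2 / 10.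
  have -> : pexp = expR gamma * expR (- (gamma * (2 * L%:R - 1))) / q%:R ^+ (L - 1)%N.
    by rewrite -expRD /pexp; congr (expR _ / _); ring.
  rewrite /suprise_eps -/rho; field.
  rewrite !gt_eqF ?exprn_gt0 //; lra.
have fl : floor_npc <= pexp * rho.
  by rewrite -pexpE ler_wpM2l // divr_ge0 ?expR_ge0 ?exprn_ge0 ?ler0n.
have pr0 : 0 < pexp * rho by rewrite mulr_gt0 // divr_gt0 ?expR_gt0 ?exprn_gt0.
have a20 : 0 < alpha ^+ 2 by rewrite exprn_gt0.
have fa : floor_npc * alpha ^+ 2 <= pexp * rho * alpha ^+ 2 by rewrite ler_wpM2r // ltW.
(* In units of [pexp * rho * alpha ^ 2] the right-hand side is at most [1/10 + 1/16 + 1/16 = 9/40],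
   below the [1/4] that is claimed. *)
rewrite -(ltr_pM2l pr0).
move: S2; rewrite mulrDr T0 T1 T2 => S2.
have pra0 : 0 < pexp * rho * alpha ^+ 2 by rewrite mulr_gt0.
move: E2lo; rewrite mulrA => E2lo.
lra.
Qed.

End Recovery.

(** The sum of the squared deviations from the mean is nonnegative. *)
Lemma sqr_sum_le_card (R : realFieldType) (I : finType) (A : {set I}) (a : I -> R) :
  (\sum_(i in A) a i) ^+ 2 <= #|A|%:R * \sum_(i in A) a i ^+ 2.
Proof.
have [->|A0] := eqVneq A finset.set0.
  by rewrite !big_set0 cards0 mul0r expr0n.
have c0 : 0 < #|A|%:R :> R by rewrite ltr0n card_gt0.
set S := \sum_(i in A) a i; set m := S / #|A|%:R.
have : 0 <= \sum_(i in A) (a i - m) ^+ 2 by apply: sumr_ge0 => i _; exact: sqr_ge0.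
have -> : \sum_(i in A) (a i - m) ^+ 2 =
    \sum_(i in A) a i ^+ 2 - 2 * m * S + #|A|%:R * m ^+ 2.
  rewrite [in RHS]/S mulr_sumr -sumrB [#|A|%:R * _]mulr_natl -sumr_const -big_split.
  by apply: eq_bigr => i _ /=; ring.
move: (\sum_(i in A) _ ^+ 2) => Q.
have -> : Q - 2 * m * S + #|A|%:R * m ^+ 2 = Q - S ^+ 2 / #|A|%:R.
  by rewrite /m; field; rewrite gt_eqF.
by rewrite subr_ge0 ler_pdivrMr // mulrC.
Qed.

Section L2norm.
Variables (R : realType) (p : nat) (qs : 'I_p -> nat) (r : {set 'I_p}).
Variables (x : letters qs r -> R) (a : R).
Lemma l2norm_lt : 0 < a -> (l2norm x < a) = (\sum_s x s ^+ 2 < a ^+ 2).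
Proof.
move=> a0; rewrite /l2norm -{1}[a]gtr0_norm // -sqrtr_sqr ltr_sqrt //.
by rewrite exprn_gt0.
Qed.
End L2norm.

(** * From close estimates to the structure *)

Section Structure.
Variables (R : realType) (L q p : nat) (qs : 'I_p -> nat) (theta : param R qs).
Arguments theta : clear implicits.
Variables (alpha gammahat : R) (n : nat).
Hypotheses (L0 : (0 < L)%N) (p0 : (0 < p)%N) (qsq : forall i, (0 < qs i <= q)%N).
Hypothesis theta_cent : globally_centered L theta.
Hypotheses (gh0 : 0 < gammahat) (theta_l1 : forall u, l1norm L u theta <= gammahat).
Hypothesis alpha0 : 0 < alpha.
Hypothesis theta_l2 : forall c, c \in structure L theta -> alpha <= l2norm (theta c).
Hypothesis n0 : (0 < n)%N.
Local Notation mu := (mu_general L theta).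
Local Notation eps := (suprise_eps L q theta alpha gammahat).
Variable w : {ffun 'I_n -> config qs}.
(** Convexity of the square: the error of an average is at most the average of the errors. *)
Lemma avg_close (th : 'I_p -> param R qs) (c : {set 'I_p}) (e : R) : c != finset.set0 ->
  (forall u, u \in c -> \sum_s (th u c s - theta c s) ^+ 2 < e) ->
  \sum_s (theta_avg th (r := c) s - theta c s) ^+ 2 < e.
Proof.
move=> c0 h; have cR : 0 < #|c|%:R :> R by rewrite ltr0n card_gt0.
apply: (@le_lt_trans _ _ (#|c|%:R^-1 * \sum_(u in c) \sum_s (th u c s - theta c s) ^+ 2)).
  rewrite exchange_big mulr_sumr; apply: ler_sum => s _.
  have -> : theta_avg th (r := c) s - theta c s =
      #|c|%:R^-1 * \sum_(u in c) (th u c s - theta c s).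
    by rewrite sumrB sumr_const -[theta c s *+ _]mulr_natl mulrBr mulrA mulVf ?mul1r // gt_eqF.
  rewrite exprMn expr2 -mulrA ler_pM2l ?invr_gt0 // ler_pdivrMl //.
  exact: sqr_sum_le_card.
rewrite ltr_pdivrMl // mulr_natl -sumr_const.
case: (set_0Vmem c) => [ce|[u uc]]; first by rewrite ce eqxx in c0.
rewrite (bigD1 u) //= [ltRHS](bigD1 u) //=; apply: ltr_leD; first exact: h.
by apply: ler_sum => v /andP[vc _]; apply/ltW/h.
Qed.

(** If [theta] vanishes on [c], the average is itself the error, hence below [alpha / 2]. Otherwise
    [c], maximal in a family that contains the support, belongs to the structure, so [theta] has
    norm at least [alpha] there and the average keeps at least half of it. *)
Lemma step_removes (Rt : {set {set 'I_p}}) (th : 'I_p -> param R qs) c :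
  concentrated L q theta alpha gammahat w -> Rt \subset factor_sets p L ->
  (forall r, r \in factor_sets p L -> r \notin Rt -> forall s, theta r s = 0) ->
  (forall u, eps_minimizer L w gammahat eps Rt u (th u)) ->
  c \in maximal_sets Rt ->
  (l2norm (theta_avg th (r := c)) < alpha / 2) = ~~ [exists s, theta c s != 0].
Proof.
move=> conc RtF thRt min cmax; have a0 := alpha0.
have /maxsetP[cRt cM] : maxset (fun r => r \in Rt) c by move: cmax; rewrite inE.
have cF : c \in factor_sets p L by apply: (fintype.subsetP RtF).
have c0 : c != finset.set0 by move: cF; rewrite inE -card_gt0 => /andP[].
have close u : u \in c -> \sum_s (th u c s - theta c s) ^+ 2 < alpha ^+ 2 / 4.
  by move=> uc; apply: (estimate_close L0 p0 qsq theta_cent gh0 theta_l1 alpha0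
       n0 conc RtF thRt (min u) cmax uc).
have avgc := avg_close c0 close.
rewrite l2norm_lt; last lra.
have -> : (alpha / 2) ^+ 2 = alpha ^+ 2 / 4 by field.
have [/existsP[s ths]|no] /= := boolP [exists s, theta c s != 0]; last first.
  rewrite -[RHS]avgc; congr (_ < _); apply: eq_bigr => s _.
  suff -> : theta c s = 0 by rewrite subr0.
  by apply/eqP; apply: contraNT no => h; apply/existsP; exists s.
apply/negbTE; rewrite -leNgt.
have cS : c \in structure L theta.
  rewrite inE; apply/maxsetP; split; first by rewrite cF; apply/existsP; exists s.
  move=> B /andP[BF /existsP[s' Bs']] cB; apply: cM => //.
  by apply: contraNT Bs' => BR; rewrite thRt.
have : alpha ^+ 2 <= \sum_s theta c s ^+ 2.
  rewrite leNgt -l2norm_lt // -leNgt; exact: theta_l2.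
(* The triangle inequality in squared form, from [2 x ^ 2 + 2 (x - y) ^ 2 - y ^ 2 = (2 x - y) ^ 2].
   It gives [alpha ^ 2 <= 2 * avg + alpha ^ 2 / 2], with [avg] the squared norm of the average. *)
have : \sum_s theta c s ^+ 2 <= 2 * (\sum_s theta_avg th (r := c) s ^+ 2) +
    2 * \sum_s (theta_avg th (r := c) s - theta c s) ^+ 2.
  rewrite !mulr_sumr -big_split; apply: ler_sum => s' _ /=.
  move: (theta_avg _ _) (theta c s') => x y.
  by rewrite -subr_ge0 (_ : _ - _ = (2 * x - y) ^+ 2) ?sqr_ge0 //; ring.
lra.
Qed.

(** After [t] rounds every remaining set with more than [L - t] elements lies below a set of the
    support. Indeed a maximal set survives a round only if it is in the support, and any other set
    lies below a strictly larger maximal one, covered by the previous round. As members are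
    nonempty, after [L] rounds this concerns all of them. *)
Lemma run_recovers Rs thetahat Shat :
  concentrated L q theta alpha gammahat w ->
  suprise_run L w alpha gammahat eps Rs thetahat Shat ->
  Shat = structure L theta.
Proof.
move=> conc [Rs0 min step ->].
have inv t : (t <= L)%N -> [/\ Rs t \subset factor_sets p L,
   forall r, r \in factor_sets p L -> r \notin Rs t -> forall s, theta r s = 0 &
   forall c, c \in Rs t -> (L < #|c| + t)%N ->
     exists r : {set 'I_p}, [/\ c \subset r, r \in factor_sets p L & [exists s, theta r s != 0]]].
  elim: t => [_|t IH tL].
    rewrite Rs0; split=> // [r -> //|c]; rewrite inE addn0 => /andP[_ cL].
    by rewrite ltnNge cL.
  have [RtF thRt big] := IH (ltnW tL).
  have rem c := step_removes (c := c) conc RtF thRt (min t tL).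
  rewrite step //; split.
  - by apply: fintype.subset_trans RtF; exact: finset.subsetDl.
  - move=> r rF; rewrite !inE negb_and negbK => /orP[/andP[rmax]|]; last exact: thRt.
    rewrite rem ?inE // => /existsPn no s; apply/eqP; have := no s; by rewrite negbK.
  - move=> c; rewrite inE => /andP[cnr cRt] cL.
    have [cmax|cnmax] := boolP (c \in maximal_sets (Rs t)).
      move: cnr; rewrite inE cmax rem //= negbK => h.
      by exists c; split => //; apply: (fintype.subsetP RtF).
    have [B Bmax cB] := maxset_exists (P := fun r => r \in Rs t) cRt.
    have BRt : B \in Rs t by have /maxsetP[] := Bmax.
    have BC : c \proper B.
      rewrite finset.properEneq cB andbT; apply: contraNneq cnmax => ->; by rewrite inE.
    have [|r [Br rF ex]] := big B BRt.
      by apply: leq_trans cL _; rewrite addnS -addSn leq_add2r proper_card.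
    by exists r; split => //; apply: fintype.subset_trans Br.
have [RLF thRL bigL] := inv L (leqnn L).
have sup c : c \in Rs L ->
    exists r : {set 'I_p}, [/\ c \subset r, r \in factor_sets p L & [exists s, theta r s != 0]].
  move=> cR; apply: bigL => //; rewrite -[X in (X < _)%N]add0n ltn_add2r.
  by have := fintype.subsetP RLF _ cR; rewrite inE => /andP[].
have inR r : r \in factor_sets p L -> [exists s, theta r s != 0] -> r \in Rs L.
  by move=> rF /existsP[s]; apply: contraNT => /(thRL r rF) ->.
apply/setP => c; rewrite !inE; apply/maxsetP/maxsetP => [[cR cM]|[/andP[cF cN] cM]].
  have [r [cr rF ex]] := sup c cR.
  have rc : r = c by apply: cM => //; exact: inR.
  split; first by rewrite -rc rF.
  by move=> B /andP[BF Bex] cB; apply: cM => //; apply: inR.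
split; first exact: inR.
move=> B BR cB; have [r [Br rF ex]] := sup B BR.
have rc : r = c by apply: cM; rewrite ?rF ?ex //; apply: fintype.subset_trans Br.
by apply/eqP; rewrite finset.eqEsubset cB andbT -rc.
Qed.

(** Recovery is stated as an equivalence, so a run has to exist. For a positive tolerance a point
    near the infimum will do; for tolerance zero all feasible points have the same energies. *)
Lemma eps_minimizer_exists (Rt : {set {set 'I_p}}) u :
  exists th, eps_minimizer L w gammahat eps Rt u th.
Proof.
have gh := gh0.
have feas0 : feasible L gammahat Rt u (fun r (s : letters qs r) => 0 : R).
  split=> //; first by move=> r rF ur i s; rewrite big1.
  rewrite /l1norm big1 ?ltW // => r _; rewrite big1 // => s _; exact: normr0.
have [e0|[e0 triv]] := eps_ge0_or_trivial L theta p0 qsq gh0 alpha0; last first.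
  exists (fun r (s : letters qs r) => 0); split=> // th' [cth' _ _].
  rewrite e0 addr0 /screening_objective ler_pM2l ?invr_gt0 ?ltr0n //.
  apply: ler_sum => m _; rewrite ler_expR lerN2 le_eqVlt; apply/orP; left; apply/eqP.
  apply: eq_bigr => r /andP[rF ur]; apply: eq_bigr => s _.
  by rewrite (triv u r _ rF ur (cth' r rF ur)).
pose V : set R := [set screening_objective L w u th | th in
   [set th | feasible L gammahat Rt u th]]%classic.
have V0 : (V !=set0)%classic by exists (screening_objective L w u (fun r (s : letters qs r) => 0)); exists (fun r (s : letters qs r) => 0).
have lbV : has_lbound V.
  exists 0 => _ [th _ <-]; rewrite /screening_objective mulr_ge0 ?invr_ge0 ?ler0n //.
  by apply: sumr_ge0 => m _; exact: expR_ge0.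
have [_ [th fth <-] lt] := inf_adherent e0 (conj V0 lbV).
exists th; split=> // th' fth'.
apply: (le_trans (ltW lt)); rewrite lerD2r; apply: ge_inf => //.
by exists th'.
Qed.

Lemma run_exists : exists Rs thetahat Shat,
  suprise_run L w alpha gammahat eps Rs thetahat Shat.
Proof.
pose pick Rt u := projT1 (cid (eps_minimizer_exists Rt u)).
have pickP Rt u : eps_minimizer L w gammahat eps Rt u (pick Rt u).
  by rewrite /pick; case: cid.
pose nxt Rt := Rt :\: [set c in maximal_sets Rt |
             l2norm (theta_avg (pick Rt) (r := c)) < alpha / 2].
exists (fun t => iter t nxt (factor_sets p L)), (fun t => pick (iter t nxt (factor_sets p L))).
by eexists; split => // t tL u; exact: pickP.
Qed.

Lemma output_iff Shat : concentrated L q theta alpha gammahat w ->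
  suprise_output L w alpha gammahat eps Shat <-> Shat = structure L theta.
Proof.
move=> conc; split=> [[Rs [th run]]|->]; first exact: run_recovers run.
have [Rs [th [S run]]] := run_exists.
by exists Rs, th; rewrite -(run_recovers conc run).
Qed.

End Structure.

(** * Sample size *)

Section SampleSize.
Variables (R : realType) (L q p : nat) (alpha gamma gammahat delta : R).
Hypotheses (L0 : (0 < L)%N) (q0 : (0 < q)%N) (p0 : (0 < p)%N).
Hypotheses (gh0 : 0 < gammahat) (alpha0 : 0 < alpha) (d0 : 0 < delta) (d1 : delta < 1).

Definition log_factor : R :=
  ln (4 * L%:R * q%:R ^+ (2 * L)%N * p%:R ^+ (2 * L - 1)%N / delta).

Lemma union_count_ge1 : 1 <= L%:R * q%:R ^+ (2 * L)%N * p%:R ^+ (2 * L - 1)%N :> R.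
Proof. by rewrite -!natrX -!natrM ler1n !muln_gt0 !expn_gt0 L0 q0 p0. Qed.

Lemma log_factor_gt0 : 0 < log_factor.
Proof.
apply: ln_gt0; rewrite ltr_pdivlMr // mul1r; apply: lt_le_trans d1 _.
by have := union_count_ge1; rewrite -!mulrA; lra.
Qed.

Definition sample_scale : R := 2 ^+ 14 * q%:R ^+ (2 * L)%N *
  (gammahat ^+ 2 * (1 + gammahat) ^+ 2 * expR (4 * gamma * (L%:R + 1)) / alpha ^+ 4).

Lemma sample_scale_gt0 : 0 < sample_scale.
Proof.
have h := gh0; have h1 : 0 < 1 + gammahat by lra.
by rewrite /sample_scale !mulr_gt0 ?invr_gt0 ?exprn_gt0 ?expR_gt0 ?ltr0n.
Qed.

Lemma sample_boundE :
  sample_bound L q p alpha gamma gammahat delta = sample_scale * log_factor.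
Proof. by []. Qed.

Lemma sample_bound_gt0 : 0 < sample_bound L q p alpha gamma gammahat delta.
Proof. by rewrite sample_boundE mulr_gt0 ?sample_scale_gt0 ?log_factor_gt0. Qed.

End SampleSize.

(** * Probability of the concentration event *)

Section Concentration.
Variables (R : realType) (L q p : nat) (qs : 'I_p -> nat) (theta : param R qs).
Arguments theta : clear implicits.
Variables (alpha gammahat delta : R) (n : nat).
Hypotheses (L0 : (0 < L)%N) (p0 : (0 < p)%N) (qsq : forall i, (0 < qs i <= q)%N).
Hypotheses (gh0 : 0 < gammahat) (alpha0 : 0 < alpha) (d0 : 0 < delta) (d1 : delta < 1).
Local Notation gamma := (interaction_strength L theta).
Local Notation mu := (mu_general L theta).
Hypothesis nbig : sample_bound L q p alpha gamma gammahat delta <= n%:R.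

Let qpos i : (0 < qs i)%N. Proof. by have /andP[] := qsq i. Qed.
Let qle i : (qs i <= q)%N. Proof. by have /andP[] := qsq i. Qed.
Let q0 : (0 < q)%N. Proof. exact: q_gt0 qpos _ qle (Ordinal p0). Qed.
Let qR0 : 0 < q%:R :> R. Proof. by rewrite ltr0n. Qed.
Let g0 : 0 <= gamma. Proof. exact: strength_ge0. Qed.
Let gh1 : 0 < 1 + gammahat. Proof. by have := gh0; lra. Qed.
Local Notation tolg := (tol_gradient L q theta alpha gammahat).
Local Notation tolh := (tol_hessian L q theta alpha gammahat).
Local Notation lg := (log_factor L q p delta).

Let ex : R := expR (- lg).

(** [sample_scale] is the exact reciprocal of Bernstein's exponent per sample:
    [64 ^ 2 * 4 = 2 ^ 14], the square of [floor_npc] yields [q ^ (2 L)] and [expR (4 * gamma * L)],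
    and the remaining [expR (4 * gamma)] comes half from the tolerance and half from the variance
    bound. *)
Lemma exponent_gradient : lg <= n%:R * tolg ^+ 2 / (4 * expR gamma ^+ 2).
Proof.
have sc0 := sample_scale_gt0 L gamma q0 gh0 alpha0.
have sX : sample_scale L q alpha gamma gammahat * (tolg ^+ 2 / (4 * expR gamma ^+ 2)) = 1.
  rewrite /sample_scale /tol_gradient /floor_npc.
  have -> : expR (4 * gamma * (L%:R + 1)) =
     expR (2 * gamma * L%:R) ^+ 2 * expR gamma ^+ 4.
    by rewrite -!expRM_natl -expRD; congr expR; ring.
  rewrite expRN mulnC exprM; field.
  by rewrite !gt_eqF ?exprn_gt0 ?expR_gt0.
rewrite -[X in X <= _]mul1r -[X in X * _ <= _]sX mulrAC -[X in _ <= X]mulrA.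
by apply: ler_wpM2r nbig; rewrite divr_ge0 ?sqr_ge0 // mulr_ge0 // sqr_ge0.
Qed.

(** Here the corresponding product is [expR (4 * gamma) * ((1 + gammahat) / gammahat) ^ 2], which is
    at least 1: the gradient decides the sample size. *)
Lemma exponent_hessian : lg <= n%:R * tolh ^+ 2 / (4 * 1).
Proof.
have sc0 := sample_scale_gt0 L gamma q0 gh0 alpha0.
have lg0 := ltW (log_factor_gt0 L0 q0 p0 d0 d1).
have sX : 1 <= sample_scale L q alpha gamma gammahat * (tolh ^+ 2 / (4 * 1)).
  rewrite /sample_scale /tol_hessian /floor_npc.
  have -> : expR (4 * gamma * (L%:R + 1)) =
     expR (2 * gamma * L%:R) ^+ 2 * expR (4 * gamma).
    by rewrite -!expRM_natl -expRD; congr expR; ring.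
  rewrite expRN [(2 * L)%N]mulnC exprM.
  have -> : 2 ^+ 14 * (q%:R ^+ L) ^+ 2 * (gammahat ^+ 2 * (1 + gammahat) ^+ 2 *
     (expR (2 * gamma * L%:R) ^+ 2 * expR (4 * gamma)) / alpha ^+ 4) *
     (((expR (2 * gamma * L%:R))^-1 / q%:R ^+ L * alpha ^+ 2 / (64 * gammahat ^+ 2)) ^+ 2 / (4 * 1))
    = expR (4 * gamma) * ((1 + gammahat) / gammahat) ^+ 2.
    by field; rewrite !gt_eqF ?exprn_gt0 ?expR_gt0.
  rewrite -[X in X <= _]mul1r; apply: ler_pM => //.
    by rewrite -[X in X <= _]expR0 ler_expR mulr_ge0.
  rewrite -[X in X <= _](expr1n _ 2) lerXn2r // ?nnegrE ?divr_ge0 ?ltW //.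
  by rewrite ltr_pdivlMr // mul1r ltrDr.
apply: (@le_trans _ _ (sample_scale L q alpha gamma gammahat * (tolh ^+ 2 / (4 * 1)) * lg)).
  by rewrite -[X in X <= _]mul1r ler_wpM2r.
rewrite mulrAC -[X in _ <= X]mulrA.
by apply: ler_wpM2r nbig; rewrite divr_ge0 ?sqr_ge0.
Qed.

Lemma floor_npc_le1 : floor_npc L q theta <= 1.
Proof.
rewrite /floor_npc ler_pdivrMr ?exprn_gt0 // mul1r.
apply: (@le_trans _ _ 1).
  by rewrite -[X in _ <= X]expR0 ler_expR oppr_le0 !mulr_ge0.
by rewrite -natrX ler1n expn_gt0 q0.
Qed.

(** Tolerances up to 1 satisfy the side condition of Bernstein's inequality, with range [expR gamma]
    and variance [expR gamma ^ 2] for gradients, range 2 and variance 1 for products. *)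
Lemma tol_small : alpha <= 4 * gammahat -> tolg <= 1 /\ tolh <= 1.
Proof.
move=> al; have h0 := gh0; have f1 := floor_npc_le1.
have f0 := floor_npc_gt0 L theta p0 qsq.
have e1 : 1 <= expR gamma by rewrite -[X in X <= _]expR0 ler_expR.
have a2 : floor_npc L q theta * alpha ^+ 2 <= 64 * gammahat ^+ 2.
  apply: (@le_trans _ _ (alpha ^+ 2)).
    by rewrite -[X in _ <= X]mul1r ler_wpM2r // sqr_ge0.
  apply: (@le_trans _ _ ((4 * gammahat) ^+ 2)).
    by rewrite lerXn2r // nnegrE ltW // mulr_gt0.
  by rewrite exprMn; apply: ler_wpM2r; [exact: sqr_ge0 | lra].
split; rewrite ler_pdivrMr ?mul1r ?mulr_gt0 ?exprn_gt0 ?expR_gt0 //.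
apply: le_trans a2 _.
apply: (@le_trans _ _ (64 * gammahat * (1 + gammahat))).
  by rewrite expr2 mulrA; apply: ler_wpM2l; [rewrite mulr_ge0 // ltW | lra].
by apply: ler_peMr => //; rewrite !mulr_ge0 // ltW.
Qed.

Local Notation atv := (at_vertex L (qs := qs)).
Let bad1 (u : 'I_p) (f : mfactor qs) (w : {ffun 'I_n -> config qs}) : bool :=
  n%:R * tolg < `|\sum_(m < n) expR (- local_energy L theta u (w m)) * fbasis R f (w m)|.
Let bad2 (f g : mfactor qs) (w : {ffun 'I_n -> config qs}) : bool :=
  n%:R * tolh < `|\sum_(m < n) (fbasis R f (w m) * fbasis R g (w m) - fcov mu f g)|.

Let pr1 (u : 'I_p) f : alpha <= 4 * gammahat -> atv u f ->
  \sum_(w | bad1 u f w) iid mu w <= 2 * ex.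
Proof.
move=> al fu; have [t1 _] := tol_small al.
have tg0 := tol_gradient_gt0 L theta p0 qsq gh0 alpha0.
apply: (@le_trans _ _ (2 * expR (- (n%:R * tolg ^+ 2 / (4 * expR gamma ^+ 2))))); last first.
  by rewrite ler_pM2l // ler_expR lerN2 exponent_gradient.
have e1 : 1 <= expR gamma by rewrite -[X in X <= _]expR0 ler_expR.
have Xb t : `|expR (- local_energy L theta u t) * fbasis R f t| <= expR gamma.
  rewrite normrM -[X in _ <= X]mulr1; apply: ler_pM => //; last exact: fbasis_norm_le1.
  rewrite ger0_norm ?expR_ge0 // ler_expR.
  by apply: le_trans (local_energy_le_strength L theta u t); rewrite -normrN ler_norm.
apply: (@bernstein _ _ mu (mu_ge0 L theta qpos) (sum_mu L theta qpos)
  (fun t => expR (- local_energy L theta u t) * fbasis R f t) (expR gamma)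
  (expR gamma ^+ 2) tolg) => //.
- by rewrite exprn_gt0 ?expR_gt0.
- rewrite expr2 mulrA; apply: ler_wpM2r; first exact: expR_ge0.
  by apply: le_trans t1 _; lra.
- by apply: gradient_mean0 => //; case/andP: fu.
- rewrite -[X in _ <= X]mul1r -(sum_mu L theta qpos) mulr_suml; apply: ler_sum => t _.
  by rewrite ler_wpM2l ?mu_ge0 // -real_normK ?num_real // lerXn2r // nnegrE ?expR_ge0.
Qed.

Let pr2 f g : alpha <= 4 * gammahat -> \sum_(w | bad2 f g w) iid mu w <= 2 * ex.
Proof.
move=> al; have [_ t1] := tol_small al.
have th0 := tol_hessian_gt0 L theta p0 qsq gh0 alpha0.
apply: (@le_trans _ _ (2 * expR (- (n%:R * tolh ^+ 2 / (4 * 1))))); last first.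
  by rewrite ler_pM2l // ler_expR lerN2 exponent_hessian.
have b1 t : `|fbasis R f t * fbasis R g t| <= 1.
  by rewrite normrM mulr_ile1 ?normr_ge0 ?fbasis_norm_le1.
have S (F : config qs -> R) (c : R) : \sum_t mu t * (F t + c) = \sum_t mu t * F t + c.
  under eq_bigr do rewrite mulrDr.
  by rewrite big_split /= -mulr_suml (sum_mu L theta qpos) mul1r.
have c1 : `|fcov mu f g| <= 1.
  apply: (le_trans (ler_norm_sum _ _ _)); rewrite -(sum_mu L theta qpos).
  apply: ler_sum => t _; rewrite normrM ger0_norm ?mu_ge0 // -[X in _ <= X]mulr1.
  by rewrite ler_wpM2l ?mu_ge0.
apply: (@bernstein _ _ mu (mu_ge0 L theta qpos) (sum_mu L theta qpos)
  (fun t => fbasis R f t * fbasis R g t - fcov mu f g) 2 1 tolh) => //.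
- by rewrite mulr1 -[X in _ <= X]mul1r ler_wpM2r.
- by move=> t; apply: (le_trans (ler_normB _ _)); have := b1 t; move: c1; lra.
- by rewrite S subrr.
- have -> : \sum_t mu t * (fbasis R f t * fbasis R g t - fcov mu f g) ^+ 2 =
     \sum_t mu t * (fbasis R f t * fbasis R g t) ^+ 2 - fcov mu f g ^+ 2.
    transitivity (\sum_t mu t * (fbasis R f t * fbasis R g t) ^+ 2
       - 2 * fcov mu f g * (\sum_t mu t * (fbasis R f t * fbasis R g t))
       + (\sum_t mu t) * fcov mu f g ^+ 2).
      by rewrite mulr_sumr mulr_suml -sumrB -big_split; apply: eq_bigr => t _ /=; ring.
    by rewrite (sum_mu L theta qpos) -/(fcov mu f g); ring.
  rewrite lerBlDr; apply: (@le_trans _ _ 1); last by rewrite lerDl sqr_ge0.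
  rewrite -[X in _ <= X](sum_mu L theta qpos); apply: ler_sum => t _.
  rewrite -[X in _ <= X]mulr1 ler_wpM2l ?mu_ge0 //.
  by rewrite -real_normK ?num_real // expr_le1.
Qed.

(** Union bound. With at most [K] factors at a vertex there are at most [p * K] gradients and
    [p * K ^ 2] products, each failing with probability at most [2 * ex], hence at most
    [4 * p * K ^ 2 * ex] in total. The product [p * K ^ 2] is the quantity
    [q ^ (2 L) * p ^ (2 L - 1)] under the logarithm. *)
Lemma prob_concentrated :
  1 - delta <= prob_samples L theta
    (fun w : {ffun 'I_n -> config qs} => concentrated L q theta alpha gammahat w).
Proof.
have [al|al] := leP alpha (4 * gammahat); last first.
  apply: (@le_trans _ _ 1); first by rewrite gerBl ltW.
  rewrite /prob_samples (eq_bigl predT) ?(sum_iid (sum_mu L theta qpos)) //.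
  by move=> w; apply/asboolP; left.
have tot := sum_iid (sum_mu L theta qpos) n.
rewrite (bigID (fun w : {ffun 'I_n -> config qs} =>
  `[< concentrated L q theta alpha gammahat w >])) /= in tot.
rewrite /prob_samples.
suff : \sum_(w : {ffun 'I_n -> config qs} |
   ~~ `[< concentrated L q theta alpha gammahat w >]) iid mu w <= delta.
  by move: tot; rewrite /iid; lra.
(* The number of violated inequalities; it is at least 1 outside the event, so its expectation
   bounds the probability of failure. *)
pose bad w := \sum_u (\sum_(f | atv u f) (bad1 u f w)%:R +
   \sum_(f | atv u f) \sum_(g | atv u g) (bad2 f g w)%:R) : R.
have swap (b : {ffun 'I_n -> config qs} -> bool) :
   \sum_w iid mu w * (b w)%:R = \sum_(w | b w) iid mu w.
  by rewrite [RHS]big_mkcond; apply: eq_bigr => w _; case: (b w); rewrite ?mulr1 ?mulr0.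
have i0 := iid_ge0 (mu_ge0 L theta qpos).
apply: (@le_trans _ _ (\sum_w iid mu w * bad w)).
  rewrite big_mkcond /=; apply: ler_sum => w _.
  have bad0 : 0 <= bad w.
    by apply: sumr_ge0 => u _; apply: addr_ge0; apply: sumr_ge0 => f _ //; apply: sumr_ge0.
  case: ifPn => [/asboolPn nc|_]; last by rewrite mulr_ge0.
  have pos1 v : 0 <= \sum_(f | atv v f) (bad1 v f w)%:R :> R by apply: sumr_ge0.
  have pos2 v : 0 <= \sum_(f | atv v f) \sum_(g | atv v g) (bad2 f g w)%:R :> R.
    by apply: sumr_ge0 => f _; apply: sumr_ge0.
  have badu v : \sum_(f | atv v f) (bad1 v f w)%:R +
      \sum_(f | atv v f) \sum_(g | atv v g) (bad2 f g w)%:R <= bad w.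
    by rewrite /bad (bigD1 v) //= lerDl; apply: sumr_ge0 => v' _; apply: addr_ge0.
  rewrite ler_peMr // leNgt; apply/negP => b1; apply: nc; right; split=> [u f fu|u f g fu gu].
    rewrite leNgt; apply/negP => b; move: b1; apply/negP; rewrite -leNgt.
    apply: le_trans (badu u); apply: (@le_trans _ _ (\sum_(f | atv u f) (bad1 u f w)%:R)).
      by rewrite (bigD1 f) //= /bad1 b lerDl; apply: sumr_ge0.
    by rewrite lerDl.
  rewrite leNgt; apply/negP => b; move: b1; apply/negP; rewrite -leNgt.
  apply: le_trans (badu u).
  apply: (@le_trans _ _ (\sum_(f | atv u f) \sum_(g | atv u g) (bad2 f g w)%:R)).
    rewrite (bigD1 f) //= (bigD1 g) //= /bad2 b -addrA lerDl; apply: addr_ge0.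
      by apply: sumr_ge0.
    by apply: sumr_ge0 => f' _; apply: sumr_ge0.
  by rewrite lerDr.
pose K : R := (p ^ (L - 1) * q ^ L)%:R.
have K0 : 0 <= K by exact: ler0n.
have K1 : 1 <= K by rewrite ler1n muln_gt0 !expn_gt0 p0 q0.
have ex0 : 0 <= ex by exact: expR_ge0.
have card_sum u (F : mfactor qs -> R) (c : R) : 0 <= c ->
    (forall f, atv u f -> F f <= c) -> \sum_(f | atv u f) F f <= K * c.
  move=> c0 Fc; apply: (@le_trans _ _ (\sum_(f | atv u f) c)); first exact: ler_sum.
  by rewrite sumr_const -mulr_natl ler_wpM2r // ler_nat card_at_vertex.
apply: (@le_trans _ _ (\sum_(u < p) (K * (2 * ex) + K * (K * (2 * ex))))).
  under eq_bigr do rewrite mulr_sumr.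
  rewrite exchange_big; apply: ler_sum => u _ /=.
  under eq_bigr do rewrite mulrDr !mulr_sumr.
  rewrite big_split /=; apply: lerD.
    rewrite exchange_big /=.
    apply: (card_sum u (fun f => \sum_w iid mu w * (bad1 u f w)%:R)) => [|f fu].
      by rewrite mulr_ge0.
    by rewrite swap; apply: pr1.
  rewrite exchange_big /=.
  apply: (card_sum u (fun f => \sum_w iid mu w * \sum_(g | atv u g) (bad2 f g w)%:R))
    => [|f fu]; first by rewrite !mulr_ge0.
  under eq_bigr do rewrite mulr_sumr.
  rewrite exchange_big /=.
  apply: (card_sum u (fun g => \sum_w iid mu w * (bad2 f g w)%:R)) => [|g gu].
    by rewrite mulr_ge0.
  by rewrite swap; apply: pr2.
rewrite sumr_const card_ord -[X in X <= _]mulr_natl.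
apply: (@le_trans _ _ (4 * (p%:R * K ^+ 2) * ex)).
  have -> : 4 * (p%:R * K ^+ 2) * ex = p%:R * (4 * K ^+ 2 * ex) by ring.
  rewrite ler_wpM2l //.
  have : K * ex <= K * K * ex by rewrite ler_wpM2r // ler_peMr.
  by rewrite expr2; lra.
have -> : p%:R * K ^+ 2 = q%:R ^+ (2 * L)%N * p%:R ^+ (2 * L - 1)%N :> R.
  rewrite /K -!natrX -!natrM; congr (_%:R); case: (L) L0 => // L' _.
  have -> : (2 * L'.+1 - 1 = (2 * L').+1)%N by rewrite mulnS subn1.
  by rewrite subn1 /= expnMn [in RHS]expnS -!expnM ![(_ * 2)%N]mulnC mulnA mulnC.
pose X : R := 4 * L%:R * q%:R ^+ (2 * L)%N * p%:R ^+ (2 * L - 1)%N / delta.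
have Y0 : 0 < q%:R ^+ (2 * L)%N * p%:R ^+ (2 * L - 1)%N :> R.
  by rewrite mulr_gt0 // exprn_gt0 // ltr0n.
have L1 : 1 <= L%:R :> R by rewrite ler1n.
have X0 : 0 < X by rewrite divr_gt0 // -!mulrA !mulr_gt0 ?exprn_gt0 ?ltr0n.
have -> : ex = X^-1 by rewrite /ex expRN -/X lnK.
rewrite ler_pdivrMr //.
have -> : delta * X = 4 * (L%:R * (q%:R ^+ (2 * L)%N * p%:R ^+ (2 * L - 1)%N)).
  by rewrite /X; field; rewrite gt_eqF.
by rewrite ler_pM2l // ler_peMl // ltW.
Qed.

End Concentration.

Lemma suprise_recovers (R : realType) (L q p : nat) (qs : 'I_p -> nat) (theta : param R qs)
    (alpha gamma gammahat delta : R) (n : nat) :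
  (0 < L)%N -> (0 < p)%N ->
  (forall i, (0 < qs i <= q)%N) ->
  globally_centered L theta ->
  interaction_strength L theta = gamma ->
  0 < gammahat ->
  (forall u, l1norm L u theta <= gammahat) ->
  0 < alpha ->
  (forall c, c \in structure L theta -> alpha <= l2norm (theta c)) ->
  0 < delta -> delta < 1 ->
  sample_bound L q p alpha gamma gammahat delta <= n%:R ->
  1 - delta <=
    prob_samples L theta
      (fun w : {ffun 'I_n -> config qs} =>
         forall Shat : {set {set 'I_p}},
           suprise_output L w alpha gammahat
             (suprise_eps L q theta alpha gammahat) Shat <->
           Shat = structure L theta).
Proof.
move=> L0 p0 qsq cent <- gh0 l1 a0 l2 d0 d1 nb.
have qpos i : (0 < qs i)%N by have /andP[] := qsq i.
have q0 : (0 < q)%N by have /andP[/leq_trans h /h] := qsq (Ordinal p0).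
have n0 : (0 < n)%N.
  by rewrite -(ltr0n R); apply: lt_le_trans nb; apply: sample_bound_gt0.
apply: le_trans (prob_concentrated L0 p0 qsq gh0 a0 d0 d1 nb) _.
rewrite /prob_samples big_mkcond [leRHS]big_mkcond; apply: ler_sum => w _.
have i0 : 0 <= \prod_(m < n) mu_general L theta (w m).
  by apply: prodr_ge0 => m _; exact: mu_ge0.
case: asboolP => [conc|_]; last by case: ifP.
by case: asboolP => // -[] Shat; apply: output_iff conc.
Qed.

Local Open Scope nat_scope.

(** * Codes of sets and of factors *)

Section Digits.
Variable b : nat.
Implicit Types (a : nat -> nat) (n i j x : nat).

Definition digit x i : nat := (x %/ b ^ i) %% b.

Definition of_digits n a : nat := \sum_(j < n) a j * b ^ j.

Lemma of_digitsS n a : of_digits n.+1 a = a 0 + b * of_digits n (fun j => a j.+1).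
Proof.
rewrite /of_digits big_ord_recl expn0 muln1; congr (_ + _).
by rewrite big_distrr; apply: eq_bigr => j _ /=; rewrite expnS mulnCA.
Qed.

Lemma of_digits_lt n a : (forall j, j < n -> a j < b) -> of_digits n a < b ^ n.
Proof.
elim: n a => [|n IH] a h; first by rewrite /of_digits big_ord0.
rewrite of_digitsS expnS.
have h0 : a 0 < b by exact: h.
have h1 := IH (fun j => a j.+1) (fun j hj => h j.+1 hj).
apply: (@leq_trans (b + b * of_digits n (fun j => a j.+1))).
  by rewrite -addSn leq_add2r.
by rewrite -mulnS leq_mul2l h1 orbT.
Qed.

Lemma digit0 x : digit x 0 = x %% b.
Proof. by rewrite /digit expn0 divn1. Qed.

Lemma digitS x i : digit x i.+1 = digit (x %/ b) i.
Proof. by rewrite /digit expnS divnMA. Qed.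

Lemma digit_of_digits n a i : (forall j, j < n -> a j < b) ->
  digit (of_digits n a) i = if i < n then a i else 0.
Proof.
elim: n a i => [|n IH] a i h.
  by rewrite /of_digits big_ord0 /digit div0n mod0n.
have h0 : a 0 < b by exact: h.
have b0 : 0 < b by exact: leq_trans h0.
rewrite of_digitsS; case: i => [|i].
  by rewrite digit0 addnC mulnC modnMDl modn_small.
rewrite digitS addnC mulnC divnMDl // (divn_small h0) addn0 IH //.
by move=> j hj; apply: h.
Qed.

Lemma of_digits_digit n x : x < b ^ n -> of_digits n (digit x) = x.
Proof.
elim: n x => [|n IH] x.
  by rewrite expn0 ltnS leqn0 => /eqP ->; rewrite /of_digits big_ord0.
move=> h; rewrite of_digitsS digit0.
have b0 : 0 < b by case: (b) h => //; rewrite exp0n.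
have -> : of_digits n (fun j => digit x j.+1) = x %/ b.
  rewrite -[RHS]IH; last by rewrite ltn_divLR // -expnSr.
  by apply: eq_bigr => j _; rewrite digitS.
by rewrite addnC mulnC -divn_eq.
Qed.

Lemma digit_ltn x i : 0 < b -> digit x i < b.
Proof. exact: ltn_pmod. Qed.

Lemma foldr_digits (s : seq nat) :
  foldr (fun x k => x + b * k) 0 s = of_digits (size s) (nth 0 s).
Proof. by elim: s => [|x s IH] /=; rewrite ?of_digitsS -?IH // /of_digits big_ord0. Qed.

Lemma foldr_digits_cat (s1 s2 : seq nat) :
  foldr (fun x k => x + b * k) 0 (s1 ++ s2) =
  foldr (fun x k => x + b * k) 0 s1 + b ^ size s1 * foldr (fun x k => x + b * k) 0 s2.
Proof.
elim: s1 => [|x s1 IH] /=; first by rewrite expn0 mul1n.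
by rewrite IH mulnDr expnS mulnA addnA.
Qed.

Lemma digit_eq n x y : x < b ^ n -> y < b ^ n ->
  (forall j, j < n -> digit x j = digit y j) -> x = y.
Proof.
move=> hx hy h; rewrite -(of_digits_digit hx) -(of_digits_digit hy).
by apply: eq_bigr => j _; rewrite h.
Qed.

End Digits.

Section SetCodes.
Variable p : nat.
Implicit Types (r : {set 'I_p}).

Definition verts r : seq nat := [seq val i | i <- enum r].

Lemma size_verts r : size (verts r) = #|r|.
Proof. by rewrite size_map -cardE. Qed.

Lemma mem_verts r (i : 'I_p) : (val i \in verts r) = (i \in r).
Proof. by rewrite (mem_map val_inj) mem_enum. Qed.

Lemma verts_lt r j : j < #|r| -> nth 0 (verts r) j < p.
Proof.
rewrite -size_verts => h; have := mem_nth 0 h.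
by move/mapP => [i _ ->]; exact: ltn_ord.
Qed.

Lemma set_codeE r :
  set_code r = of_digits p.+1 #|r| (fun j => (nth 0 (verts r) j).+1).
Proof.
have -> : set_code r = foldr (fun x k => x + p.+1 * k) 0 [seq x.+1 | x <- verts r].
  by rewrite /set_code /verts; elim: (enum r) => [|x s IH] //=; rewrite IH.
rewrite foldr_digits size_map size_verts; apply: eq_bigr => j _.
by rewrite (nth_map 0) ?size_verts.
Qed.

Lemma set_code_digit r j :
  digit p.+1 (set_code r) j = if j < #|r| then (nth 0 (verts r) j).+1 else 0.
Proof.
rewrite set_codeE digit_of_digits // => i hi.
by rewrite ltnS verts_lt.
Qed.

Lemma set_code_lt r L : #|r| <= L -> set_code r < p.+1 ^ L.
Proof.
move=> h; rewrite set_codeE; apply: (@leq_trans (p.+1 ^ #|r|)).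
  by apply: of_digits_lt => j hj; rewrite ltnS verts_lt.
by rewrite leq_pexp2l.
Qed.

Lemma mem_set_code r (i : 'I_p) :
  (i \in r) = has (fun j => digit p.+1 (set_code r) j == i.+1) (iota 0 #|r|).
Proof.
rewrite -mem_verts; apply/idP/hasP => [h|[j]].
  exists (index (val i) (verts r)).
    by rewrite mem_iota /= add0n -size_verts index_mem.
  by rewrite set_code_digit -size_verts index_mem h nth_index.
rewrite mem_iota add0n /= => hj; rewrite set_code_digit hj eqSS => /eqP <-.
by rewrite mem_nth // size_verts.
Qed.

Lemma set_code_inj : injective (@set_code p).
Proof.
move=> r r' e; have cE : #|r| = #|r'|.
  apply/eqP; case: (ltngtP #|r| #|r'|) => // h.
    by have := set_code_digit r #|r|; rewrite ltnn e set_code_digit h.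
  by have := set_code_digit r' #|r'|; rewrite ltnn -e set_code_digit h.
by apply/setP => i; rewrite !mem_set_code e cE.
Qed.

Lemma sorted_enum r : sorted ltn (verts r).
Proof.
have -> : verts r = [seq x <- iota 0 p | x \in verts r].
  rewrite -val_enum_ord filter_map {1}/verts; congr map.
  rewrite {1}/enum_mem -enumT; apply/eq_in_filter => i _ /=.
  by rewrite mem_verts.
by apply: sorted_filter; [exact: ltn_trans | exact: iota_ltn_sorted].
Qed.

Lemma verts_setU1 r (x : 'I_p) : (forall y, y \in r -> x < y) ->
  verts (x |: r) = val x :: verts r.
Proof.
move=> h; apply: (irr_sorted_eq ltn_trans ltnn) => [||y].
- exact: sorted_enum.
- have := sorted_enum r; rewrite /=; case E : (verts r) => [|z s] //= ->.
  rewrite andbT; have : z \in verts r by rewrite E mem_head.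
  by move/mapP => [i]; rewrite mem_enum => /h xi ->.
- apply/mapP/idP => [[i]|].
    rewrite mem_enum !inE => /orP[/eqP -> ->|ir ->]; first by rewrite eqxx.
    by rewrite mem_verts ir orbT.
  rewrite inE => /orP[/eqP ->|/mapP[i]]; first by exists x; rewrite // mem_enum !inE eqxx.
  by rewrite mem_enum => ir ->; exists i; rewrite // mem_enum !inE ir orbT.
Qed.

Lemma set_code_setU1 r (x : 'I_p) : (forall y, y \in r -> x < y) ->
  set_code (x |: r) = x.+1 + p.+1 * set_code r.
Proof.
move=> h; have xr : x \notin r by apply/negP => /h; rewrite ltnn.
rewrite !set_codeE cardsU1 xr add1n of_digitsS verts_setU1 //=.
Qed.

Lemma set_code0 : set_code (finset.set0 : {set 'I_p}) = 0.
Proof. by rewrite set_codeE cards0 /of_digits big_ord0. Qed.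

Lemma set_code_eq0 r : (set_code r == 0) = (r == finset.set0).
Proof. by rewrite -(inj_eq set_code_inj) set_code0. Qed.

Lemma verts_D1 r (i : 'I_p) j : j < #|r| -> nth 0 (verts r) j = i ->
  verts (r :\ i) = take j (verts r) ++ drop j.+1 (verts r).
Proof.
rewrite -size_verts => hj ij.
have dec : verts r = take j (verts r) ++ val i :: drop j.+1 (verts r).
  by rewrite -{1}(cat_take_drop j (verts r)) (drop_nth 0 hj) ij.
apply: (irr_sorted_eq ltn_trans ltnn) => [||y].
- exact: sorted_enum.
- apply: (subseq_sorted ltn_trans) (sorted_enum r); rewrite {3}dec.
  by rewrite cat_subseq // subseq_cons.
have U : uniq (verts r) by rewrite (map_inj_uniq val_inj) enum_uniq.
have iN : val i \notin take j (verts r) ++ drop j.+1 (verts r).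
  move: U; rewrite {1}dec -cat_rcons cat_uniq rcons_uniq mem_cat negb_or.
  move=> /and3P[/andP[-> _] /hasPn h _] /=; apply/negP => /h.
  by rewrite mem_rcons mem_head.
have yV : (y \in verts r) = (y == val i) || (y \in take j (verts r) ++ drop j.+1 (verts r)).
  by rewrite {1}dec !mem_cat inE orbCA.
apply/mapP/idP => [[k]|h].
  rewrite mem_enum !inE => /andP[ki kr] yk.
  have : y \in verts r by rewrite yk mem_verts.
  rewrite yV => /orP[/eqP e|//].
  by case/eqP: ki; apply: val_inj; rewrite -yk.
have : y \in verts r by rewrite yV h orbT.
move/mapP => [k]; rewrite mem_enum => kr yk; exists k => //.
rewrite mem_enum !inE kr andbT; apply/eqP => ki.
by move: iN; rewrite -ki -yk h.
Qed.

(** The digits above position [j] move down by one place. By this arithmetic the program reaches the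
    sets directly below a given one. *)
Lemma set_code_D1 r (i : 'I_p) j : j < #|r| -> nth 0 (verts r) j = i ->
  set_code (r :\ i) = set_code r %/ p.+1 ^ j.+1 * p.+1 ^ j + set_code r %% p.+1 ^ j.
Proof.
move=> hj ij; have hs : j < size (verts r) by rewrite size_verts.
pose f s := foldr (fun x k => x + p.+1 * k) 0 [seq x.+1 | x <- s].
have codeE r' : set_code r' = f (verts r').
  by rewrite /f /set_code /verts; elim: (enum r') => [|x s IH] //=; rewrite IH.
have fcat s1 s2 : f (s1 ++ s2) = f s1 + p.+1 ^ size s1 * f s2.
  by rewrite /f map_cat foldr_digits_cat size_map.
have szt : size (take j (verts r)) = j by rewrite size_takel // ltnW.
have flt : f (take j (verts r)) < p.+1 ^ j.
  rewrite -[j in X in _ < X]szt /f foldr_digits size_map; apply: of_digits_lt => k hk.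
  rewrite (nth_map 0) // ltnS nth_take; last by rewrite -szt.
  by apply: verts_lt; rewrite -size_verts; apply: leq_trans hk _; rewrite size_takel // ltnW.
rewrite !codeE (verts_D1 hj ij) fcat szt.
have -> : verts r = take j (verts r) ++ val i :: drop j.+1 (verts r).
  by rewrite -{1}(cat_take_drop j (verts r)) (drop_nth 0 hs) ij.
rewrite take_cat szt ltnn subnn take0 cats0 drop_cat szt ltnNge leqnSn /= subSnn /= drop0.
rewrite fcat szt.
have b0 : 0 < p.+1 ^ j by rewrite expn_gt0.
rewrite [X in X %% _]addnC [X in (X + _) %% _]mulnC modnMDl (modn_small flt).
rewrite [LHS]addnC [X in X + _ = _]mulnC; congr (_ * _ + _).
rewrite expnSr divnMA addnC mulnC divnMDl // (divn_small flt) addn0.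
by rewrite /f /= addnC mulnC divnMDl // divn_small ?addn0 // ltnS ltn_ord.
Qed.

End SetCodes.

(** The digits of a code increase, so removing the lowest digit removes the least element. Apart
    from the quotient being a code, only the two lowest digits matter, which lets the program decide
    all codes in increasing order. *)
Lemma set_code_rec p (x : nat) : (0 < x)%N ->
  (exists r : {set 'I_p}, set_code r = x) <->
  [/\ exists r : {set 'I_p}, set_code r = (x %/ p.+1)%N, (0 < x %% p.+1)%N &
      (x %/ p.+1 == 0)%N || (x %% p.+1 < (x %/ p.+1) %% p.+1)%N].
Proof.
move=> x0; split=> [[r rx]|[[r' r'x] d0 lt]].
  have r0 : r != finset.set0 by rewrite -set_code_eq0 rx -lt0n.
  have c0 : (0 < #|r|)%N by rewrite card_gt0.
  have : nth 0%N (verts r) 0 \in verts r by rewrite mem_nth // size_verts.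
  move=> /mapP[i]; rewrite mem_enum => ir ni.
  have min y : y \in r :\ i -> (i < y)%N.
    rewrite !inE => /andP[yi yr]; have := sorted_enum r; rewrite -mem_verts in yr.
    case E : (verts r) ni yr => [|z s] //= ->.
    rewrite inE -(inj_eq val_inj) in yi * => /orP[e|ys]; first by rewrite e in yi.
    by move/(order_path_min ltn_trans)/allP; apply.
  have rE : r = i |: (r :\ i) by rewrite finset.setD1K.
  have E := set_code_setU1 min; rewrite -rE rx in E.
  have xm : (x %% p.+1 = i.+1)%N.
    by rewrite E addnC mulnC modnMDl modn_small // ltnS ltn_ord.
  have xd : (x %/ p.+1 = set_code (r :\ i))%N.
    by rewrite E addnC mulnC divnMDl // divn_small ?addn0 // ltnS ltn_ord.
  split; [by exists (r :\ i) | by rewrite xm |].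
  rewrite xd xm set_code_eq0; case: eqVneq => //= ne.
  rewrite -digit0 set_code_digit card_gt0 ne ltnS.
  have : nth 0%N (verts (r :\ i)) 0 \in verts (r :\ i).
    by rewrite mem_nth // size_verts card_gt0.
  by move=> /mapP[k]; rewrite mem_enum => /min ik ->.
have hd : ((x %% p.+1).-1 < p)%N by rewrite -ltnS prednK // ltn_pmod.
exists (Ordinal hd |: r'); rewrite set_code_setU1 /=.
  by rewrite prednK // r'x addnC mulnC -divn_eq.
move=> y yr; move: lt; rewrite -r'x set_code_eq0 => /orP[/eqP r0|].
  by rewrite r0 inE in yr.
have c0 : (0 < #|r'|)%N by apply/card_gt0P; exists y.
rewrite -(digit0 _ (set_code r')) set_code_digit c0 => lt.
rewrite -ltnS prednK //; apply: leq_trans lt _; rewrite ltnS.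
rewrite -mem_verts in yr; have := sorted_enum r'.
case: (verts r') yr => [|z s] //=; rewrite inE => /orP[/eqP <- //|ys].
by move/(order_path_min ltn_trans)/allP/(_ _ ys)/ltnW.
Qed.

Lemma card_set_code p (r r' : {set 'I_p}) : r != finset.set0 ->
  set_code r' = (set_code r %/ p.+1)%N -> #|r| = #|r'|.+1.
Proof.
move=> r0 e.
have dg j : digit p.+1 (set_code r') j = digit p.+1 (set_code r) j.+1 by rewrite e digitS.
have c0 : (0 < #|r|)%N by rewrite card_gt0.
apply/eqP; case: (ltngtP #|r| #|r'|.+1) => // h.
  have := dg #|r|.-1; rewrite prednK // [in RHS]set_code_digit ltnn set_code_digit.
  by have -> : (#|r|.-1 < #|r'|)%N by rewrite -ltnS prednK.
by have := dg #|r'|; rewrite !set_code_digit ltnn h.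
Qed.

Lemma foldr_pairs (T : Type) (f g : T -> nat) (P Q : nat) (l : seq T) :
  (foldr (fun i k => f i + P * (g i + Q * k)) 0 l =
   foldr (fun x k => x + P * Q * k) 0 [seq f i + P * g i | i <- l])%N.
Proof. by elim: l => [|x l IH] //=; rewrite IH mulnDr addnA mulnA. Qed.

Section Letters.
Local Open Scope nat_scope.
Variables (p : nat) (qs : 'I_p -> nat).
Local Notation Q := (\max_(j < p) qs j).

Definition qn (x : nat) : nat := nth 0 [seq qs i | i <- enum 'I_p] x.

Lemma qnE (i : 'I_p) : qn i = qs i.
Proof. by rewrite /qn (nth_map i) ?size_enum_ord // nth_ord_enum. Qed.

Lemma qn_le x : qn x <= Q.
Proof.
have [xp|xp] := ltnP x p; first by rewrite (qnE (Ordinal xp)) leq_bigmax.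
by rewrite /qn nth_default // size_map size_enum_ord.
Qed.

Variable r : {set 'I_p}.
Local Notation sub := {i : 'I_p | i \in r}.
Implicit Types (s : letters qs r).

Definition lseq s : seq nat := [seq val (s i) | i <- enum {: sub}].

Lemma size_sub : size (enum {: sub}) = #|r|.
Proof. by rewrite -cardE card_sig. Qed.

(** The subtype is enumerated in the order of [enum r], so that a position names the same vertex in
    the list of vertices and in the list of letters. *)
Lemma verts_sub : verts r = [seq val (val i) | i <- enum {: sub}].
Proof.
have -> : enum {: sub} = pmap insub (enum 'I_p) :> seq sub.
  by rewrite [LHS]enumT [in LHS]unlock [in RHS]enumT.
rewrite (map_comp val val) (@pmap_filter _ _ _ val (insubK _)) /verts; congr map.
rewrite {1}/enum_mem -enumT; apply: eq_filter => i.
by rewrite /= isSome_insub.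
Qed.

Lemma nth_pos (j : 'I_#|r|) : exists i : sub,
  nth 0 (verts r) j = val (val i) /\ forall s, nth 0 (lseq s) j = s i.
Proof.
have hj : j < size (enum {: sub}) by rewrite size_sub.
have [x0 _] : exists x : sub, x \in enum {: sub}.
  by case: (enum {: sub}) hj => [|x l] // _; exists x; rewrite mem_head.
exists (nth x0 (enum {: sub}) j); split=> [|s].
  by rewrite verts_sub (nth_map x0).
by rewrite /lseq (nth_map x0).
Qed.

Lemma pos_of (i : sub) : exists j : 'I_#|r|,
  nth 0 (verts r) j = val (val i) /\ forall s, nth 0 (lseq s) j = s i.
Proof.
have hj : index i (enum {: sub}) < #|r| by rewrite -size_sub index_mem mem_enum.
exists (Ordinal hj) => /=; split=> [|s].
  by rewrite verts_sub (nth_map i) ?size_sub // nth_index // mem_enum.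
by rewrite /lseq (nth_map i) ?size_sub // nth_index // mem_enum.
Qed.

Lemma prod_pos (R : comNzRingType) (F : nat -> nat -> nat -> R) s s' :
  (\prod_(i : sub) F (val (val i)) (s i) (s' i) =
  \prod_(j < #|r|) F (nth 0 (verts r) j) (nth 0 (lseq s) j) (nth 0 (lseq s') j))%R.
Proof.
rewrite -big_enum; case E : (enum {: sub}) => [|x0 l].
  rewrite -size_sub E big_nil /=; by rewrite big_ord0.
rewrite -E (big_nth x0) size_sub big_mkord; apply: eq_bigr => j _.
have hj : j < size (enum {: sub}) by rewrite size_sub.
by rewrite verts_sub /lseq !(nth_map x0) -?enumT ?size_sub.
Qed.

Definition lcode s : nat := of_digits Q #|r| (nth 0 (lseq s)).

(** With the common base [Q], a digit may exceed the alphabet of its vertex, so not every number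
    below [Q ^ #|r|] codes letters. *)
Definition lvalid (e : nat) : bool :=
  [forall j : 'I_#|r|, digit Q e j < qn (nth 0 (verts r) j)].

Lemma lseq_lt s (j : 'I_#|r|) : nth 0 (lseq s) j < qn (nth 0 (verts r) j).
Proof. by have [i [-> ->]] := nth_pos j; rewrite qnE. Qed.

Lemma lseq_ltQ s j : j < #|r| -> nth 0 (lseq s) j < Q.
Proof. by move=> h; apply: leq_trans (lseq_lt s (Ordinal h)) (qn_le _). Qed.

Lemma lcode_lt s : lcode s < Q ^ #|r|.
Proof. by apply: of_digits_lt => j; exact: lseq_ltQ. Qed.

Lemma lcode_digit s j : digit Q (lcode s) j = if j < #|r| then nth 0 (lseq s) j else 0.
Proof. by rewrite digit_of_digits // => i; exact: lseq_ltQ. Qed.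

Lemma lcode_valid s : lvalid (lcode s).
Proof. by apply/forallP => j; rewrite lcode_digit ltn_ord; exact: lseq_lt. Qed.

Lemma lcode_inj : injective lcode.
Proof.
move=> s s' e; apply/ffunP => i; apply/val_inj => /=.
have [j [_ h]] := pos_of i; rewrite -!h.
by have := lcode_digit s j; rewrite e lcode_digit ltn_ord.
Qed.

Hypothesis qpos : forall i, 0 < qs i.

Definition ldecode (e : nat) : letters qs r :=
  [ffun i => odflt (Ordinal (qpos (val i)))
     (insub (digit Q e (index i (enum {: sub}))))].

Lemma ldecodeK e : e < Q ^ #|r| -> lvalid e -> lcode (ldecode e) = e.
Proof.
move=> hlt /forallP v; apply: (digit_eq (lcode_lt _) hlt) => j hj.
rewrite lcode_digit hj.
have hj' : j < size (enum {: sub}) by rewrite size_sub.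
have [x0 _] : exists x : sub, x \in enum {: sub}.
  by case: (enum {: sub}) hj' => [|x l] // _; exists x; rewrite mem_head.
rewrite /lseq (nth_map x0) // ffunE index_uniq ?enum_uniq //.
have := v (Ordinal hj); rewrite /= verts_sub (nth_map x0) // qnE => lt.
by rewrite insubT.
Qed.

(** The loops of the program run over all codes; their sums are the intended ones because the
    summands vanish at invalid codes. *)
Lemma sum_lcode (R : nzRingType) (g : nat -> R) :
  (forall e, e < Q ^ #|r| -> ~~ lvalid e -> g e = 0%R) ->
  (\sum_(s : letters qs r) g (lcode s) = \sum_(e < Q ^ #|r|) g e)%R.
Proof.
move=> g0; rewrite [RHS](bigID (fun e : 'I_(Q ^ #|r|) => lvalid e)) /=.
rewrite [X in (_ + X)%R]big1 ?addr0 => [|e]; last exact: g0.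
rewrite (reindex_onto (fun s => Ordinal (lcode_lt s)) (fun e => ldecode e)) /=.
  apply: eq_bigl => s; rewrite lcode_valid /=; apply/esym/eqP/lcode_inj.
  by rewrite ldecodeK ?lcode_lt ?lcode_valid.
by move=> e ve; apply/val_inj; rewrite /= ldecodeK.
Qed.

Lemma factor_codeE s : factor_code s =
  of_digits (p.+1 * Q) #|r| (fun j => (nth 0 (verts r) j).+1 + p.+1 * nth 0 (lseq s) j).
Proof.
have -> : factor_code s = foldr (fun x k => x + p.+1 * Q * k) 0
    [seq (val (val i)).+1 + p.+1 * s i | i <- enum {: sub}].
  exact: foldr_pairs.
rewrite foldr_digits size_map size_sub; apply: eq_bigr => j _.
have hj' : j < size (enum {: sub}) by rewrite size_sub.
have [x0 _] : exists x : sub, x \in enum {: sub}.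
  by case: (enum {: sub}) hj' => [|x l] // _; exists x; rewrite mem_head.
by rewrite verts_sub /lseq !(nth_map x0) -?enumT ?size_sub.
Qed.

End Letters.

Section FactorCodes.
Local Open Scope nat_scope.
Variables (p : nat) (qs : 'I_p -> nat).
Local Notation Q := (\max_(j < p) qs j).
Implicit Types (r : {set 'I_p}).

Definition fcode (len c e : nat) : nat :=
  of_digits (p.+1 * Q) len (fun j => digit p.+1 c j + p.+1 * digit Q e j).

Lemma fcode_lcode r (s : letters qs r) :
  fcode #|r| (set_code r) (lcode s) = factor_code s.
Proof.
rewrite factor_codeE; apply: eq_bigr => j _.
by rewrite set_code_digit lcode_digit ltn_ord.
Qed.

Hypothesis Q0 : 0 < Q.

Lemma fcode_digit r e j : digit (p.+1 * Q) (fcode #|r| (set_code r) e) j =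
  if j < #|r| then digit p.+1 (set_code r) j + p.+1 * digit Q e j else 0.
Proof.
rewrite digit_of_digits // => i _.
have h1 := digit_ltn (set_code r) i (ltn0Sn p).
have h2 := digit_ltn e i Q0.
apply: (@leq_trans (p.+1 + p.+1 * digit Q e i)); first by rewrite -addSn leq_add2r.
by rewrite -mulnS leq_mul2l h2 orbT.
Qed.

(** Modulo [p + 1] a digit gives back the vertex, and then its quotient the letter. Hence different
    coordinates never share a cell of the array of estimates. *)
Lemma fcode_inj r r' e e' : e < Q ^ #|r| -> e' < Q ^ #|r'| ->
  fcode #|r| (set_code r) e = fcode #|r'| (set_code r') e' -> r = r' /\ e = e'.
Proof.
move=> he he' E.
have D (r0 : {set 'I_p}) e0 j : digit (p.+1 * Q) (fcode #|r0| (set_code r0) e0) j %% p.+1 =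
    digit p.+1 (set_code r0) j.
  rewrite fcode_digit; case: ifP => [h|h]; last by rewrite mod0n set_code_digit h.
  by rewrite addnC mulnC modnMDl modn_small // digit_ltn.
have rr : r = r'.
  apply: set_code_inj.
  have pr (r0 : {set 'I_p}) : #|r0| <= p by rewrite -[X in _ <= X]card_ord max_card.
  apply: (digit_eq (set_code_lt (pr r)) (set_code_lt (pr r'))) => j _.
  by rewrite -(D r e) E D.
split=> //; subst r'.
apply: (digit_eq he he') => j hj.
have := fcode_digit r e j; rewrite E fcode_digit hj.
by move/addnI/eqP; rewrite eqn_mul2l /= => /eqP.
Qed.

End FactorCodes.

Local Open Scope ring_scope.

(** * Greedy minimization *)

(** A step towards a random atom compared with a step towards its mean. Expanding around the step
    towards the mean, the linear terms average out; the deviations are at most [2 * g * tau], which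
    leaves [tau ^ 2 * 4 * g ^ 2] times the exponentials [expR g] and [expR (2 * g)]. Convexity
    handles the step towards the mean. *)
Lemma expR_jensen_taylor (R : realType) (I : finType) (lam z : I -> R) (g y tau : R) :
  (forall i, 0 <= lam i) -> \sum_i lam i = 1 -> (forall i, `|z i| <= g) -> `|y| <= g ->
  0 <= tau -> tau <= 1 ->
  \sum_i lam i * expR (- ((1 - tau) * y + tau * z i)) <=
  (1 - tau) * expR (- y) + tau * expR (- \sum_i lam i * z i)
    + tau ^+ 2 * (4 * g ^+ 2 * expR (3 * g)).
Proof.
move=> l0 l1 zg yg t0 t1; set zs := \sum_i lam i * z i.
have g0 : 0 <= g by apply: le_trans yg.
have zsg : `|zs| <= g.
  apply: (le_trans (ler_norm_sum _ _ _)); rewrite -[X in _ <= X]mul1r -l1 mulr_suml.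
  by apply: ler_sum => i _; rewrite normrM ger0_norm ?ler_wpM2l.
pose a := (1 - tau) * y + tau * zs.
have ag : - a <= g.
  rewrite /a opprD; have -> : g = (1 - tau) * g + tau * g by ring.
  apply: lerD; rewrite -mulrN; apply: ler_wpM2l; rewrite ?subr_ge0 //.
    by apply: le_trans yg; rewrite -normrN ler_norm.
  by apply: le_trans zsg; rewrite -normrN ler_norm.
(* Convexity of the exponential, by adding the two tangent inequalities at [a], whose slopes
   cancel. *)
have conv : expR (- a) <= (1 - tau) * expR (- y) + tau * expR (- zs).
  have h v : expR (- a) * (1 + (a - v)) <= expR (- v).
    have -> : expR (- v) = expR (- a) * expR (a - v) by rewrite -expRD; congr expR; ring.
    by apply: ler_wpM2l (expR_ge1Dx _); exact: expR_ge0.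
  have h1 : (1 - tau) * (expR (- a) * (1 + (a - y))) <= (1 - tau) * expR (- y).
    by apply: ler_wpM2l (h y); rewrite subr_ge0.
  have h2 : tau * (expR (- a) * (1 + (a - zs))) <= tau * expR (- zs) by apply: ler_wpM2l (h zs).
  apply: le_trans (lerD h1 h2); rewrite le_eqVlt; apply/orP; left; apply/eqP.
  by rewrite /a; ring.
apply: (@le_trans _ _ (\sum_i lam i * (expR (- a) * (1 - tau * (z i - zs))
    + tau ^+ 2 * (4 * g ^+ 2 * expR (3 * g))))).
  apply: ler_sum => i _; apply: ler_wpM2l; first exact: l0.
  set x := - (tau * (z i - zs)).
  have -> : - ((1 - tau) * y + tau * z i) = - a + x by rewrite /a /x; ring.
  rewrite expRD.
  have xb : `|x| <= tau * (2 * g).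
    rewrite /x normrN normrM (ger0_norm t0); apply: ler_wpM2l => //.
    by apply: (le_trans (ler_normB _ _)); have := zg i; move: zsg; lra.
  have xb2 : `|x| <= 2 * g.
    by apply: le_trans xb _; rewrite -[X in _ <= X]mul1r ler_wpM2r // mulr_ge0.
  apply: (@le_trans _ _ (expR (- a) * (1 + x + x ^+ 2 * expR `|x|))).
    by apply: ler_wpM2l (expR_le_taylor2 x); exact: expR_ge0.
  rewrite mulrDr; apply: lerD; first by rewrite /x.
  have x2 : x ^+ 2 <= tau ^+ 2 * (4 * g ^+ 2).
    rewrite -real_normK ?num_real // (_ : _ * _ = (tau * (2 * g)) ^+ 2); last by ring.
    by rewrite lerXn2r // nnegrE // mulr_ge0 // mulr_ge0.
  apply: (@le_trans _ _ (expR g * (tau ^+ 2 * (4 * g ^+ 2) * expR (2 * g)))).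
    have x20 := sqr_ge0 x.
    apply: ler_pM; [exact: expR_ge0 | by apply: mulr_ge0 => //; exact: expR_ge0
      | by rewrite ler_expR |].
    by apply: ler_pM; rewrite ?ler_expR ?expR_ge0.
  have -> : expR (3 * g) = expR g * expR (2 * g) by rewrite -expRD; congr expR; ring.
  by rewrite le_eqVlt; apply/orP; left; apply/eqP; ring.
have lin (c d t : R) : \sum_i lam i * (c * (1 - tau * (z i - t)) + d) =
   c * (1 + tau * t) * (\sum_i lam i) - c * tau * (\sum_i lam i * z i) + d * \sum_i lam i.
  by rewrite !mulr_sumr -sumrB -big_split; apply: eq_bigr => i _ /=; ring.
rewrite lin -/zs l1 !mulr1 lerD2r; apply: le_trans conv; rewrite le_eqVlt.
by apply/orP; left; apply/eqP; ring.
Qed.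

(** * A finite net of the l1 ball of centered arrays on one set *)

Section Atoms.
Variables (R : realType) (p : nat) (qs : 'I_p -> nat) (gh : R) (K : nat).
Hypothesis qpos : forall i, (0 < qs i)%N.
Local Notation Q := (\max_(j < p) qs j)%N.
Implicit Types (r : {set 'I_p}).

(** The tensor product over the vertices of identity minus averaging, that is, the orthogonal
    projection onto the centered arrays. *)
Definition kern r (s' s : letters qs r) : R :=
  \prod_i centered_indicator R (s' i) (s i).

(* The digits 0, ..., 2K stand for the coefficients -K, ..., K: the shift is
   immaterial, because the kernel annihilates constants. *)
Definition atomv (N : nat) r (s : letters qs r) : R :=
  (gh / K%:R) * \sum_(s' : letters qs r)
    (digit (2 * K).+1 N (lcode s'))%:R * kern s' s.

Lemma kern_sym r (s' s : letters qs r) : kern s' s = kern s s'.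
Proof. by apply: eq_bigr => i _; rewrite ci_sym. Qed.

Lemma kern_norm r (s' s : letters qs r) : `|kern s' s| <= 1.
Proof. by rewrite normr_prod; apply: prodr_ile1 => i _; rewrite normr_ge0 ci_norm_le1. Qed.

Lemma kern_centered r (s' : letters qs r) : centered (fun s => kern s' s).
Proof.
move=> i s; rewrite sum_fiber.
rewrite (eq_bigr (fun a => centered_indicator R a (s' i) *
    \prod_(j | j != i) centered_indicator R (s' j) (s j))).
  by rewrite -mulr_suml sum_ci mul0r.
move=> a _; rewrite /kern (bigD1 i) //= updf_in ci_sym; congr (_ * _).
by apply: eq_bigr => j ji; rewrite updf_out.
Qed.

Lemma kern_lookup r (x : letters qs r -> R) (s : letters qs r) : centered x ->
  \sum_s' x s' * kern s' s = x s.
Proof.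
move=> cx; pose s0 : config qs := [ffun i => Ordinal (qpos i)].
have -> : x s = x (restr (glue s s0) r).
  by congr x; apply/ffunP => i; rewrite ffunE glue_in.
rewrite -centered_lookup //; apply: eq_bigr => s' _; congr (_ * _).
by apply: eq_bigr => i _; rewrite glue_in.
Qed.

Lemma sum_kern r (s : letters qs r) : (0 < #|r|)%N -> \sum_s' kern s' s = 0.
Proof.
case/card_gt0P => i ir; apply: (sum_fibers0 (i := exist _ i ir) (P := predT)) => // s0 _.
by under eq_bigr do rewrite kern_sym; exact: kern_centered.
Qed.

Lemma atomv_centered N r : centered (@atomv N r).
Proof.
move=> i s; rewrite /atomv -mulr_sumr exchange_big /= big1 ?mulr0 // => s' _.
by rewrite -mulr_sumr kern_centered mulr0.
Qed.

Lemma card_letters_le r : (#|letters qs r| <= Q ^ #|r|)%N.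
Proof.
rewrite -[X in (_ <= X)%N]card_ord.
rewrite -(card_imset _ (f := fun s : letters qs r => Ordinal (lcode_lt s))).
  exact: max_card.
by move=> s s' [/lcode_inj].
Qed.

Hypotheses (gh0 : 0 < gh).

(** Rounding could leave the ball, so [v] is first shrunk by [1 - eta], then rounded down to
    multiples of [gh / K] and projected. The projection fixes centered arrays and spreads the
    rounding errors: each entry moves by at most [QL] grid steps, the whole array by [eta * gh] in
    l1 norm, just the room that the shrinking has made. *)
Lemma atom_cover r (v : letters qs r -> R) (QL : nat) : (0 < #|r|)%N ->
  (Q ^ #|r| <= QL)%N -> (QL ^ 2 <= K)%N -> (0 < K)%N ->
  centered v -> \sum_s `|v s| <= gh ->
  exists N, [/\ (N < (2 * K).+1 ^ (Q ^ #|r|))%N,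
    \sum_(s : letters qs r) `|atomv N s| <= gh &
    \sum_(s : letters qs r) `|atomv N s - v s| <= 2 * (QL ^ 2)%:R / K%:R * gh].
Proof.
move=> r0 QLr QK K0 cv vgh.
have KR0 : 0 < K%:R :> R by rewrite ltr0n.
pose eta : R := (QL ^ 2)%:R / K%:R.
have eta0 : 0 <= eta by rewrite divr_ge0 ?ler0n.
have eta1 : eta <= 1 by rewrite ler_pdivrMr // mul1r ler_nat.
pose step := gh / K%:R; have step0 : 0 < step by rewrite divr_gt0.
pose v' s := (1 - eta) * v s.
have v'le s : `|v' s| <= gh.
  rewrite normrM ger0_norm ?subr_ge0 // -[X in _ <= X]mul1r.
  apply: ler_pM => //; rewrite ?subr_ge0 //; first by rewrite gerBl.
  by apply: le_trans vgh; rewrite (bigD1 s) //= lerDl; apply: sumr_ge0.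
(* Measured in grid steps and shifted by [K], the entries lie between 0 and [2 * K], so their
   integer parts are digits of the code [N]. *)
pose y s := v' s / step + K%:R.
have yE s : step * y s = v' s + gh.
  by rewrite /y /step; field; rewrite !gt_eqF.
have y0 s : 0 <= y s.
  rewrite -(pmulr_rge0 _ step0) yE; have := v'le s; rewrite ler_norml => /andP[]; lra.
have yK s : y s <= (2 * K)%:R.
  rewrite -(ler_pM2l step0) yE natrM.
  have -> : step * (2%:R * K%:R) = 2 * gh by rewrite /step; field; rewrite gt_eqF.
  by have := v'le s; rewrite ler_norml => /andP[]; lra.
pose a s := Num.truncn (y s).
have aP s : (a s)%:R <= y s < (a s).+1%:R by apply: truncn_itv.
have aB s : (a s < (2 * K).+1)%N.
  rewrite ltnS -(ler_nat R); apply: le_trans (yK s); by case/andP: (aP s).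
pose N := of_digits (2 * K).+1 (Q ^ #|r|)
  (fun e => if [pick s | lcode s == e] is Some s then a s else 0%N).
have Nlt : forall e, (e < Q ^ #|r|)%N ->
   ((if [pick s : letters qs r | lcode s == e] is Some s then a s else 0) < (2 * K).+1)%N.
  by move=> e _; case: pickP => [s _|_].
have Nd s : digit (2 * K).+1 N (lcode s) = a s.
  rewrite digit_of_digits // lcode_lt; case: pickP => [s' /eqP/lcode_inj -> //|].
  by move/(_ s); rewrite eqxx.
have cv' : centered v'.
  by move=> i s; rewrite /v' -mulr_sumr cv mulr0.
have close s : `|atomv N s - v' s| <= QL%:R * step.
  have -> : atomv N s - v' s = \sum_(s' : letters qs r) (step * ((a s')%:R - y s')) * kern s' s.
    rewrite -{1}(kern_lookup s cv') /atomv mulr_sumr -sumrB.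
    (* The shift contributes [gh] times a sum of the kernel, which is zero as [r] is nonempty. *)
    rewrite -[LHS]subr0 -[X in _ - X](mulr0 gh) -[X in _ - _ * X](sum_kern s r0).
    rewrite [X in _ - X]mulr_sumr -sumrB; apply: eq_bigr => s' _.
    by rewrite Nd mulrBr yE /step; ring.
  apply: (le_trans (ler_norm_sum _ _ _)).
  apply: (@le_trans _ _ (\sum_(s' : letters qs r) step)).
    apply: ler_sum => s' _; rewrite normrM [X in X * _]normrM (gtr0_norm step0) -mulrA -[X in _ <= X]mulr1.
    apply: ler_wpM2l; first exact: ltW.
    apply: mulr_ile1 => //; last exact: kern_norm.
    have := aP s'; rewrite -natr1 => /andP[h1 h2].
    by rewrite ler_norml; apply/andP; split; lra.
  rewrite sumr_const -[X in X <= _]mulr_natl.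
  apply: ler_wpM2r; first exact: ltW.
  rewrite ler_nat; exact: leq_trans (card_letters_le r) QLr.
have closes : \sum_s `|atomv N s - v' s| <= eta * gh.
  apply: (@le_trans _ _ (\sum_(s : letters qs r) QL%:R * step)); first exact: ler_sum.
  rewrite sumr_const -[X in X <= _]mulr_natl.
  have -> : eta * gh = QL%:R * (QL%:R * step).
    by rewrite /eta /step natrX; field; rewrite gt_eqF.
  apply: ler_wpM2r; first by rewrite mulr_ge0 ?ler0n ?ltW.
  by rewrite ler_nat (leq_trans (card_letters_le r) QLr).
exists N; split.
- exact: of_digits_lt.
- apply: (@le_trans _ _ (\sum_s `|atomv N s - v' s| + \sum_s `|v' s|)).
    by rewrite -big_split; apply: ler_sum => s _ /=; rewrite -{1}(subrK (v' s) (atomv N s)) ler_normD.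
  have -> : \sum_s `|v' s| = (1 - eta) * \sum_s `|v s|.
    by rewrite mulr_sumr; apply: eq_bigr => s _; rewrite normrM ger0_norm // subr_ge0.
  have : (1 - eta) * \sum_s `|v s| <= (1 - eta) * gh by apply: ler_wpM2l; rewrite ?subr_ge0.
  by move: closes; lra.
- apply: (@le_trans _ _ (\sum_s `|atomv N s - v' s| + \sum_s `|v' s - v s|)).
    rewrite -big_split; apply: ler_sum => s _ /=.
    by rewrite -[X in `|X| <= _](subrKA (v' s)) ler_normD.
  have -> : \sum_s `|v' s - v s| = eta * \sum_s `|v s|.
    rewrite mulr_sumr; apply: eq_bigr => s _.
    have -> : v' s - v s = - (eta * v s) by rewrite /v'; ring.
    by rewrite normrN normrM ger0_norm.
  have -> : 2 * (QL ^ 2)%:R / K%:R * gh = 2 * (eta * gh) by rewrite /eta; ring.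
  have : eta * \sum_s `|v s| <= eta * gh by apply: ler_wpM2l.
  by move: closes; lra.
Qed.

End Atoms.

(** * Convergence of the greedy Frank-Wolfe method *)

Section FrankWolfe.
Variables (R : realType) (p : nat) (qs : 'I_p -> nat) (L n : nat).
Variables (w : {ffun 'I_n -> config qs}) (gh : R) (K : nat) (u : 'I_p).
Variable (Rt : {set {set 'I_p}}).
Hypotheses (qpos : forall i, (0 < qs i)%N) (n0 : (0 < n)%N) (gh0 : 0 < gh).
Hypotheses (K0 : (0 < K)%N).
Local Notation Q := (\max_(j < p) qs j)%N.
Hypothesis (QK : ((Q ^ L) ^ 2 <= K)%N).
Local Notation atomv := (atomv gh K).
Implicit Types (r : {set 'I_p}) (X Y : param R qs).

Lemma local_energy_lin (a b : R) X Y sigma :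
  local_energy L (fun r s => a * X r s + b * Y r s) u sigma =
  a * local_energy L X u sigma + b * local_energy L Y u sigma.
Proof.
rewrite /local_energy !mulr_sumr -big_split; apply: eq_bigr => r _.
rewrite !mulr_sumr -big_split; apply: eq_bigr => s _ /=; ring.
Qed.

Lemma l1norm_lin (a b : R) X Y : 0 <= a -> 0 <= b ->
  l1norm L u (fun r s => a * X r s + b * Y r s) <= a * l1norm L u X + b * l1norm L u Y.
Proof.
move=> a0 b0; rewrite /l1norm !mulr_sumr -big_split; apply: ler_sum => r _.
rewrite !mulr_sumr -big_split; apply: ler_sum => s _ /=.
by apply: (le_trans (ler_normD _ _)); rewrite !normrM (ger0_norm a0) (ger0_norm b0).
Qed.

Definition blockp (r : {set 'I_p}) (Y : param R qs) : param R qs :=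
  fun r' s => if r' == r then Y r' s else 0.
Arguments blockp : clear implicits.

Lemma local_energy_block r Y sigma : local_energy L (blockp r Y) u sigma =
  if (r \in factor_sets p L) && (u \in r)
  then \sum_s Y r s * basis_fun R s sigma else 0.
Proof.
rewrite /local_energy /blockp; case: ifP => h; last first.
  rewrite big1 // => r' h'; rewrite big1 // => s _.
  by case: eqVneq => [e|]; rewrite ?mul0r //; rewrite e h in h'.
rewrite (bigD1 r) //= eqxx [X in _ + X]big1 ?addr0 // => r' /andP[_ /negbTE ->].
by rewrite big1 // => s _; rewrite mul0r.
Qed.

Lemma l1norm_block r Y : l1norm L u (blockp r Y) =
  if (r \in factor_sets p L) && (u \in r) then \sum_s `|Y r s| else 0.
Proof.
rewrite /l1norm /blockp; case: ifP => h; last first.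
  rewrite big1 // => r' h'; rewrite big1 // => s _.
  by case: eqVneq => [e|]; rewrite ?normr0 //; rewrite e h in h'.
rewrite (bigD1 r) //= eqxx [X in _ + X]big1 ?addr0 // => r' /andP[_ /negbTE ->].
by rewrite big1 // => s _; rewrite normr0.
Qed.

Definition atomp (r : {set 'I_p}) (N : nat) : param R qs :=
  blockp r (fun r' s => atomv N s).
Arguments atomp : clear implicits.

(* The pair (set0, 0) stands for the zero atom. *)
Definition adm (r : {set 'I_p}) (N : nat) : Prop :=
  (r = finset.set0 /\ N = 0%N) \/
  [/\ r \in factor_sets p L, r \in Rt, u \in r, (N < (2 * K).+1 ^ (Q ^ #|r|))%N &
      \sum_(s : letters qs r) `|atomv N s| <= gh].

(** The iterate is stored as [X], scaled by [k (k + 1) / 2]. In this scale the step of size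
    [2 / (k + 2)] towards an atom just adds [k + 1] times the atom, and old coordinates need no
    rescaling. For [k = 0] the quotient is 0 by convention and so is the iterate. *)
Definition curp (k : nat) (X : param R qs) : param R qs :=
  fun r s => 2 / (k * k.+1)%:R * X r s.
Arguments curp : clear implicits.

Definition nextp (k : nat) (X : param R qs) r N : param R qs :=
  fun r' s => X r' s + k.+1%:R * atomp r N r' s.
Arguments nextp : clear implicits.

(** [C] is the curvature term of [expR_jensen_taylor]; [slack] is the precision of the net times the
    Lipschitz constant [expR gh] of the exponential. *)
Let C : R := 4 * gh ^+ 2 * expR (3 * gh).
Let slack : R := 2 * ((Q ^ L) ^ 2)%:R / K%:R * gh * expR gh.
Local Notation S := (screening_objective L w u).

(** Multiplied by [k (k + 1)], the optimality gap telescopes under the step sizes [2 / (k + 2)] and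
    grows by at most [4 * C] in each step. *)
Definition fw_inv (k : nat) (X : param R qs) : Prop :=
  [/\ forall r, r \in factor_sets p L -> u \in r -> centered (X r),
      l1norm L u X <= gh * ((k * k.+1)%:R / 2),
      forall r, r \in factor_sets p L -> u \in r -> r \notin Rt -> forall s, X r s = 0 &
      forall x, feasible L gh Rt u x ->
        (k * k.+1)%:R * (S (curp k X) - S x - slack) <= 4 * C * k%:R].

Lemma fw_inv0 : fw_inv 0 (fun r (s : letters qs r) => 0).
Proof.
split=> //; last by move=> x _; rewrite mul0n mul0r mulr0.
  by move=> r _ _ i s; rewrite big1.
by rewrite mul0n mul0r mulr0 /l1norm big1 // => r _; rewrite big1 // => s _; rewrite normr0.
Qed.

Lemma set0_notin : (finset.set0 : {set 'I_p}) \in factor_sets p L = false.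
Proof. by rewrite inE cards0. Qed.

Lemma atomp_l1 r N : adm r N -> l1norm L u (atomp r N) <= gh.
Proof.
rewrite /atomp l1norm_block => -[[-> _]|[rF _ ur _ h]]; last by rewrite rF ur.
by rewrite set0_notin ltW.
Qed.

(** The best atom is at least as good as a random one. The random atom is chosen with mean near [x]:
    its set [r'] has probability equal to the l1 norm of the block of [x] on [r'] divided by [gh].
    Comparing the random step with the step towards the mean costs the curvature term, replacing the
    mean by [x] costs [slack]. *)
Lemma objective_step k X r N x : fw_inv k X -> adm r N -> feasible L gh Rt u x ->
  (forall r' N', adm r' N' -> S (curp k.+1 (nextp k X r N)) <= S (curp k.+1 (nextp k X r' N'))) ->
  S (curp k.+1 (nextp k X r N)) <=
   (1 - 2 / k.+2%:R) * S (curp k X) + 2 / k.+2%:R * (S x + slack) + (2 / k.+2%:R) ^+ 2 * C.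
Proof.
move=> [cX l1X RX hX] ar [cx l1x Rx] best.
have k2 : 0 < k.+2%:R :> R by rewrite ltr0n.
pose tau : R := 2 / k.+2%:R.
have t0 : 0 <= tau by rewrite divr_ge0.
have t1 : tau <= 1 by rewrite ler_pdivrMr // mul1r ler_nat.
have nR0 : 0 < n%:R :> R by rewrite ltr0n.
pose y m := local_energy L (curp k X) u (w m).
have nextE r' N' m : local_energy L (curp k.+1 (nextp k X r' N')) u (w m) =
    (1 - tau) * y m + tau * local_energy L (atomp r' N') u (w m).
  have E1 : local_energy L (curp k.+1 (nextp k X r' N')) u (w m) =
      2 / (k.+1 * k.+2)%:R * (local_energy L X u (w m) +
        k.+1%:R * local_energy L (atomp r' N') u (w m)).
    rewrite mulrDr mulrA -local_energy_lin; congr (local_energy _ _ _ _).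
    apply: functional_extensionality_dep => r''; apply: funext => s.
    by rewrite /curp /nextp; ring.
  have E2 : y m = 2 / (k * k.+1)%:R * local_energy L X u (w m).
    rewrite /y /local_energy mulr_sumr; apply: eq_bigr => r0 _.
    by rewrite mulr_sumr; apply: eq_bigr => s _; rewrite mulrA.
  rewrite E1 E2 /tau; case: (posnP k) => [k0|kp].
    have -> : local_energy L X u (w m) = 0.
      apply/eqP; rewrite -normr_le0; apply: le_trans (local_energy_bound _ _ _ _) _.
      by move: l1X; rewrite k0 mul0n mul0r mulr0.
    by rewrite k0 !mulr0 !add0r mul1n mul1r.
  rewrite !natrM -!natr1; field.
  have kR : 0 < k%:R :> R by rewrite ltr0n.
  by do ?[apply/andP; split]; rewrite gt_eqF //; lra.
have yb m : `|y m| <= gh.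
  apply: le_trans (local_energy_bound _ _ _ _) _.
  have -> : l1norm L u (curp k X) = 2 / (k * k.+1)%:R * l1norm L u X.
    rewrite /l1norm mulr_sumr; apply: eq_bigr => r' _; rewrite mulr_sumr.
    by apply: eq_bigr => s _; rewrite normrM ger0_norm // divr_ge0.
  case: (posnP k) => [->|kp]; first by rewrite mul0n invr0 mulr0 mul0r ltW.
  have kk : 0 < (k * k.+1)%:R :> R by rewrite ltr0n muln_gt0 kp.
  rewrite mulrAC ler_pdivrMr //; move: l1X; rewrite mulrCA; lra.
pose lam1 r' : R := if [&& r' \in factor_sets p L, r' \in Rt & u \in r']
  then (\sum_s `|x r' s|) / gh else 0.
have lam10 r' : 0 <= lam1 r'.
  by rewrite /lam1; case: ifP => // _; apply: divr_ge0; [exact: sumr_ge0 | exact: ltW].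
have lam1s : \sum_r' lam1 r' <= 1.
  rewrite -(ler_pM2r gh0) mul1r; apply: le_trans l1x.
  rewrite mulr_suml /l1norm [leRHS]big_mkcond; apply: ler_sum => r' _; rewrite /lam1.
  case: (boolP (r' \in factor_sets p L)) => rF; rewrite ?mul0r //=.
  case: (boolP (u \in r')) => ur; rewrite ?andbF ?andbT ?mul0r //=.
  case: ifP => _; last by rewrite mul0r; apply: sumr_ge0.
  by rewrite divfK // gt_eqF.
(* The mass missing when the norm of [x] is below [gh] goes to the empty set, which stands for the
   zero atom. *)
pose lam r' : R := lam1 r' + (r' == finset.set0)%:R * (1 - \sum_r'' lam1 r'').
have lam0 r' : 0 <= lam r' by rewrite addr_ge0 // mulr_ge0 // subr_ge0.
have lams : \sum_r' lam r' = 1.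
  have e1 : \sum_r' (r' == finset.set0 :> {set 'I_p})%:R = 1 :> R.
    rewrite (bigD1 (finset.set0 : {set 'I_p})) //= eqxx big1 ?addr0 //.
    by move=> r' /negbTE ->.
  by rewrite big_split /= -mulr_suml e1 mul1r addrC subrK.
have lam1_0 : lam1 finset.set0 = 0 by rewrite /lam1 set0_notin.
(* Divided by its probability, a block of [x] has l1 norm [gh] and is covered by the net; a block of
   probability zero vanishes and takes the zero atom. *)
have pickN r' : exists N', adm (if lam1 r' == 0 then finset.set0 else r') N' /\
   forall m, `|lam1 r' * local_energy L (atomp (if lam1 r' == 0 then finset.set0 else r') N') u (w m) -
     local_energy L (blockp r' x) u (w m)| <= lam1 r' * (2 * ((Q ^ L) ^ 2)%:R / K%:R * gh).
  have [l0|ln] := eqVneq (lam1 r') 0.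
    exists 0%N; split; first by left.
    move=> m; rewrite l0 !mul0r sub0r normrN local_energy_block.
    case: ifP => [/andP[rF ur]|]; last by rewrite normr0.
    have x0 s : x r' s = 0.
      have [rR|rR] := boolP (r' \in Rt); last exact: Rx.
      move: l0; rewrite /lam1 rF rR ur /= => /eqP.
      rewrite mulf_eq0 invr_eq0 (gt_eqF gh0) orbF => /eqP/psumr_eq0P h.
      by apply/normr0_eq0/h.
    by rewrite big1 ?normr0 // => s _; rewrite x0 mul0r.
  have : [&& r' \in factor_sets p L, r' \in Rt & u \in r'].
    by move: ln; rewrite /lam1; case: ifP => //; rewrite eqxx.
  move=> /and3P[rF rR ur].
  have lE : lam1 r' * gh = \sum_s `|x r' s|.
    by rewrite /lam1 rF rR ur /= divfK // gt_eqF.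
  pose v s := (lam1 r')^-1 * x r' s.
  have cv : centered v by move=> i s; rewrite /v -mulr_sumr cx // mulr0.
  have vgh : \sum_s `|v s| <= gh.
    under eq_bigr do rewrite normrM (ger0_norm (x := (lam1 r')^-1)) ?invr_ge0 //.
    by rewrite -mulr_sumr -lE mulKf.
  have c0 : (0 < #|r'|)%N by move: rF; rewrite inE => /andP[].
  have cL : (Q ^ #|r'| <= Q ^ L)%N.
    have Q0 : (0 < Q)%N by apply: leq_trans (qpos u) _; apply: leq_bigmax.
    by rewrite leq_pexp2l //; move: rF; rewrite inE => /andP[].
  have [N' [Nlt Nl1 Nc]] := atom_cover qpos gh0 c0 cL QK K0 cv vgh.
  exists N'; split; first by right.
  move=> m; rewrite !local_energy_block rF ur /=.
  have -> : \sum_s x r' s * basis_fun R s (w m) = lam1 r' * \sum_s v s * basis_fun R s (w m).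
    by rewrite mulr_sumr; apply: eq_bigr => s _; rewrite /v !mulrA divff // mul1r.
  rewrite -mulrBr normrM ger0_norm // ler_wpM2l // -sumrB.
  apply: le_trans Nc; apply: (le_trans (ler_norm_sum _ _ _)); apply: ler_sum => s _.
  by rewrite -mulrBl normrM ler_piMr ?basis_norm_le1.
pose N' r' := projT1 (cid (pickN r')).
have N'P r' := projT2 (cid (pickN r')).
pose rr r' := if lam1 r' == 0 then finset.set0 else r'.
pose z m r' := if lam1 r' == 0 then 0 else local_energy L (atomp r' (N' r')) u (w m).
have zE m r' : z m r' = local_energy L (atomp (rr r') (N' r')) u (w m).
  rewrite /z /rr; case: ifP => // _.
  by rewrite /atomp local_energy_block set0_notin.
have zb m r' : `|z m r'| <= gh.
  rewrite zE; apply: le_trans (local_energy_bound _ _ _ _) _; apply: atomp_l1.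
  by have [] := N'P r'.
have xE m : local_energy L x u (w m) = \sum_r' local_energy L (blockp r' x) u (w m).
  rewrite {1}/local_energy big_mkcond /=; apply: eq_bigr => r' _.
  by rewrite local_energy_block.
have xb m : `|local_energy L x u (w m)| <= gh.
  exact: le_trans (local_energy_bound _ _ _ _) l1x.
have zx m : `|\sum_r' lam r' * z m r' - local_energy L x u (w m)| <=
    2 * ((Q ^ L) ^ 2)%:R / K%:R * gh.
  have -> : \sum_r' lam r' * z m r' = \sum_r' lam1 r' * z m r'.
    apply: eq_bigr => r' _; rewrite /lam; case: eqVneq => [->|_]; last by rewrite mul0r addr0.
    by rewrite /z lam1_0 eqxx !mulr0.
  rewrite xE -sumrB; apply: (le_trans (ler_norm_sum _ _ _)).
  apply: (@le_trans _ _ (\sum_r' lam1 r' * (2 * ((Q ^ L) ^ 2)%:R / K%:R * gh))).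
    by apply: ler_sum => r' _; rewrite zE; have [_ h] := N'P r'; exact: h.
  rewrite -mulr_suml -[X in _ <= X]mul1r ler_wpM2r // mulr_ge0 ?(ltW gh0) // divr_ge0 ?mulr_ge0 ?ler0n.
have main m : \sum_r' lam r' * expR (- ((1 - tau) * y m + tau * z m r')) <=
   (1 - tau) * expR (- y m) + tau * (expR (- local_energy L x u (w m)) + slack) + tau ^+ 2 * C.
  apply: le_trans (expR_jensen_taylor lam0 lams (zb m) (yb m) t0 t1) _.
  rewrite lerD2r lerD2l ler_wpM2l //.
  set zs := \sum_i _; set ex := local_energy _ _ _ _.
  have zsb : - zs <= gh.
    apply: le_trans (ler_norm _) _; rewrite normrN.
    apply: (le_trans (ler_norm_sum _ _ _)); rewrite -[X in _ <= X]mul1r -lams mulr_suml.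
    by apply: ler_sum => i _; rewrite normrM ger0_norm ?ler_wpM2l.
  have d : expR (- zs) * (1 + (zs - ex)) <= expR (- ex).
    have -> : expR (- ex) = expR (- zs) * expR (zs - ex) by rewrite -expRD; congr expR; ring.
    by apply: ler_wpM2l (expR_ge1Dx _); exact: expR_ge0.
  have d2 : expR (- zs) * (ex - zs) <= slack.
    apply: (@le_trans _ _ (expR (- zs) * `|zs - ex|)).
      by apply: ler_wpM2l; [exact: expR_ge0 | rewrite distrC ler_norm].
    rewrite /slack mulrC; apply: ler_pM.
    - exact: normr_ge0.
    - exact: expR_ge0.
    - exact: zx.
    - by rewrite ler_expR.
  by move: d d2; lra.
have wavg : S (curp k.+1 (nextp k X r N)) <=
    \sum_r' lam r' * S (curp k.+1 (nextp k X (rr r') (N' r'))).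
  rewrite -[X in X <= _]mul1r -lams mulr_suml; apply: ler_sum => r' _.
  by apply: ler_wpM2l => //; apply: best; have [] := N'P r'.
apply: le_trans wavg _.
have -> : \sum_r' lam r' * S (curp k.+1 (nextp k X (rr r') (N' r'))) =
   n%:R^-1 * \sum_(m < n) \sum_r' lam r' * expR (- ((1 - tau) * y m + tau * z m r')).
  rewrite exchange_big mulr_sumr; apply: eq_bigr => r' _.
  rewrite /screening_objective mulrCA; congr (_ * _); rewrite mulr_sumr.
  by apply: eq_bigr => m _; rewrite nextE zE.
rewrite -/tau; apply: (@le_trans _ _ (n%:R^-1 * \sum_(m < n)
   ((1 - tau) * expR (- y m) + tau * (expR (- local_energy L x u (w m)) + slack) + tau ^+ 2 * C))).
  by rewrite ler_wpM2l ?invr_ge0 //; apply: ler_sum => m _; exact: main.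
have lin (a b c d : R) (f g : 'I_n -> R) :
    \sum_(m < n) (a * f m + b * (g m + d) + c) =
    a * (\sum_(m < n) f m) + b * (\sum_(m < n) g m) + (b * d + c) * n%:R.
  have -> : (b * d + c) * n%:R = \sum_(m < n) (b * d + c).
    by rewrite sumr_const card_ord mulr_natr.
  by rewrite !mulr_sumr -!big_split; apply: eq_bigr => m _ /=; ring.
rewrite lin le_eqVlt; apply/orP; left; apply/eqP.
by rewrite /screening_objective -/y; field; rewrite gt_eqF.
Qed.

Lemma fw_step k X r N : fw_inv k X -> adm r N ->
  (forall r' N', adm r' N' -> S (curp k.+1 (nextp k X r N)) <= S (curp k.+1 (nextp k X r' N'))) ->
  fw_inv k.+1 (nextp k X r N).
Proof.
move=> inv ar best; have [cX l1X RX hX] := inv.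
split.
- move=> r' rF ur i s; rewrite big_split /= cX // add0r -mulr_sumr /atomp /blockp.
  case: eqVneq => _; last by rewrite big1 ?mulr0.
  by rewrite (atomv_centered _ _ _ i s) mulr0.
- have := @l1norm_lin 1 k.+1%:R X (atomp r N) ler01 (ler0n _ _).
  have -> : (fun (r0 : {set 'I_p}) (s : letters qs r0) => 1 * X r0 s + k.+1%:R * atomp r N r0 s)
     = nextp k X r N.
    by apply: functional_extensionality_dep => r0; apply: funext => s; rewrite mul1r.
  move=> h; apply: le_trans h _; rewrite mul1r.
  have h2 : k.+1%:R * l1norm L u (atomp r N) <= k.+1%:R * gh.
    by apply: ler_wpM2l => //; exact: atomp_l1.
  apply: le_trans (lerD l1X h2) _; rewrite le_eqVlt; apply/orP; left; apply/eqP.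
  by rewrite !natrM -!natr1; field.
- move=> r' rF ur rR s; rewrite /nextp RX // add0r /atomp /blockp.
  case: eqVneq => [e|]; last by rewrite mulr0.
  case: ar => [[r0 _]|[_ rR' _ _ _]]; last by rewrite e rR' in rR.
  by rewrite e r0 set0_notin in rF.
- move=> x fx; have h := hX x fx; have st := objective_step inv ar fx best.
  have C0 : 0 <= C by rewrite /C mulr_ge0 ?expR_ge0 // mulr_ge0 ?sqr_ge0.
  have k2 : 0 < k.+2%:R :> R by rewrite ltr0n.
  have kk0 : 0 <= (k.+1 * k.+2)%:R :> R by rewrite ler0n.
  set a := S (curp k.+1 _) in st *.
  apply: (@le_trans _ _ ((k.+1 * k.+2)%:R * (((1 - 2 / k.+2%:R) * S (curp k X) +
      2 / k.+2%:R * (S x + slack) + (2 / k.+2%:R) ^+ 2 * C) - S x - slack))).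
    by rewrite ler_wpM2l // !lerD2r.
  have -> : (k.+1 * k.+2)%:R * (((1 - 2 / k.+2%:R) * S (curp k X) +
      2 / k.+2%:R * (S x + slack) + (2 / k.+2%:R) ^+ 2 * C) - S x - slack) =
     (k * k.+1)%:R * (S (curp k X) - S x - slack) + 4 * C * (k.+1%:R / k.+2%:R).
    rewrite !natrM -!natr1; field.
    have kR : 0 <= k%:R :> R by rewrite ler0n.
    by do ?[apply/andP; split]; rewrite gt_eqF //; lra.
  apply: le_trans (lerD h (_ : _ <= 4 * C)) _; last by rewrite -(natr1 k) mulrDr mulr1.
  rewrite -[X in _ <= X]mulr1; apply: ler_wpM2l; first by rewrite mulr_ge0.
  by rewrite ler_pdivrMr // mul1r ler_nat.
Qed.

(** The gap left by the recursion is [4 * C / (K + 1)] and [slack] is a constant over [K]; hence the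
    linear condition on [K * eps]. *)
Lemma fw_final X eps : fw_inv K X ->
  16 * gh ^+ 2 * expR (3 * gh) + 2 * gh * expR gh * ((Q ^ L) ^ 2)%:R <= K%:R * eps ->
  eps_minimizer L w gh eps Rt u (curp K X).
Proof.
move=> [cX l1X RX hX] epsb.
have KR0 : 0 < K%:R :> R by rewrite ltr0n.
have kk : 0 < (K * K.+1)%:R :> R by rewrite ltr0n muln_gt0 K0.
split; first split.
- by move=> r rF ur i s; rewrite -mulr_sumr cX // mulr0.
- have -> : l1norm L u (curp K X) = 2 / (K * K.+1)%:R * l1norm L u X.
    rewrite /l1norm mulr_sumr; apply: eq_bigr => r' _; rewrite mulr_sumr.
    by apply: eq_bigr => s _; rewrite normrM ger0_norm // divr_ge0.
  by rewrite mulrAC ler_pdivrMr //; move: l1X; rewrite mulrCA; lra.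
- by move=> r rF ur rR s; rewrite /curp RX // mulr0.
move=> x fx; have := hX x fx; rewrite mulrC -ler_pdivlMr // => h.
rewrite -lerBlDl; rewrite lerBlDr in h; apply: le_trans h _.
have C0 : 0 <= C by rewrite /C mulr_ge0 ?expR_ge0 // mulr_ge0 ?sqr_ge0.
rewrite -(ler_pM2l KR0); apply: le_trans epsb.
have -> : K%:R * (4 * C * K%:R / (K * K.+1)%:R + slack) =
   4 * C * (K%:R / K.+1%:R) + 2 * gh * expR gh * ((Q ^ L) ^ 2)%:R.
  rewrite /slack natrM -natr1; field.
  by do ?[apply/andP; split]; rewrite gt_eqF //; lra.
rewrite lerD2r; apply: (@le_trans _ _ (4 * C * 1)).
  apply: ler_wpM2l; first by rewrite mulr_ge0.
  by rewrite ler_pdivrMr ?ltr0n // mul1r ler_nat.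
by rewrite le_eqVlt; apply/orP; left; apply/eqP; rewrite /C; ring.
Qed.

End FrankWolfe.

Local Open Scope nat_scope.

(** * Execution with costs *)

(** The written arrays are read off the syntax, so that the preservation of any other array is
    settled by evaluation, with [isT] as its proof. *)
Fixpoint nwr (c : cmd) : seq nat :=
  match c with
  | CSetN a _ _ => [:: a]
  | CSeq c1 c2 | CIf _ c1 c2 => nwr c1 ++ nwr c2
  | CWhile _ c => nwr c
  | _ => [::]
  end.

Fixpoint rwr (c : cmd) : seq nat :=
  match c with
  | CSetR a _ _ => [:: a]
  | CSeq c1 c2 | CIf _ c1 c2 => rwr c1 ++ rwr c2
  | CWhile _ c => rwr c
  | _ => [::]
  end.

Definition CFor (i : nat) (b : nexp) (c : cmd) : cmd :=
  CSeq (CSetN i (NConst 0) (NConst 0))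
    (CWhile (NLess (NGet i (NConst 0)) b)
      (CSeq c (CSetN i (NConst 0) (NAdd (NGet i (NConst 0)) (NConst 1))))).

Section WP.
Variable R : realType.
Implicit Types (st : store R) (c : cmd) (Q : store R -> Prop).

Definition setN st a i v : store R := Store (upd (narr st) a i v) (rarr st).
Definition setR st a i v : store R := Store (narr st) (upd (rarr st) a i v).

Definition frame c st st' : Prop :=
  (forall a, a \notin nwr c -> narr st' a = narr st a) /\
  (forall a, a \notin rwr c -> rarr st' a = rarr st a).

Lemma upd_other T (f : nat -> nat -> T) a i v b : b != a -> upd f a i v b = f b.
Proof. by move=> /negbTE ba; apply: funext => j; rewrite /upd ba. Qed.

Lemma frame_refl c st : frame c st st. Proof. by []. Qed.

Lemma frame_trans c st st1 st2 : frame c st st1 -> frame c st1 st2 -> frame c st st2.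
Proof.
move=> [n1 r1] [n2 r2].
by split=> a h; [rewrite n2 // n1 | rewrite r2 // r1].
Qed.

Lemma frame_setN a i v c st : a \in nwr c -> frame c st (setN st a i v).
Proof.
move=> h; split=> // b hb; apply: upd_other; by apply: contraNneq hb => ->.
Qed.

Lemma exec_frame c st st' k : exec c st st' k -> frame c st st'.
Proof.
elim=> {c st st' k} //=.
- move=> a i e st; apply: frame_setN; exact: mem_head.
- move=> a i e st; split=> // b /= hb; apply: upd_other.
  by rewrite inE in hb.
- move=> c1 c2 st st1 st2 k1 k2 _ [n1 r1] _ [n2 r2]; split=> a;
    rewrite mem_cat negb_or => /andP[h1 h2].
    by rewrite n2 // n1.
  by rewrite r2 // r1.
- move=> b c1 c2 st st' k _ _ [n1 r1]; split=> a;
    rewrite mem_cat negb_or => /andP[h1 h2]; [exact: n1 | exact: r1].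
- move=> b c1 c2 st st' k _ _ [n1 r1]; split=> a;
    rewrite mem_cat negb_or => /andP[h1 h2]; [exact: n1 | exact: r1].
- move=> b c st st1 st2 k1 k2 _ _ f1 _ f2; exact: frame_trans f1 f2.
Qed.

(* Total correctness: the cost bound [k] includes termination. *)
Definition wp c k Q st : Prop := exists st' k', [/\ exec c st st' k', k' <= k & Q st'].

Lemma wp_conseq c k k' (P Q : store R -> Prop) st : wp c k P st -> k <= k' ->
  (forall st', frame c st st' -> P st' -> Q st') -> wp c k' Q st.
Proof.
move=> [st' [k0 [ex le Pst]]] kk PQ; exists st', k0; split=> //.
  exact: leq_trans le kk.
by apply: PQ Pst; exact: exec_frame ex.
Qed.

Lemma wp_skip k Q st : 0 < k -> Q st -> wp CSkip k Q st.
Proof. by move=> k0 h; exists st, 1; split=> //; exact: ExecSkip. Qed.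

Lemma wp_setN k Q a i e st : ncost i + ncost e < k ->
  Q (setN st a (neval st i) (neval st e)) -> wp (CSetN a i e) k Q st.
Proof. by move=> lt h; eexists; eexists; split; [exact: ExecSetN| |]. Qed.

Lemma wp_setR k Q a i e st : ncost i + rcost e < k ->
  Q (setR st a (neval st i) (reval st e)) -> wp (CSetR a i e) k Q st.
Proof. by move=> lt h; eexists; eexists; split; [exact: ExecSetR| |]. Qed.

Lemma wp_seq k1 k2 Q c1 c2 st :
  wp c1 k1 (fun st1 => frame c1 st st1 -> wp c2 k2 Q st1) st ->
  wp (CSeq c1 c2) (k1 + k2) Q st.
Proof.
move=> [st1 [k1' [ex1 le1 h]]].
have [st2 [k2' [ex2 le2 hQ]]] := h (exec_frame ex1).
by exists st2, (k1' + k2'); split => //; [exact: ExecSeq ex1 ex2 | exact: leq_add].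
Qed.

Lemma wp_if k Q b c1 c2 st : tcost b <= 99 ->
  (teval st b -> wp c1 k Q st) -> (~~ teval st b -> wp c2 k Q st) ->
  wp (CIf b c1 c2) (100 + k) Q st.
Proof.
move=> tb h1 h2; have [t|t] := boolP (teval st b).
  have [st' [k' [ex le hQ]]] := h1 t; exists st', (tcost b + k').+1.
  by split => //; [exact: ExecIfTrue | rewrite -addSn leq_add].
have [st' [k' [ex le hQ]]] := h2 t; exists st', (tcost b + k').+1.
by split => //; [exact: ExecIfFalse | rewrite -addSn leq_add].
Qed.

(** Overhead of a pass: 43 for the test when the bound costs at most 40, 6 for the increment, 1 for
    the loop. The last 50 covers the initialization and the failing test. *)
Definition cfor (N k : nat) : nat := N * (k + 50) + 50.

Lemma leq_cfor N N' k k' : N <= N' -> k <= k' -> cfor N k <= cfor N' k'.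
Proof. by move=> h1 h2; rewrite leq_add2r leq_mul // leq_add2r. Qed.

(** The body does not write the counter, so the invariant for [j + 1] is asked of the store whose
    counter has just been advanced. The bound is evaluated anew before each pass; its hypothesis
    therefore covers all stores that the loop can reach. *)
Lemma wp_for (i : nat) (b : nexp) (c : cmd) (N k : nat) (Inv : nat -> store R -> Prop) st :
  i \notin nwr c -> ncost b <= 40 ->
  (forall st', frame (CFor i b c) st st' -> neval st' b = N) ->
  Inv 0 (setN st i 0 0) ->
  (forall j st', j < N -> frame (CFor i b c) st st' -> narr st' i 0 = j -> Inv j st' ->
     wp c k (fun st'' => Inv j.+1 (setN st'' i 0 j.+1)) st') ->
  wp (CFor i b c) (cfor N k) (Inv N) st.
Proof.
move=> ic cb bN I0 step; set F := frame (CFor i b c) st.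
have iF : i \in nwr (CFor i b c) by rewrite /= mem_head.
have loop m j st' : N - j = m -> j <= N -> F st' -> narr st' i 0 = j -> Inv j st' ->
    wp (CWhile (NLess (NGet i (NConst 0)) b)
      (CSeq c (CSetN i (NConst 0) (NAdd (NGet i (NConst 0)) (NConst 1)))))
      (m * (k + 50) + 44) (Inv N) st'.
  elim: m j st' => [|m IH] j st' mE jN Fst ij Ij.
    have jNE : j = N by apply/eqP; rewrite eqn_leq jN -subn_eq0 mE.
    exists st', (3 + ncost b).+1; split; last by rewrite -jNE.
      by apply: ExecWhileFalse; rewrite /= ij bN // jNE ltnn.
    by rewrite add0n ltnS (leq_add2l 3 _ 40).
  have jlt : j < N by rewrite -subn_gt0 mE.
  have [st1 [k1 [ex1 le1 h1]]] := step j st' jlt Fst ij Ij.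
  have f1 := exec_frame ex1.
  have i1 : narr st1 i 0 = j by rewrite (f1.1 i ic).
  set st2 := setN st1 i 0 j.+1.
  have F2 : F st2.
    apply: frame_trans Fst (frame_trans _ (frame_setN _ _ _ iF)).
    split=> a h; [apply: f1.1 | apply: f1.2]; apply: contra h => h /=.
      by rewrite inE !mem_cat h orbT.
    by rewrite !mem_cat h.
  have m1 : N - j.+1 = m by rewrite subnS mE.
  have ij2 : narr st2 i 0 = j.+1 by rewrite /= /upd !eqxx.
  have [st3 [k3 [ex3 le3 h3]]] := IH j.+1 st2 m1 jlt F2 ij2 h1.
  have ex2 : exec (CSetN i (NConst 0) (NAdd (NGet i (NConst 0)) (NConst 1))) st1 st2 6.
    have := ExecSetN i (NConst 0) (NAdd (NGet i (NConst 0)) (NConst 1)) st1.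
    by rewrite /= i1 addn1.
  exists st3, ((3 + ncost b) + (k1 + 6) + k3).+1; split=> //.
    apply: ExecWhileTrue (ExecSeq ex1 ex2) ex3.
    by rewrite /= ij bN.
  rewrite mulSn; move: (m * (k + 50)) le3 le1 cb => x; clear; lia.
have I0' : narr (setN st i 0 0) i 0 = 0 by rewrite /= /upd !eqxx.
have [st' [k' [ex le h]]] := loop N 0 _ (subn0 N) (leq0n N) (frame_setN 0 0 st iF) I0' I0.
exists st', (3 + k'); split=> //; last first.
  by rewrite /cfor -[50]/(6 + 44) addnCA leq_add.
exact: ExecSeq (ExecSetN i (NConst 0) (NConst 0) st) ex.
Qed.

End WP.

(** * The program *)

Notation nvar a := (NGet a (NConst 0)).
Notation rvar a := (RGet a (NConst 0)).
Notation "e1 <+> e2" := (NAdd e1 e2) (at level 50, left associativity).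
Notation "e1 <*> e2" := (NMul e1 e2) (at level 40, left associativity).
Notation "c1 ;;; c2" := (CSeq c1 c2) (at level 80, right associativity).
Notation sP := (NGet 0 (NConst 0)).
Notation sL := (NGet 0 (NConst 1)).
Notation sN := (NGet 0 (NConst 2)).
Notation sP1 := (NAdd (NGet 0 (NConst 0)) (NConst 1)).
Notation sQ := (nvar 5).
Notation sB := (NAdd (NMul (NConst 2) (nvar 10)) (NConst 1)).
Notation set0N a e := (CSetN a (NConst 0) e).
Notation set0R a e := (CSetR a (NConst 0) e).

Definition e_dig (c j : nexp) : nexp := NMod (NDiv c (NGet 6 j)) sP1.
Definition e_let (e j : nexp) : nexp := NMod (NDiv e (NGet 7 j)) sQ.
Definition e_vert (c j : nexp) : nexp := NSub (e_dig c j) (NConst 1).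
Definition e_len : nexp := NGet 9 (nvar 22).
Definition e_lets : nexp := NGet 7 e_len.

(* The two truncated differences test whether the letters are below the size of
   the alphabet, and 1 - (|a - b|) tests whether they are equal. *)
Definition e_kern_factor : rexp :=
  let a := e_let (nvar 26) (nvar 23) in
  let b := e_let (nvar 27) (nvar 23) in
  let q := NGet 1 (e_vert (nvar 22) (nvar 23)) in
  RMul (RMul (ROfNat (NSub (NConst 1) (NSub (NAdd a (NConst 1)) q)))
             (ROfNat (NSub (NConst 1) (NSub (NAdd b (NConst 1)) q))))
       (RSub (ROfNat (NSub (NConst 1) (NAdd (NSub a b) (NSub b a))))
             (RDiv (ROfNat (NConst 1)) (ROfNat q))).

Definition KER : cmd :=
  set0R 5 (ROfNat (NConst 1)) ;;;
  CFor 23 e_len (set0R 5 (RMul (rvar 5) e_kern_factor)).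

Definition ATOM : cmd :=
  CFor 26 e_lets
   (set0R 6 (ROfNat (NConst 0)) ;;;
    CFor 27 e_lets
      (KER ;;;
       set0R 6 (RAdd (rvar 6)
         (RMul (ROfNat (NMod (NDiv (nvar 25) (NGet 11 (nvar 27))) sB)) (rvar 5)))) ;;;
    CSetR 4 (nvar 26) (RMul (rvar 8) (rvar 6))).

Definition NORM : cmd :=
  set0R 7 (ROfNat (NConst 0)) ;;;
  CFor 26 e_lets
    (CIf (RLess (RGet 4 (nvar 26)) (ROfNat (NConst 0)))
      (set0R 7 (RSub (rvar 7) (RGet 4 (nvar 26))))
      (set0R 7 (RAdd (rvar 7) (RGet 4 (nvar 26))))).

Definition LOOK : cmd :=
  set0N 29 (NConst 0) ;;;
  CFor 23 e_len
    (set0N 29 (NAdd (nvar 29)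
       (NMul (NGet 2 (NAdd (NMul (nvar 28) sP) (e_vert (nvar 22) (nvar 23))))
             (NGet 7 (nvar 23))))).

Definition FCODE : cmd :=
  set0N 29 (NConst 0) ;;;
  set0N 30 (NConst 1) ;;;
  CFor 23 e_len
    (set0N 29 (NAdd (nvar 29)
       (NMul (NAdd (e_dig (nvar 22) (nvar 23))
                   (NMul sP1 (e_let (nvar 26) (nvar 23)))) (nvar 30))) ;;;
     set0N 30 (NMul (nvar 30) (NMul sP1 sQ))).

(* [2 / ((k + 1) (k + 2))], where [k] is the step of the Frank-Wolfe loop. *)
Definition e_weight : rexp :=
  RDiv (ROfNat (NConst 2))
    (ROfNat (NMul (NAdd (nvar 21) (NConst 1)) (NAdd (nvar 21) (NConst 2)))).

Definition e_G : nexp := NAdd (NMul (nvar 24) sN) (nvar 28).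

Definition VAL : cmd :=
  set0R 9 (ROfNat (NConst 0)) ;;;
  CFor 28 sN
    (LOOK ;;;
     set0R 9 (RAdd (rvar 9)
       (RExp (RSub (ROfNat (NConst 0))
         (RMul e_weight
           (RAdd (RGet 2 e_G)
             (RMul (ROfNat (NAdd (nvar 21) (NConst 1))) (RGet 4 (nvar 29))))))))).

(** * Correctness of the elementary blocks *)

Section Blocks.
Variables (R : realType) (p : nat) (qs : 'I_p -> nat) (L n K : nat).
Variables (w : {ffun 'I_n -> config qs}) (alpha gh eps : R).
Local Notation Q := (\max_(j < p) qs j).
Local Notation store := (store R).
Implicit Types (st : store) (r : {set 'I_p}).

(* Natural arrays: 9 holds the cardinalities, indexed by set codes; 10 the number
   K of greedy steps; 12 marks the sets that are not maximal; 13 and 14 hold the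
   best atom found so far for each vertex, as set code and coefficient code; from
   20 on, the loop variables: 20 the round, 21 the greedy step, 22 the set code,
   24 the vertex, 25 the coefficient code, 26 and 27 letter codes, 28 the sample,
   31 a position in the set.
   Real arrays: 1 holds the estimates, 2 the scaled energies of the samples, 3 the
   best objective values, 4 the current atom; 5 to 9 are scratch. *)
Record consts st : Prop := Consts {
  c_p : narr st 0 0 = p;
  c_L : narr st 0 1 = L;
  c_n : narr st 0 2 = n;
  c_q : forall x, narr st 1 x = qn qs x;
  c_w : forall (m : 'I_n) (i : 'I_p), narr st 2 (m * p + i) = w m i;
  c_Q : narr st 5 0 = Q;
  c_W : forall j, j <= L -> narr st 6 j = p.+1 ^ j;
  c_QW : forall j, j <= L -> narr st 7 j = Q ^ j;
  c_len : forall r, #|r| <= L -> narr st 9 (set_code r) = #|r|;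
  c_K : narr st 10 0 = K;
  c_BW : forall e, e <= Q ^ L -> narr st 11 e = (2 * K).+1 ^ e;
  c_alpha : rarr st 0 0 = alpha;
  c_gh : rarr st 0 1 = gh;
  c_step : rarr st 8 0 = (gh / K%:R)%R }.

Definition nids := [:: 0; 1; 2; 5; 6; 7; 9; 10; 11].
Definition rids := [:: 0; 8].

Lemma consts_frame c st st' : frame c st st' ->
  all [predC nwr c] nids -> all [predC rwr c] rids -> consts st -> consts st'.
Proof.
move=> [fn fr] /allP hn /allP hr.
have en a : a \in nids -> narr st' a = narr st a by move=> /hn h; apply: fn.
have er a : a \in rids -> rarr st' a = rarr st a by move=> /hr h; apply: fr.
by case=> *; split=> *; rewrite ?en ?er //; auto.
Qed.

Definition kf (q a b : nat) : R :=
  ((1 - (a.+1 - q))%:R * (1 - (b.+1 - q))%:R * ((1 - ((a - b) + (b - a)))%:R - 1 / q%:R))%R.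

Definition kerc r e e' : R :=
  (\prod_(j < #|r|) kf (qn qs (nth 0 (verts r) j)) (digit Q e j) (digit Q e' j))%R.

Definition cKER := 10 + cfor L 150.

Lemma wp_KER st r e e' : consts st -> #|r| <= L ->
  narr st 22 0 = set_code r -> narr st 26 0 = e -> narr st 27 0 = e' ->
  wp KER cKER (fun st' => rarr st' 5 0 = kerc r e e') st.
Proof.
move=> C rL hc he he'; apply: wp_seq; apply: wp_setR => // f1.
have C1 := consts_frame f1 isT isT C.
apply: (wp_conseq (k := cfor #|r| 150)
  (P := fun st' => rarr st' 5 0 =
    (\prod_(j < #|r|) kf (qn qs (nth 0 (verts r) j)) (digit Q e j) (digit Q e' j))%R)).
- apply: (@wp_for _ _ _ _ #|r| 150 (fun J st' => rarr st' 5 0 =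
    (\prod_(j < J) kf (qn qs (nth 0 (verts r) j)) (digit Q e j) (digit Q e' j))%R)) => //.
  + by move=> st' fr; rewrite /= (fr.1 9 isT) (fr.1 22 isT) /= hc c_len.
  + by rewrite big_ord0.
  + move=> j st' jr fr hj IH; apply: wp_setR => //.
    have C' := consts_frame fr isT isT C1.
    have jL : j <= L by apply: leq_trans (ltnW jr) rL.
    rewrite /= /upd /= big_ord_recr /= IH; congr (_ * _)%R.
    rewrite hj (fr.1 22 isT) (fr.1 26 isT) (fr.1 27 isT) /= hc he he'.
    rewrite (c_p C') (c_W C') // (c_QW C') // (c_Q C') (c_q C') !addn1.
    have := set_code_digit r j; rewrite jr /digit => ->.
    by rewrite subn1.
- by rewrite leq_cfor.
- by [].
Qed.

Definition AT (r : {set 'I_p}) N e : R :=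
  (gh / K%:R * \sum_(e' < Q ^ #|r|) (digit (2 * K).+1 N e')%:R * kerc r e e')%R.

Hypothesis Q0 : 0 < Q.
Local Notation QL := (Q ^ L).

Lemma letters_bound r : #|r| <= L -> Q ^ #|r| <= QL.
Proof. by move=> h; rewrite leq_pexp2l. Qed.

Lemma e_lets_val st r : consts st -> #|r| <= L -> narr st 22 0 = set_code r ->
  neval st e_lets = Q ^ #|r|.
Proof. by move=> C rL hc; rewrite /= hc (c_len C) // (c_QW C). Qed.

Lemma e_len_val st r : consts st -> #|r| <= L -> narr st 22 0 = set_code r ->
  neval st e_len = #|r|.
Proof. by move=> C rL hc; rewrite /= hc (c_len C). Qed.

Definition cATOM := cfor QL (10 + (cfor QL (cKER + 50) + 20)).

Lemma wp_ATOM st r N : consts st -> #|r| <= L ->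
  narr st 22 0 = set_code r -> narr st 25 0 = N ->
  wp ATOM cATOM (fun st' => forall e, e < Q ^ #|r| -> rarr st' 4 e = AT r N e) st.
Proof.
move=> C rL hc hN.
apply: (wp_conseq (k := cfor (Q ^ #|r|) (10 + (cfor QL (cKER + 50) + 20)))
  (P := fun st' => forall e, e < Q ^ #|r| -> rarr st' 4 e = AT r N e)) => //; last first.
  by rewrite leq_cfor ?letters_bound.
apply: (@wp_for _ _ _ _ (Q ^ #|r|) _ (fun J st' => forall e, e < J -> rarr st' 4 e = AT r N e)) => //.
  move=> st' fr; apply: e_lets_val => //; first exact: consts_frame fr isT isT C.
  by rewrite (fr.1 22 isT).
move=> e st1 eQ fr1 he IH; have C1 := consts_frame fr1 isT isT C.
have hc1 : narr st1 22 0 = set_code r by rewrite (fr1.1 22 isT).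
have hN1 : narr st1 25 0 = N by rewrite (fr1.1 25 isT).
apply: wp_seq; apply: wp_setR => // f2; set st2 := setR _ _ _ _ in f2 *.
have C2 := consts_frame f2 isT isT C1.
apply: wp_seq; apply: (wp_conseq (k := cfor (Q ^ #|r|) (cKER + 50)) (P := fun st' => rarr st' 6 0 =
    (\sum_(e' < Q ^ #|r|) (digit (2 * K).+1 N e')%:R * kerc r e e')%R)).
- apply: (@wp_for _ _ _ _ (Q ^ #|r|) _ (fun J st' => rarr st' 6 0 =
    (\sum_(e' < J) (digit (2 * K).+1 N e')%:R * kerc r e e')%R)) => //.
  + move=> st' fr; apply: e_lets_val => //; first exact: consts_frame fr isT isT C2.
    by rewrite (fr.1 22 isT).
  + by rewrite big_ord0.
  move=> e' st3 eQ' fr3 he' IH3; have C3 := consts_frame fr3 isT isT C2.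
  apply: wp_seq; apply: (wp_conseq (wp_KER (e := e) C3 rL _ _ he')) => //.
  + by rewrite (fr3.1 22 isT).
  + by rewrite (fr3.1 26 isT); exact: he.
  move=> st4 f4 h4 _; have C4 := consts_frame f4 isT isT C3; apply: wp_setR => //.
  rewrite /= /upd /= big_ord_recr /= -IH3 (f4.2 6 isT) h4; congr (_ + _ * _)%R.
  rewrite (f4.1 27 isT) he' (f4.1 25 isT) (fr3.1 25 isT) /= hN1 (c_BW C4); last first.
    by apply: leq_trans (ltnW eQ') _; exact: letters_bound.
  by rewrite (c_K C4) addn1.
- by rewrite leq_cfor ?letters_bound.
move=> st3 f3 h3 _; have C3 := consts_frame f3 isT isT C2.
apply: wp_setR => // e0; rewrite ltnS leq_eqVlt /= /upd /= (f3.1 26 isT) /= he.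
case: eqP => [-> _|_ /= lt]; last by rewrite (f3.2 4 isT) /=; apply: IH.
by rewrite h3 (c_step C3).
Qed.

Definition cNORM := 10 + cfor QL (100 + 20).

Lemma wp_NORM st r : consts st -> #|r| <= L -> narr st 22 0 = set_code r ->
  wp NORM cNORM (fun st' => rarr st' 7 0 = (\sum_(e < Q ^ #|r|) `|rarr st 4 e|)%R) st.
Proof.
move=> C rL hc; apply: wp_seq; apply: wp_setR => // f1.
have C1 := consts_frame f1 isT isT C.
apply: (wp_conseq (k := cfor (Q ^ #|r|) (100 + 20)) (P := fun st' => rarr st' 7 0 =
   (\sum_(e < Q ^ #|r|) `|rarr st 4 e|)%R)) => //; last by rewrite leq_cfor ?letters_bound.
apply: (@wp_for _ _ _ _ (Q ^ #|r|) _ (fun J st' => rarr st' 7 0 =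
   (\sum_(e < J) `|rarr st 4 e|)%R)) => //.
- move=> st' fr; apply: e_lets_val => //; first exact: consts_frame fr isT isT C1.
  by rewrite (fr.1 22 isT).
- by rewrite big_ord0.
move=> e st2 eQ f2 he IH.
apply: wp_if => //= t; apply: wp_setR => //; rewrite /= /upd /= big_ord_recr /= IH.
  move: t; rewrite he (f2.2 4 isT) /= => t.
  by rewrite ltr0_norm.
move: t; rewrite he (f2.2 4 isT) /= -leNgt => t.
by rewrite ger0_norm.
Qed.

Definition lookc r (m : 'I_n) : nat := lcode (restr (w m) r).

Definition cLOOK := 10 + cfor L 100.

Lemma wp_LOOK st r (m : 'I_n) : consts st -> #|r| <= L -> narr st 22 0 = set_code r ->
  narr st 28 0 = m -> wp LOOK cLOOK (fun st' => narr st' 29 0 = lookc r m) st.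
Proof.
move=> C rL hc hm; apply: wp_seq; apply: wp_setN => // f1.
have C1 := consts_frame f1 isT isT C.
apply: (wp_conseq (k := cfor #|r| 100) (P := fun st' => narr st' 29 0 = lookc r m)) => //;
  last by rewrite leq_cfor.
apply: (@wp_for _ _ _ _ #|r| _ (fun J st' => narr st' 29 0 =
   of_digits Q J (nth 0 (lseq (restr (w m) r))))) => //.
- move=> st' fr; apply: e_len_val => //; first exact: consts_frame fr isT isT C1.
  by rewrite (fr.1 22 isT).
- by rewrite /of_digits big_ord0.
move=> j st2 jr f2 hj IH; have C2 := consts_frame f2 isT isT C1; apply: wp_setN => //.
have jL : j <= L by apply: leq_trans (ltnW jr) rL.
rewrite /= /upd /= /of_digits big_ord_recr /= IH; congr (_ + _).
rewrite hj (f2.1 28 isT) (f2.1 22 isT) (f1.1 28 isT) (f1.1 22 isT) hm hc (c_p C2) (c_W C2) // (c_QW C2) // !addn1.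
have := set_code_digit r j; rewrite jr /digit => ->; rewrite subn1 /=; congr (_ * _).
have [i [-> ->]] := nth_pos qs (Ordinal jr).
by rewrite (c_w C2) ffunE.
Qed.

Definition cFCODE := 10 + (10 + cfor L (80 + 30)).

Lemma wp_FCODE st r e : consts st -> #|r| <= L -> narr st 22 0 = set_code r ->
  narr st 26 0 = e ->
  wp FCODE cFCODE (fun st' => narr st' 29 0 = fcode qs #|r| (set_code r) e) st.
Proof.
move=> C rL hc he; apply: wp_seq; apply: wp_setN => // f1.
have C1 := consts_frame f1 isT isT C.
apply: wp_seq; apply: wp_setN => // f2; have C2 := consts_frame f2 isT isT C1.
pose F J := of_digits (p.+1 * Q) J (fun j => digit p.+1 (set_code r) j + p.+1 * digit Q e j).
apply: (wp_conseq (k := cfor #|r| (80 + 30)) (P := fun st' =>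
  narr st' 29 0 = F #|r| /\ narr st' 30 0 = (p.+1 * Q) ^ #|r|)) => //; last first.
- by move=> st' _ [].
- by rewrite leq_cfor.
apply: (@wp_for _ _ _ _ #|r| _ (fun J st' =>
  narr st' 29 0 = F J /\ narr st' 30 0 = (p.+1 * Q) ^ J)) => //.
- move=> st' fr; apply: e_len_val => //; first exact: consts_frame fr isT isT C2.
  by rewrite (fr.1 22 isT).
- by rewrite /F /of_digits big_ord0.
move=> j st3 jr f3 hj [IH1 IH2]; have C3 := consts_frame f3 isT isT C2.
have jL : j <= L by apply: leq_trans (ltnW jr) rL.
apply: wp_seq; apply: wp_setN => // f4; apply: wp_setN => //.
rewrite /= /upd /= /F /of_digits big_ord_recr /= IH1 IH2 hj.
rewrite (f3.1 22 isT) (f3.1 26 isT) (f2.1 22 isT) (f2.1 26 isT) (f1.1 22 isT) (f1.1 26 isT) hc he (c_p C3) (c_W C3) // (c_QW C3) // (c_Q C3) !addn1.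
by rewrite expnSr.
Qed.

Definition VALf (k u : nat) (G : nat -> R) r (d : nat -> R) : R :=
  (\sum_(m < n) expR (- (2 / (k.+1 * k.+2)%:R *
     (G (u * n + m)%N + k.+1%:R * d (lookc r m)))))%R.

Definition cVAL := 10 + cfor n (cLOOK + 100).

Lemma wp_VAL st r k u : consts st -> #|r| <= L -> narr st 22 0 = set_code r ->
  narr st 21 0 = k -> narr st 24 0 = u ->
  wp VAL cVAL (fun st' => rarr st' 9 0 = VALf k u (rarr st 2) r (rarr st 4)) st.
Proof.
move=> C rL hc hk hu; apply: wp_seq; apply: wp_setR => // f1.
have C1 := consts_frame f1 isT isT C.
pose T (m : nat) : R := if insub m is Some m' then
  expR (- (2 / (k.+1 * k.+2)%:R *
     (rarr st 2 (u * n + m)%N + k.+1%:R * rarr st 4 (lookc r m'))))%R else 0%R.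
apply: (wp_conseq (k := cfor n (cLOOK + 100)) (P := fun st' =>
  rarr st' 9 0 = (\sum_(m < n) T m)%R)) => //; last first.
  by move=> st' _ ->; apply: eq_bigr => m _; rewrite /T valK.
apply: (@wp_for _ _ _ _ n _ (fun J st' => rarr st' 9 0 = (\sum_(m < J) T m)%R)) => //.
- by move=> st' fr; rewrite /= (c_n (consts_frame fr isT isT C1)).
- by rewrite big_ord0.
move=> m st2 mn f2 hm IH; have C2 := consts_frame f2 isT isT C1.
apply: wp_seq; apply: (wp_conseq (wp_LOOK (m := Ordinal mn) C2 rL _ hm)) => //.
  by rewrite (f2.1 22 isT).
move=> st3 f3 h3 _; have C3 := consts_frame f3 isT isT C2; apply: wp_setR => //.
rewrite /= /upd /= big_ord_recr /= (f3.2 9 isT) IH; congr (_ + _)%R.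
rewrite /T insubT sub0r h3 (f3.1 21 isT) (f3.1 24 isT) (f3.1 28 isT) (f3.2 2 isT) (f3.2 4 isT).
rewrite (f2.1 21 isT) (f2.1 24 isT) (f2.2 2 isT) (f2.2 4 isT) /= hk hu hm (c_n C3).
by rewrite !addn1 !addn2.
Qed.

End Blocks.

Definition e_fam : nexp := NAdd (NMul (nvar 22) (NAdd sL (NConst 1))) (nvar 20).
Definition e_member : test := NLess (NConst 0) (NGet 4 e_fam).

Definition TRY : cmd :=
  ATOM ;;; NORM ;;;
  CIf (RLess (RGet 0 (NConst 1)) (rvar 7)) CSkip
    (VAL ;;;
     CIf (RLess (rvar 9) (RGet 3 (nvar 24)))
       (CSetR 3 (nvar 24) (rvar 9) ;;; CSetN 13 (nvar 24) (nvar 22) ;;;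
        CSetN 14 (nvar 24) (nvar 25)) CSkip).

(** Sets are enumerated outside and their vertices inside: a set meets only its own at most [L]
    vertices, which keeps the search at order [p ^ L] pairs. Running over all vertices for each set
    would cost another factor [p]. *)
Definition SEARCH : cmd :=
  CFor 22 (NGet 6 sL)
    (CIf e_member
      (CFor 31 e_len
        (set0N 24 (e_vert (nvar 22) (nvar 31)) ;;;
         CFor 25 (NGet 11 e_lets) TRY)) CSkip).

(** The search starts from the zero atom. On the empty set the only letter code is 0, so clearing
    cell 0 of the current atom is enough for [VAL]. *)
Definition RESET : cmd :=
  CFor 24 sP
    (set0N 22 (NConst 0) ;;; CSetR 4 (NConst 0) (ROfNat (NConst 0)) ;;; VAL ;;;
     CSetR 3 (nvar 24) (rvar 9) ;;; CSetN 13 (nvar 24) (NConst 0) ;;;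
     CSetN 14 (nvar 24) (NConst 0)).

Definition e_est : nexp :=
  NAdd (NMul (NAdd (NMul (nvar 29) sP) (nvar 24)) sL) (nvar 20).

Definition e_final_weight : rexp :=
  RDiv (RMul (ROfNat (NConst 2)) (ROfNat (NAdd (nvar 21) (NConst 1))))
    (ROfNat (NMul (nvar 10) (NAdd (nvar 10) (NConst 1)))).

(** The energies accumulate the scaled iterate, while the estimates receive each atom with the
    weight [2 (k + 1) / (K (K + 1))] that it has in the final iterate. They are meaningful after the
    last step only, and no normalization follows. *)
Definition UPDATE : cmd :=
  CFor 24 sP
    (set0N 22 (NGet 13 (nvar 24)) ;;; set0N 25 (NGet 14 (nvar 24)) ;;; ATOM ;;;
     CFor 28 sN
       (LOOK ;;; CSetR 2 e_G (RAdd (RGet 2 e_G)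
          (RMul (ROfNat (NAdd (nvar 21) (NConst 1))) (RGet 4 (nvar 29))))) ;;;
     CFor 26 e_lets
       (FCODE ;;; CSetR 1 e_est (RAdd (RGet 1 e_est)
          (RMul e_final_weight (RGet 4 (nvar 26)))))).

(** * Correctness of the search for the best atom *)

Section Greedy.
Variables (R : realType) (p : nat) (qs : 'I_p -> nat) (L n K : nat).
Variables (w : {ffun 'I_n -> config qs}) (alpha gh : R).
Hypothesis qpos : forall i, 0 < qs i.
Local Notation Q := (\max_(j < p) qs j).
Hypothesis Q0 : 0 < Q.
Local Notation QL := (Q ^ L).
Local Notation B := (2 * K).+1.
Local Notation consts := (consts L K w alpha gh).
Implicit Types (r : {set 'I_p}) (u : 'I_p).
Local Notation AT := (AT qs K gh).
Local Notation VALf := (VALf w).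

Lemma kf_ci q (a b : 'I_q) : kf R q a b = centered_indicator R b a.
Proof.
rewrite /kf /centered_indicator.
have h (x : 'I_q) : 1 - (x.+1 - q) = 1.
  by have -> : x.+1 - q = 0 by apply/eqP; rewrite subn_eq0.
rewrite !h !mul1r; case: eqVneq => [->|ab]; first by rewrite subnn.
have -> : 1 - (a - b + (b - a)) = 0.
  apply/eqP; rewrite subn_eq0; case: (ltngtP a b) => h2.
  - by rewrite addn_gt0 !subn_gt0 h2 orbT.
  - by rewrite addn_gt0 !subn_gt0 h2.
  - by case/eqP: ab; apply/val_inj.
by rewrite sub0r.
Qed.

Lemma kerc_kern r (s s' : letters qs r) : kerc R qs r (lcode s) (lcode s') = kern R s' s.
Proof.
rewrite /kern (eq_bigr (fun i => kf R (qn qs (val (val i))) (s i) (s' i))).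
  rewrite (prod_pos (fun v => kf R (qn qs v))).
  by apply: eq_bigr => j _; rewrite !lcode_digit !ltn_ord.
by move=> i _; rewrite qnE kf_ci.
Qed.

Lemma kerc_invalid_l r e e' : ~~ lvalid qs r e -> kerc R qs r e e' = 0%R.
Proof.
case/forallPn => j; rewrite -leqNgt => h; rewrite /kerc (bigD1 j) //= /kf.
have -> : 1 - ((digit Q e j).+1 - qn qs (nth 0 (verts r) j)) = 0.
  by apply/eqP; rewrite subn_eq0 subn_gt0 ltnS.
by rewrite !mul0r.
Qed.

Lemma kerc_invalid_r r e e' : ~~ lvalid qs r e' -> kerc R qs r e e' = 0%R.
Proof.
case/forallPn => j; rewrite -leqNgt => h; rewrite /kerc (bigD1 j) //= /kf.
have -> : 1 - ((digit Q e' j).+1 - qn qs (nth 0 (verts r) j)) = 0.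
  by apply/eqP; rewrite subn_eq0 subn_gt0 ltnS.
by rewrite mulr0 !mul0r.
Qed.

Lemma AT_atomv r N (s : letters qs r) : AT r N (lcode s) = atomv gh K N s.
Proof.
rewrite /AT /atomv; congr (_ * _)%R.
rewrite -(sum_lcode qpos (r := r) (g := fun e => (digit B N e)%:R * kerc R qs r (lcode s) e)%R).
  by apply: eq_bigr => s' _; rewrite kerc_kern.
by move=> e _ ve; rewrite kerc_invalid_r ?mulr0.
Qed.

Lemma AT_invalid r N e : ~~ lvalid qs r e -> AT r N e = 0%R.
Proof.
move=> ve; rewrite /AT big1 ?mulr0 // => e' _.
by rewrite kerc_invalid_l ?mulr0.
Qed.

Lemma sum_AT r N : (\sum_(e < Q ^ #|r|) `|AT r N e| = \sum_(s : letters qs r) `|atomv gh K N s|)%R.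
Proof.
rewrite -(sum_lcode qpos (r := r) (g := fun e => `|AT r N e|)%R).
  by apply: eq_bigr => s _; rewrite AT_atomv.
by move=> e _ ve; rewrite AT_invalid ?normr0.
Qed.

Variables (F : {set {set 'I_p}}) (t : nat).
Hypothesis FF : F \subset factor_sets p L.

Definition family (st : store R) : Prop :=
  (forall c, c < p.+1 ^ L -> 0 < narr st 4 (c * L.+1 + t) -> exists2 r, r \in F & c = set_code r)
  /\ (forall r, r \in F -> 0 < narr st 4 (set_code r * L.+1 + t)).

Lemma F_card r : r \in F -> 0 < #|r| <= L.
Proof. by move/(fintype.subsetP FF); rewrite inE. Qed.

Variables (k : nat) (G : nat -> R).
Local Notation adm := (adm qs L gh K).
Local Notation vl u r N := (VALf k u G r (AT r N)).

(** [S] describes the atoms tried so far. *)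
Definition best (S : 'I_p -> {set 'I_p} -> nat -> Prop) (st : store R) : Prop :=
  forall u : 'I_p, exists r N, [/\ narr st 13 u = set_code r, narr st 14 u = N,
    adm u F r N, rarr st 3 u = vl u r N &
    forall r' N', S u r' N' -> adm u F r' N' -> (vl u r N <= vl u r' N')%R].

Lemma best_sub (S S' : 'I_p -> {set 'I_p} -> nat -> Prop) st st' :
  narr st' 13 = narr st 13 -> narr st' 14 = narr st 14 -> rarr st' 3 = rarr st 3 ->
  (forall u r N, S' u r N -> adm u F r N -> S u r N) -> best S st -> best S' st'.
Proof.
move=> e1 e2 e3 h b u; have [r [N [h1 h2 h3 h4 h5]]] := b u.
exists r, N; rewrite e1 e2 e3; split=> // r' N' s' a'; by apply: h5 => //; apply: h.
Qed.

Lemma adm_card u r N : adm u F r N -> #|r| <= L.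
Proof.
case=> [[-> _]|[rF _ _ _ _]]; first by rewrite cards0.
by move: rF; rewrite inE => /andP[].
Qed.

Lemma lookc_lt r (m : 'I_n) : lookc w r m < Q ^ #|r|.
Proof. exact: lcode_lt. Qed.

Definition cTRY := cATOM qs L + (cNORM qs L + (100 + (cVAL L n + (100 + (20 + (20 + 20)))))).

Lemma wp_TRY S st r u N : consts st -> narr st 22 0 = set_code r -> narr st 24 0 = u ->
  narr st 25 0 = N -> narr st 21 0 = k -> rarr st 2 = G ->
  r \in F -> u \in r -> N < B ^ (Q ^ #|r|) -> best S st ->
  wp TRY cTRY (best (fun u' r' N' => S u' r' N' \/ [/\ u' = u, r' = r & N' = N])) st.
Proof.
move=> C hc hu hN hk hG rF ur NB bS.
have /andP[r0 rL] := F_card rF.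
have rFS : r \in factor_sets p L by rewrite inE r0.
apply: wp_seq; apply: (wp_conseq (wp_ATOM Q0 C rL hc hN)) => // st1 f1 h1 _.
have C1 := consts_frame f1 isT isT C.
have hc1 : narr st1 22 0 = set_code r by rewrite (f1.1 22 isT).
apply: wp_seq; apply: (wp_conseq (wp_NORM Q0 C1 rL hc1)) => // st2 f2 h2 _.
have C2 := consts_frame f2 isT isT C1.
have norm2 : rarr st2 7 0 = (\sum_(s : letters qs r) `|atomv gh K N s|)%R.
  by rewrite h2 -sum_AT; apply: eq_bigr => e _; rewrite h1.
have bS2 : best S st2.
  move=> u'; have [r' [N' [b1 b2 b3 b4 b5]]] := bS u'; exists r', N'.
  by split=> //; rewrite ?(f2.1 13 isT) ?(f2.1 14 isT) ?(f2.2 3 isT)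
     ?(f1.1 13 isT) ?(f1.1 14 isT) ?(f1.2 3 isT).
apply: wp_if => //= T.
  apply: wp_skip => //; apply: (best_sub _ _ _ _ bS2) => // u' r' N' [//|[-> -> ->]].
  case=> [[r00 _]|[_ _ _ _]]; first by rewrite r00 cards0 in r0.
  by rewrite leNgt -norm2 -(c_gh C2) T.
have aN : adm u F r N.
  by right; split => //; move: T; rewrite -leNgt norm2 (c_gh C2).
have hc2 : narr st2 22 0 = set_code r by rewrite (f2.1 22 isT).
have hu2 : narr st2 24 0 = u by rewrite (f2.1 24 isT) (f1.1 24 isT).
have hk2 : narr st2 21 0 = k by rewrite (f2.1 21 isT) (f1.1 21 isT).
apply: wp_seq; apply: (wp_conseq (wp_VAL C2 rL hc2 hk2 hu2)) => // st3 f3 h3 _.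
have val3 : rarr st3 9 0 = vl u r N.
  rewrite h3 (f2.2 2 isT) (f1.2 2 isT) hG; apply: eq_bigr => m _.
  by rewrite (f2.2 4 isT) h1 ?lookc_lt.
have bS3 : best S st3.
  move=> u'; have [r' [N' [b1 b2 b3 b4 b5]]] := bS2 u'; exists r', N'.
  by split=> //; rewrite ?(f3.1 13 isT) ?(f3.1 14 isT) ?(f3.2 3 isT).
have hu3 : narr st3 24 0 = u by rewrite (f3.1 24 isT).
have hc3 : narr st3 22 0 = set_code r by rewrite (f3.1 22 isT).
have hN3 : narr st3 25 0 = N by rewrite (f3.1 25 isT) (f2.1 25 isT) (f1.1 25 isT).
apply: wp_if => //=; rewrite hu3 val3 => T3; last first.
  apply: wp_skip => // u'; have [r' [N' [b1 b2 b3 b4 b5]]] := bS3 u'.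
  exists r', N'; split=> // r1 N1 [h|[e -> ->]] a1; first exact: b5.
  by rewrite -b4 e leNgt.
apply: wp_seq; apply: wp_setR => // f4; apply: wp_seq; apply: wp_setN => // f5.
apply: wp_setN => // u' /=; rewrite /upd /= hu3.
have [r' [N' [b1 b2 b3 b4 b5]]] := bS3 u'.
have [uu|uu] := eqVneq (nat_of_ord u') (nat_of_ord u).
  have -> : u' = u by apply/val_inj.
  exists r, N; split=> //; rewrite ?hc3 ?hN3 ?val3 //.
  move=> r1 N1 [h|[_ -> ->]] a1 //.
  move: T3 b4 b5; have -> : u' = u by apply/val_inj.
  by move=> T3 b4 b5; apply: le_trans (b5 _ _ h a1); rewrite -b4 ltW.
exists r', N'; split=> // r1 N1 [h|[e _ _]] a1; first exact: b5.
by rewrite e eqxx in uu.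
Qed.

Definition cSEARCH := cfor (p.+1 ^ L) (100 + cfor L (40 + cfor (B ^ QL) cTRY)).

(** The set of atoms tried grows along three nested loops: smaller set codes, earlier positions in
    the current set, smaller coefficient codes. What the program skips is not admissible: sets
    outside the family, and vertices outside the set. *)
Lemma wp_SEARCH st : consts st -> narr st 20 0 = t -> narr st 21 0 = k -> rarr st 2 = G ->
  family st -> best (fun u r N => r = finset.set0) st ->
  wp SEARCH cSEARCH (best (fun u r N => True)) st.
Proof.
move=> C ht hk hG fam b0.
apply: (wp_conseq (k := cSEARCH)
  (P := best (fun u r N => r = finset.set0 \/ set_code r < p.+1 ^ L))) => //; last first.
  move=> st' _; apply: best_sub => // u r N _ /adm_card rL.
  by right; apply: set_code_lt.
apply: (@wp_for _ _ _ _ _ _ (fun J => best (fun u r N => r = finset.set0 \/ set_code r < J))) => //.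
- by move=> st' fr; have C' := consts_frame fr isT isT C; rewrite /= (c_L C') (c_W C').
- by apply: (best_sub _ _ _ _ b0) => // u r N [].
move=> c st1 cP f1 hc b1; have C1 := consts_frame f1 isT isT C.
have mem : neval st1 (NGet 4 e_fam) = narr st 4 (c * L.+1 + t).
  by rewrite /= hc (c_L C1) (f1.1 20 isT) (f1.1 4 isT) ht addn1.
apply: wp_if => //=; rewrite -/(neval st1 (NGet 4 e_fam)) ?mem => T; last first.
  apply: wp_skip; first by rewrite addn_gt0 orbT.
  apply: (best_sub _ _ _ _ b1) => // u r N.
  move=> [->|]; [by left | rewrite ltnS leq_eqVlt => /orP[/eqP rc|]; last by right].
  case=> [[-> _]|[_ rF _ _ _]]; first by left.
  by have := fam.2 r rF; rewrite rc (negbTE T).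
have [r rF cr] := fam.1 c cP T; have /andP[r0 rL] := F_card rF.
rewrite cr in hc.
pose S1 J := fun (u : 'I_p) (r' : {set 'I_p}) (N : nat) =>
  (r' = finset.set0 \/ set_code r' < c) \/
  (r' = r /\ exists2 j, j < J & nth 0 (verts r) j = u).
apply: (wp_conseq (k := cfor #|r| (40 + cfor (B ^ QL) cTRY)) (P := best (S1 #|r|))).
- apply: (@wp_for _ _ _ _ _ _ (fun J => best (S1 J))) => //.
  + move=> st' fr; have C' := consts_frame fr isT isT C1.
    by rewrite (e_len_val C' rL) // (fr.1 22 isT).
  + by apply: (best_sub _ _ _ _ b1) => // u r' N [//|[_ [j]]].
  move=> j st2 jr f2 hj b2; have C2 := consts_frame f2 isT isT C1.
  apply: wp_seq; apply: wp_setN => //; set st3 := setN _ _ _ _ => f3.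
  have C3 := consts_frame f3 isT isT C2.
  have [i [vi _]] := nth_pos qs (Ordinal jr).
  have hc2 : narr st2 22 0 = set_code r by rewrite (f2.1 22 isT).
  have jL : j <= L by apply: leq_trans (ltnW jr) rL.
  have hu3 : narr st3 24 0 = val i.
    rewrite /st3 /= /upd /= hj hc2 (c_W C2) // (c_p C2) addn1.
    by have := set_code_digit r j; rewrite jr /digit => ->; rewrite subn1 -vi.
  pose S2 J := fun (u : 'I_p) (r' : {set 'I_p}) (N : nat) =>
    S1 j u r' N \/ [/\ u = val i, r' = r & N < J].
  apply: (wp_conseq (k := cfor (B ^ (Q ^ #|r|)) cTRY) (P := best (S2 (B ^ (Q ^ #|r|))))).
  * apply: (@wp_for _ _ _ _ _ _ (fun J => best (S2 J))) => //.
    - move=> st' fr; have C' := consts_frame fr isT isT C3.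
      have -> : neval st' (NGet 11 e_lets) = narr st' 11 (neval st' e_lets) by [].
      rewrite (e_lets_val C' rL) ?(fr.1 22 isT) // (c_BW C') //; exact: letters_bound.
    - by apply: (best_sub _ _ _ _ b2) => // u r' N [//|[_ _]].
    move=> N st4 NB f4 hN b4; have C4 := consts_frame f4 isT isT C3.
    apply: (wp_conseq (wp_TRY C4 (r := r) (u := val i) (N := N) _ _ hN _ _ rF (valP i) NB b4)) => //.
    - by rewrite (f4.1 22 isT) (f3.1 22 isT).
    - by rewrite (f4.1 24 isT).
    - by rewrite (f4.1 21 isT) (f3.1 21 isT) (f2.1 21 isT) (f1.1 21 isT).
    - by rewrite (f4.2 2 isT) (f3.2 2 isT) (f2.2 2 isT) (f1.2 2 isT).
    move=> st5 _; apply: best_sub => // u' r' N' [h|[-> -> +]] _; first by left; left.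
    rewrite ltnS leq_eqVlt => /orP[/eqP ->|lt]; first by right.
    by left; right.
  * by rewrite leq_cfor // leq_pexp2l // letters_bound.
  move=> st4 f4 b4; apply: (best_sub _ _ _ _ b4) => // u' r' N' [h|[-> [j' + e]]] a; first by left; left.
  rewrite ltnS leq_eqVlt => /orP[/eqP jj|lt]; last by left; right; split=> //; exists j'.
  right; split=> //; first by apply/val_inj; rewrite /= -e jj vi.
  case: a => [[r00 _]|[_ _ _ //]]; by rewrite r00 cards0 in r0.
- by rewrite leq_cfor.
move=> st2 f2; apply: best_sub => // u r' N [->|]; first by left; left.
rewrite ltnS leq_eqVlt => /orP[/eqP e|lt]; last by left; right.
case=> [[-> _]|[_ _ ur _ _]]; first by left; left.
have rr : r' = r by apply: set_code_inj; rewrite e.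
right; split=> //; rewrite rr in ur.
exists (index (val u) (verts r)); last by rewrite nth_index ?mem_verts.
by rewrite -size_verts index_mem mem_verts.
Qed.

Definition cRESET := cfor p (20 + (20 + (cVAL L n + (20 + (20 + 20))))).

Lemma wp_RESET st : consts st -> narr st 21 0 = k -> rarr st 2 = G ->
  wp RESET cRESET (best (fun u r N => r = finset.set0)) st.
Proof.
move=> C hk hG.
apply: (wp_conseq (k := cRESET) (P := fun st' => forall u : 'I_p, u < p ->
   [/\ narr st' 13 u = 0, narr st' 14 u = 0 & rarr st' 3 u = vl u finset.set0 0])) => //; last first.
  move=> st' _ h u; have [h1 h2 h3] := h u (ltn_ord u).
  exists finset.set0, 0; split=> //; [by rewrite set_code0|by left|].
  move=> r' N' -> [[_ ->] //|[]]; by rewrite inE cards0.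
apply: (@wp_for _ _ _ _ _ _ (fun J st' => forall u : 'I_p, u < J ->
   [/\ narr st' 13 u = 0, narr st' 14 u = 0 & rarr st' 3 u = vl u finset.set0 0])) => //.
  by move=> st' fr; rewrite /= (c_p (consts_frame fr isT isT C)).
move=> u st1 up f1 hu IH.
apply: wp_seq; apply: wp_setN => // f2; apply: wp_seq; apply: wp_setR => // f3.
set st3 := setR _ _ _ _ in f3 *.
have C3 := consts_frame f3 isT isT (consts_frame f2 isT isT (consts_frame f1 isT isT C)).
have hc3 : narr st3 22 0 = set_code (finset.set0 : {set 'I_p}) by rewrite set_code0.
have hk3 : narr st3 21 0 = k by rewrite -hk -(f1.1 21 isT).
have c0 : #|finset.set0 : {set 'I_p}| <= L by rewrite cards0.
apply: wp_seq; apply: (wp_conseq (wp_VAL C3 c0 hc3 hk3 hu)) => // st4 f4 h4 _.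
have hu4 : narr st4 24 0 = u by rewrite (f4.1 24 isT).
apply: wp_seq; apply: wp_setR => // f5; apply: wp_seq; apply: wp_setN => // f6.
apply: wp_setN => // u'; rewrite ltnS leq_eqVlt /= /upd /= hu4 => /orP[/eqP e|lt].
  rewrite e eqxx; split=> //; rewrite h4 -e.
  have -> : rarr st3 2 = G by rewrite -hG -(f1.2 2 isT).
  apply: eq_bigr => m _; congr (expR (- (_ * (_ + _ * _))))%R.
  have := lookc_lt finset.set0 m; rewrite cards0 expn0 ltnS leqn0 => /eqP ->.
  rewrite /st3 /= /upd /= /AT cards0 expn0 big_ord1 /digit expn0 divn1 mod0n.
  by rewrite mul0r mulr0.
rewrite (ltn_eqF lt) (f4.1 13 isT) (f4.1 14 isT) (f4.2 3 isT).
exact: IH.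
Qed.

End Greedy.

Lemma pair_index_eq b x y i j : i < b -> j < b ->
  (x * b + i == y * b + j) = (x == y) && (i == j).
Proof.
move=> ib jb; have b0 : 0 < b by exact: leq_ltn_trans ib.
apply/eqP/andP => [e|[/eqP -> /eqP ->] //].
have := congr1 (modn^~ b) e; rewrite !modnMDl !modn_small // => ij.
by split; apply/eqP => //; have := congr1 (divn^~ b) e; rewrite !divnMDl // !divn_small // !addn0.
Qed.

Definition OPTIMIZE : cmd :=
  CFor 28 (NMul sP sN) (CSetR 2 (nvar 28) (ROfNat (NConst 0))) ;;;
  CFor 21 (nvar 10) (RESET ;;; SEARCH ;;; UPDATE).

(** * Correctness of a greedy step and of the optimization *)

Section Update.
Variables (R : realType) (p : nat) (qs : 'I_p -> nat) (L n K : nat).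
Variables (w : {ffun 'I_n -> config qs}) (alpha gh : R).
Hypothesis qpos : forall i, 0 < qs i.
Local Notation Q := (\max_(j < p) qs j).
Hypothesis Q0 : 0 < Q.
Hypotheses (n0 : 0 < n) (gh0 : (0 < gh)%R).
Local Notation QL := (Q ^ L).
Hypothesis QK : (0 < K -> QL ^ 2 <= K).
Local Notation B := (2 * K).+1.
Local Notation consts := (consts L K w alpha gh).
Implicit Types (r : {set 'I_p}) (u : 'I_p).
Local Notation AT := (AT qs K gh).
Variables (F : {set {set 'I_p}}) (t : nat).
Hypotheses (FF : F \subset factor_sets p L) (tL : t < L).
Local Notation adm := (adm qs L gh K).
Local Notation family := (family L F t).

Definition est_addr (u : nat) r e : nat :=
  (fcode qs #|r| (set_code r) e * p + u) * L + t.

Definition wt (k : nat) : R := (2 * k.+1%:R / (K * K.+1)%:R)%R.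

Definition cUPDATE := cfor p (20 + (20 + (cATOM qs L +
  (cfor n (cLOOK L + 100) + cfor QL (cFCODE L + 100))))).

(** The new estimate at [a] is given as the sum of all writes that hit the address [a]; that these
    are at most one is shown in [wp_STEP]. *)
Lemma wp_UPDATE st k (rr : 'I_p -> {set 'I_p}) (NN : 'I_p -> nat) :
  consts st -> narr st 20 0 = t -> narr st 21 0 = k ->
  (forall u, [/\ narr st 13 u = set_code (rr u), narr st 14 u = NN u & #|rr u| <= L]) ->
  wp UPDATE cUPDATE (fun st' =>
   (forall (u : 'I_p) (m : 'I_n), rarr st' 2 (u * n + m) = (rarr st 2 (u * n + m)%N +
       k.+1%:R * AT (rr u) (NN u) (lookc w (rr u) m))%R) /\
   (forall a, rarr st' 1 a = (rarr st 1 a +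
      \sum_(u < p) \sum_(e < Q ^ #|rr u| | est_addr u (rr u) e == a)
         wt k * AT (rr u) (NN u) e)%R)) st.
Proof.
move=> C ht hk hb.
pose Inv J st' :=
   (forall (u : 'I_p) (m : 'I_n), rarr st' 2 (u * n + m) = (rarr st 2 (u * n + m)%N +
       (u < J)%N%:R * (k.+1%:R * AT (rr u) (NN u) (lookc w (rr u) m)))%R) /\
   (forall a, rarr st' 1 a = (rarr st 1 a +
      \sum_(u < p | (u < J)%N) \sum_(e < Q ^ #|rr u| | est_addr u (rr u) e == a)
         wt k * AT (rr u) (NN u) e)%R).
apply: (wp_conseq (k := cUPDATE) (P := Inv p)) => //; last first.
  move=> st' _ [h1 h2]; split=> [u m|a]; first by rewrite h1 ltn_ord mul1r.
  by rewrite h2; congr (_ + _)%R; apply: eq_bigl => u; rewrite ltn_ord.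
apply: (@wp_for _ _ _ _ _ _ Inv) => //.
- by move=> st' fr; rewrite /= (c_p (consts_frame fr isT isT C)).
- split=> [u m|a]; first by rewrite ltn0 mul0r addr0.
  by rewrite big_pred0 ?addr0.
move=> u0 st1 up f1 hu [IH2 IH1].
have C1 := consts_frame f1 isT isT C.
pose u := Ordinal up; have [b1 b2 rL] := hb u.
apply: wp_seq; apply: wp_setN => //; set st2 := setN _ _ _ _ => f2.
apply: wp_seq; apply: wp_setN => //; set st3 := setN _ _ _ _ => f3.
have C3 := consts_frame f3 isT isT (consts_frame f2 isT isT C1).
have hc3 : narr st3 22 0 = set_code (rr u).
  by rewrite (f3.1 22 isT) /st2 /= /upd /= hu (f1.1 13 isT) -b1.
have hN3 : narr st3 25 0 = NN u.
  rewrite /st3 /= /upd /=.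
  by rewrite hu (f1.1 14 isT) -b2.
have ht3 : narr st3 20 0 = t by rewrite (f3.1 20 isT) (f2.1 20 isT) (f1.1 20 isT).
have hk3 : narr st3 21 0 = k by rewrite (f3.1 21 isT) (f2.1 21 isT) (f1.1 21 isT).
have hu3 : narr st3 24 0 = u by rewrite (f3.1 24 isT) (f2.1 24 isT).
apply: wp_seq; apply: (wp_conseq (wp_ATOM Q0 C3 rL hc3 hN3)) => // st4 f4 h4 _.
have C4 := consts_frame f4 isT isT C3.
have hc4 : narr st4 22 0 = set_code (rr u) by rewrite (f4.1 22 isT).
pose I5 M st' := forall (u' : 'I_p) (m : 'I_n), rarr st' 2 (u' * n + m) =
   (rarr st4 2 (u' * n + m)%N + ((u' == u) && (m < M)%N)%:R *
     (k.+1%:R * AT (rr u) (NN u) (lookc w (rr u) m)))%R.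
apply: wp_seq; apply: (wp_conseq (k := cfor n (cLOOK L + 100)) (P := I5 n)) => //.
  apply: (@wp_for _ _ _ _ _ _ I5) => //.
  - by move=> st' fr; rewrite /= (c_n (consts_frame fr isT isT C4)).
  - by move=> u' m; rewrite ltn0 andbF mul0r addr0.
  move=> m0 st5 mn f5 hm IH5; have C5 := consts_frame f5 isT isT C4.
  apply: wp_seq; apply: (wp_conseq (wp_LOOK (m := Ordinal mn) (r := rr u) C5 rL _ hm)) => //.
    by rewrite (f5.1 22 isT).
  move=> st6 f6 h6 _; have C6 := consts_frame f6 isT isT C5; apply: wp_setR => //.
  move=> u' m /=; rewrite /upd /= (f6.1 24 isT) (f6.1 28 isT) hm (c_n C6).
  rewrite (f5.1 24 isT) (f4.1 24 isT) hu3 pair_index_eq ?ltn_ord // (f6.2 2 isT).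
  have -> : (m < m0.+1) = (nat_of_ord m == m0) || (m < m0) by rewrite ltnS leq_eqVlt.
  rewrite -(inj_eq val_inj) /=.
  case: (eqVneq (nat_of_ord u') u0) => [eu|] /=; last by move=> ne; rewrite IH5 -(inj_eq val_inj) /= (negbTE ne).
  case: (eqVneq (nat_of_ord m) m0) => [em|] /=; last first.
    by move=> ne; rewrite IH5 -(inj_eq val_inj) /= eu eqxx.
  have -> : u0 * n + m0 = u' * n + m by rewrite eu em.
  rewrite IH5 em ltnn andbF mul0r addr0 mul1r h6 (f6.1 21 isT) (f6.2 4 isT) (f5.1 21 isT).
  rewrite (f5.2 4 isT) (f4.1 21 isT) hk3 addn1 h4 ?lookc_lt //.
  by have -> : m = Ordinal mn by apply/val_inj.
move=> st5 f5 h5 _; have C5 := consts_frame f5 isT isT C4.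
pose I6 M st' := forall a, rarr st' 1 a = (rarr st5 1 a +
  \sum_(e < M | est_addr u (rr u) e == a) wt k * AT (rr u) (NN u) e)%R.
apply: (wp_conseq (k := cfor (Q ^ #|rr u|) (cFCODE L + 100)) (P := I6 (Q ^ #|rr u|))) => //.
- apply: (@wp_for _ _ _ _ _ _ I6) => //.
  + move=> st' fr; have C' := consts_frame fr isT isT C5.
    by rewrite (e_lets_val C' rL) // (fr.1 22 isT) (f5.1 22 isT).
  + by move=> a; rewrite big_ord0 addr0.
  move=> e st6 eQ f6 he IH6; have C6 := consts_frame f6 isT isT C5.
  apply: wp_seq; apply: (wp_conseq (wp_FCODE (r := rr u) C6 rL _ he)) => //.
    by rewrite (f6.1 22 isT) (f5.1 22 isT).
  move=> st7 f7 h7 _; have C7 := consts_frame f7 isT isT C6; apply: wp_setR => //.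
  move=> a /=; rewrite /upd /= h7 (f7.1 24 isT) (f7.1 20 isT) (c_p C7) (c_L C7).
  rewrite (f6.1 24 isT) (f6.1 20 isT) (f5.1 24 isT) (f5.1 20 isT) (f4.1 24 isT) (f4.1 20 isT).
  rewrite hu3 ht3 -/(est_addr u0 (rr u) e) big_mkcond big_ord_recr -big_mkcond /= (f7.2 1 isT).
  rewrite [a == _]eq_sym; case: eqVneq => [<-|_]; last by rewrite addr0 IH6.
  rewrite IH6 addrA; congr (_ + _)%R.
  rewrite (f7.1 21 isT) (f6.1 21 isT) (f5.1 21 isT) (f4.1 21 isT) hk3 (c_K C7) !addn1.
  by rewrite (f7.1 26 isT) he (f7.2 4 isT) (f6.2 4 isT) (f5.2 4 isT) h4 //.
- by rewrite leq_cfor // letters_bound.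
move=> st6 f6 h6; split=> [u' m|a] /=.
  rewrite (f6.2 2 isT) h5 (f4.2 2 isT) -[rarr st3 2]/(rarr st1 2) IH2.
  have -> : (u' < u0.+1) = (nat_of_ord u' == u0) || (u' < u0) by rewrite ltnS leq_eqVlt.
  rewrite ltn_ord andbT -(inj_eq val_inj) /=.
  case: (eqVneq (nat_of_ord u') u0) => [eu|ne] /=; last by rewrite mul0r addr0.
  rewrite eu ltnn !mul0r addr0 !mul1r.
  by have -> : u' = u by apply/val_inj.
rewrite h6 (f5.2 1 isT) (f4.2 1 isT) -[rarr st3 1]/(rarr st1 1) IH1 -addrA; congr (_ + _)%R.
rewrite [in RHS](bigD1 u) /= ?ltnSn // addrC; congr (_ + _)%R.
apply: eq_bigl => u'.
have -> : (u' < u0.+1) = (nat_of_ord u' == u0) || (u' < u0) by rewrite ltnS leq_eqVlt.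
rewrite -(inj_eq val_inj) /=.
by case: (ltngtP u' u0).
Qed.

Local Notation S u := (screening_objective L w u).
Local Notation atomp := (@atomp R p qs gh K).
Local Notation nextp := (@nextp R p qs gh K).
Local Notation fw_inv := (fw_inv L w gh K).

Lemma atom_energy u r N (m : 'I_n) : adm u F r N ->
  local_energy L (atomp r N) u (w m) = AT r N (lookc w r m).
Proof.
rewrite /atomp local_energy_block; case=> [[-> ->]|[rF _ ur _ _]].
  rewrite inE cards0 /= /AT big1 ?mulr0 // => e _.
  by rewrite /digit div0n mod0n mul0r.
rewrite rF ur /= centered_lookup ?AT_atomv //.
exact: atomv_centered.
Qed.

Lemma next_energy k X u r N sigma :
  local_energy L (curp k.+1 (nextp k X r N)) u sigma =
   (2 / (k.+1 * k.+2)%:R * (local_energy L X u sigma +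
      k.+1%:R * local_energy L (atomp r N) u sigma))%R.
Proof.
rewrite mulrDr mulrA -local_energy_lin; congr (local_energy _ _ _ _).
apply: functional_extensionality_dep => r'; apply: funext => s.
by rewrite /curp /nextp; ring.
Qed.

Lemma VALf_objective k u G X r N : adm u F r N ->
  (forall m : 'I_n, G (u * n + m) = local_energy L X u (w m)) ->
  VALf w k u G r (AT r N) = (n%:R * S u (curp k.+1 (nextp k X r N)))%R.
Proof.
move=> a hG; rewrite /screening_objective mulVKf ?pnatr_eq0 -?lt0n //.
by apply: eq_bigr => m _; rewrite next_energy atom_energy // hG.
Qed.

(** Cells of invalid letter codes stay zero because the averaging sums over all codes. Columns of
    other rounds stay untouched because the final store has to show the whole run. *)
Definition opt_inv (st0 : store R) (k : nat) (st : store R) : Prop :=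
  (exists X : 'I_p -> param R qs, forall u,
   [/\ fw_inv u F k (X u),
       forall m : 'I_n, rarr st 2 (u * n + m) = local_energy L (X u) u (w m) &
       forall r (s : letters qs r), rarr st 1 ((factor_code s * p + u) * L + t) =
          (2 / (K * K.+1)%:R * X u r s)%R]) /\
  (forall (u : 'I_p) r e, e < Q ^ #|r| -> ~~ lvalid qs r e ->
     rarr st 1 (est_addr u r e) = 0%R) /\
  (forall a, a %% L != t -> rarr st 1 a = rarr st0 1 a).

Definition cSTEP := cRESET p L n + (cSEARCH qs L n K + cUPDATE).

Lemma wp_STEP st0 st k : consts st -> narr st 20 0 = t -> narr st 21 0 = k -> k < K ->
  family st -> opt_inv st0 k st ->
  wp (RESET ;;; SEARCH ;;; UPDATE) cSTEP (opt_inv st0 k.+1) st.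
Proof.
move=> C ht hk kK fam [[X hX] [inval frz]].
have K0 : 0 < K by apply: leq_ltn_trans kK.
have QK' := QK K0.
pose G := rarr st 2.
apply: wp_seq; apply: (wp_conseq (wp_RESET F C hk erefl)) => // st1 f1 h1 _.
have C1 := consts_frame f1 isT isT C.
have ht1 : narr st1 20 0 = t by rewrite (f1.1 20 isT).
have hk1 : narr st1 21 0 = k by rewrite (f1.1 21 isT).
have hG1 : rarr st1 2 = rarr st 2 by rewrite (f1.2 2 isT).
have fam1 : family st1 by rewrite /family (f1.1 4 isT).
apply: wp_seq; apply: (wp_conseq (wp_SEARCH qpos Q0 FF C1 ht1 hk1 hG1 fam1 h1)) => // st2 f2 h2 _.
have C2 := consts_frame f2 isT isT C1.
pose rr u := projT1 (cid (h2 u)); pose NN u := projT1 (cid (projT2 (cid (h2 u)))).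
have P2 u := projT2 (cid (projT2 (cid (h2 u)))).
rewrite -/(rr _) -/(NN _) in P2.
have hb u : [/\ narr st2 13 u = set_code (rr u), narr st2 14 u = NN u & #|rr u| <= L].
  by have [b1 b2 b3 _ _] := P2 u; split=> //; exact: adm_card b3.
apply: (wp_conseq (wp_UPDATE (k := k) C2 _ _ hb)) => //.
- by rewrite (f2.1 20 isT).
- by rewrite (f2.1 21 isT).
move=> st3 f3 [h3 h4]; split; last split.
- have nR0 : (0 < n%:R :> R)%R by rewrite ltr0n.
  exists (fun u => nextp k (X u) (rr u) (NN u)) => u.
  have [hfw hen hest] := hX u; have [_ _ ad _ bst] := P2 u.
  split.
  + apply: (fw_step qpos n0 gh0 K0 QK' hfw ad) => r' N' a'.
    rewrite -(ler_pM2l nR0) -!(VALf_objective _ (G := G)) //.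
    exact: bst.
  + move=> m; rewrite h3 (f2.2 2 isT) (f1.2 2 isT) hen -(atom_energy m ad).
    rewrite -[X in (X + _)%R]mul1r -local_energy_lin; congr (local_energy _ _ _ _).
    apply: functional_extensionality_dep => r'; apply: funext => s.
    by rewrite mul1r.
  + move=> r s; rewrite h4 (f2.2 1 isT) (f1.2 1 isT) hest /nextp mulrDr; congr (_ + _)%R.
    (* Injectivity of the addresses: the only write to this cell is that of [u], and only if its
       atom lives on [r]. *)
    have addrE (u' : 'I_p) r' e : e < Q ^ #|r'| ->
       (est_addr u' r' e == (factor_code s * p + u) * L + t) = [&& u' == u, r' == r & e == lcode s].
      move=> eQ; rewrite /est_addr pair_index_eq // eqxx andbT pair_index_eq // andbC.
      rewrite -(inj_eq val_inj); congr (_ && _); rewrite -fcode_lcode.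
      apply/eqP/andP => [h|[/eqP -> /eqP ->] //].
      by have [-> ->] := fcode_inj Q0 eQ (lcode_lt s) h; rewrite !eqxx.
    rewrite (bigD1 u) //= [X in (_ + X)%R]big1 ?addr0; last first.
      move=> u' /negbTE uu; rewrite big_pred0 // => e.
      by rewrite addrE // uu.
    rewrite /atomp /blockp; case: (eqVneq r (rr u)) => [rE|rne]; last first.
      rewrite mulr0 mulr0 big_pred0 // => e.
      by rewrite addrE // eqxx eq_sym (negbTE rne).
    move: (rr u) (NN u) rE => r0 N0 rE; subst r0.
    rewrite (big_pred1 (Ordinal (lcode_lt s))) /=; last first.
      by move=> e; rewrite /= addrE // !eqxx.
    by rewrite AT_atomv // /wt [RHS]mulrA; congr (_ * _)%R; rewrite mulrAC.
- move=> u r e eQ ve; rewrite h4 (f2.2 1 isT) (f1.2 1 isT) inval // add0r.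
  rewrite big1 // => u' _; rewrite big1 // => e'; rewrite /est_addr => /eqP.
  move/eqP; rewrite pair_index_eq // eqxx andbT pair_index_eq // => /andP[/eqP h _].
  have [rE eE] := fcode_inj Q0 (ltn_ord e') eQ h.
  by rewrite AT_invalid ?mulr0 // eE rE.
- move=> a aL; rewrite h4 (f2.2 1 isT) (f1.2 1 isT) frz // big1 ?addr0 // => u _.
  rewrite big_pred0 // => e; apply/negP => /eqP ea; move: aL.
  by rewrite -ea /est_addr modnMDl modn_small // eqxx.
Qed.

Definition cOPT := cfor (p * n) 20 + cfor K cSTEP.

Lemma wp_OPTIMIZE st : consts st -> narr st 20 0 = t -> family st ->
  (forall x, rarr st 1 (x * L + t) = 0%R) ->
  wp OPTIMIZE cOPT (opt_inv st K) st.
Proof.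
move=> C ht fam z1.
apply: wp_seq; apply: (wp_conseq (k := cfor (p * n) 20)
  (P := fun st' => forall a, a < p * n -> rarr st' 2 a = 0%R)) => //.
  apply: (@wp_for _ _ _ _ _ _ (fun J st' => forall a, a < J -> rarr st' 2 a = 0%R)) => //.
    by move=> st' fr; have C' := consts_frame fr isT isT C; rewrite /= (c_p C') (c_n C').
  move=> j st1 jp f1 hj IH; apply: wp_setR => // a; rewrite ltnS leq_eqVlt /= /upd /= hj.
  by case: eqP => //= _ /IH.
move=> st1 f1 h1 _; have C1 := consts_frame f1 isT isT C.
apply: (wp_conseq (k := cfor K cSTEP) (P := opt_inv st K)) => //.
apply: (@wp_for _ _ _ _ _ _ (opt_inv st)) => //.
- by move=> st' fr; rewrite /= (c_K (consts_frame fr isT isT C1)).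
- split; last first.
    split=> [u r e _ _|a _]; rewrite /= (f1.2 1 isT) //; exact: z1.
  exists (fun u r (s : letters qs r) => 0%R) => u; split.
  + exact: fw_inv0.
  + move=> m; rewrite /= h1; last first.
      by apply: (@leq_trans (u * n + n)); rewrite ?ltn_add2l // -mulSnr leq_mul2r ltn_ord orbT.
    rewrite /local_energy big1 // => r _; rewrite big1 // => s _; exact: mul0r.
  + by move=> r s; rewrite /= (f1.2 1 isT) z1 mulr0.
move=> k st2 kK f2 hk inv; have C2 := consts_frame f2 isT isT C1.
apply: (wp_conseq (wp_STEP C2 _ hk kK _ inv)) => //.
- by rewrite (f2.1 20 isT) (f1.1 20 isT).
- by rewrite /family (f2.1 4 isT) (f1.1 4 isT).
Qed.

End Update.

(* The code of the set [c] without its element at position [nvar 31]. *)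
Definition e_without : nexp :=
  NAdd (NMul (NDiv (nvar 22) (NGet 6 (NAdd (nvar 31) (NConst 1)))) (NGet 6 (nvar 31)))
       (NMod (nvar 22) (NGet 6 (nvar 31))).

(** Marks the sets one element below a member. The families are downward closed, so this finds every
    member that is not maximal without comparing members in pairs. *)
Definition MARK : cmd :=
  CFor 22 (NGet 6 sL)
    (CIf e_member
      (CFor 31 e_len
        (CSetN 12 (NAdd (NMul e_without (NAdd sL (NConst 1))) (nvar 20)) (NConst 1)))
      CSkip).

Definition AVERAGE : cmd :=
  set0R 6 (ROfNat (NConst 0)) ;;;
  CFor 26 e_lets
    (FCODE ;;; set0R 7 (ROfNat (NConst 0)) ;;;
     CFor 31 e_len
       (set0N 24 (e_vert (nvar 22) (nvar 31)) ;;;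
        set0R 7 (RAdd (rvar 7) (RGet 1 e_est))) ;;;
     set0R 6 (RAdd (rvar 6) (RMul (RDiv (rvar 7) (ROfNat e_len)) (RDiv (rvar 7) (ROfNat e_len))))).

(** The square of [alpha / 2]: the machine has no square root, so the squared norm is compared. *)
Definition e_threshold : rexp :=
  RDiv (RMul (rvar 0) (rvar 0)) (ROfNat (NConst 4)).

Definition KEEP : cmd := CSetN 4 (NAdd e_fam (NConst 1)) (NConst 1).

Definition PRUNE : cmd :=
  CFor 22 (NGet 6 sL)
    (CIf e_member
      (CIf (NLess (NConst 0) (NGet 12 e_fam)) KEEP
        (AVERAGE ;;; CIf (RLess (rvar 6) e_threshold) CSkip KEEP))
      CSkip).

Definition OUTPUT : cmd :=
  CFor 22 (NGet 6 sL)
    (CIf e_member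
      (CIf (NLess (NConst 0) (NGet 12 e_fam)) CSkip (CSetN 3 (nvar 22) (NConst 1)))
      CSkip).

(** * Correctness of marking, pruning and output *)

Section Rounds.
Variables (R : realType) (p : nat) (qs : 'I_p -> nat) (L n K : nat).
Variables (w : {ffun 'I_n -> config qs}) (alpha gh : R).
Hypothesis qpos : forall i, 0 < qs i.
Local Notation Q := (\max_(j < p) qs j).
Hypothesis Q0 : 0 < Q.
Local Notation QL := (Q ^ L).
Local Notation consts := (consts L K w alpha gh).
Implicit Types (r : {set 'I_p}) (u : 'I_p).
Variables (F : {set {set 'I_p}}) (t : nat).
Hypotheses (FF : F \subset factor_sets p L).
Local Notation family := (family L F t).

Let rL r : r \in F -> #|r| <= L.
Proof. by move=> /(F_card FF) /andP[]. Qed.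

Definition cMARK := cfor (p.+1 ^ L) (100 + cfor L 60).

Lemma col_eq a b t1 t2 : t1 <= L -> t2 <= L ->
  (a * L.+1 + t1 == b * L.+1 + t2) = (a == b) && (t1 == t2).
Proof. by move=> h1 h2; rewrite pair_index_eq. Qed.

Definition marked r : Prop := exists r' i, [/\ r' \in F, i \in r' & r = r' :\ i].

Lemma wp_MARK st : consts st -> narr st 20 0 = t -> t <= L -> family st ->
  (forall x, narr st 12 (x * L.+1 + t) = 0) ->
  wp MARK cMARK (fun st' =>
    (forall r, 0 < narr st' 12 (set_code r * L.+1 + t) <-> marked r) /\
    (forall a, a %% L.+1 != t -> narr st' 12 a = narr st 12 a)) st.
Proof.
move=> C ht tL fam z.
(* [D] describes the pairs of a member and a position that have been processed; both loops use the
   same invariant with different [D]. *)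
pose Inv (D : {set 'I_p} -> nat -> Prop) (st' : store R) :=
    (forall r, 0 < narr st' 12 (set_code r * L.+1 + t) <->
       exists r' j, [/\ r' \in F, j < #|r'|, D r' j &
         exists i : 'I_p, nth 0 (verts r') j = i /\ r = r' :\ i]) /\
    (forall a, a %% L.+1 != t -> narr st' 12 a = narr st 12 a).
apply: (wp_conseq (k := cMARK) (P := Inv (fun r j => set_code r < p.+1 ^ L))) => //; last first.
  move=> st' _ [h1 h2]; split=> // r; rewrite h1; split=> [[r' [j [rF jr _ [i [ji e]]]]]|].
    by exists r', i; split=> //; rewrite -mem_verts /= -ji mem_nth // size_verts.
  move=> [r' [i [rF ir e]]]; exists r', (index (val i) (verts r')).
  have iv : val i \in verts r' by rewrite mem_verts.
  split=> //; first by rewrite -size_verts index_mem.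
    by apply: set_code_lt; exact: rL.
  by exists i; rewrite nth_index.
apply: (@wp_for _ _ _ _ _ _ (fun J => Inv (fun r j => set_code r < J))) => //.
- by move=> st' fr; have C' := consts_frame fr isT isT C; rewrite /= (c_L C') (c_W C').
- split=> // r; rewrite /= /upd /= z; split=> // -[r' [j []]] //.
move=> c st1 cP f1 hc [I1 I2]; have C1 := consts_frame f1 isT isT C.
have mem : neval st1 (NGet 4 e_fam) = narr st 4 (c * L.+1 + t).
  by rewrite /= hc (c_L C1) (f1.1 20 isT) (f1.1 4 isT) ht addn1.
apply: wp_if => //=; rewrite -/(neval st1 (NGet 4 e_fam)) ?mem => T; last first.
  apply: wp_skip; first by rewrite addn_gt0 orbT.
  split=> // r; rewrite /= I1; split=> -[r' [j [rF jr D e]]]; exists r', j; split=> //.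
    by rewrite ltnS ltnW.
  move: D; rewrite ltnS leq_eqVlt => /orP[/eqP rc|//].
  by have := fam.2 r' rF; rewrite rc (negbTE T).
have [r rF cr] := fam.1 c cP T; have rLr := rL rF.
rewrite cr in hc.
apply: (wp_conseq (k := cfor #|r| 60)
  (P := Inv (fun r' j => set_code r' < c \/ (r' = r /\ j < #|r|)))).
- apply: (@wp_for _ _ _ _ _ _ (fun J => Inv (fun r' j => set_code r' < c \/ (r' = r /\ j < J)))) => //.
  + move=> st' fr; have C' := consts_frame fr isT isT C1.
    by rewrite (e_len_val C' rLr) // (fr.1 22 isT).
  + split=> // r1; rewrite /= I1; split=> -[r' [j [r'F jr D e]]]; exists r', j; split=> //.
      by left.
    by case: D => // -[].
  move=> j st2 jr f2 hj [J1 J2]; have C2 := consts_frame f2 isT isT C1.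
  have jL : j < L by apply: leq_trans jr rLr.
  have jL' : j <= L by exact: ltnW.
  have [i [vi _]] := nth_pos qs (Ordinal jr).
  have D1 := set_code_D1 jr vi.
  apply: wp_setN => //; split=> [r1|a aL] /=; rewrite /upd /= (f2.1 22 isT) hc hj
     (f2.1 20 isT) (f1.1 20 isT) ht (c_L C2) !addn1 !(c_W C2) // -D1.
    rewrite col_eq // eqxx andbT; case: eqVneq => [/set_code_inj e|ne]; split=> //.
    * move=> _; exists r, j; split=> //; first by right.
      by exists (val i); rewrite -vi.
    * move/J1 => [r' [j' [r'F jr' D e]]]; exists r', j'; split=> //.
      by case: D => [|[-> lt]]; [left | right; split => //; exact: ltnW].
    * move=> [r' [j' [r'F jr' D [i' [vi' e']]]]]; apply/J1; exists r', j'; split=> //; last by exists i'.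
      case: D => [|[rr]]; first by left.
      rewrite ltnS leq_eqVlt => /orP[/eqP jj|lt]; last by right.
      case/eqP: ne; rewrite e' rr; congr (set_code (_ :\ _)); apply/val_inj.
      by rewrite /= -vi' rr jj vi.
  case: eqVneq => [e|_]; last exact: J2.
  by rewrite e modnMDl modn_small // eqxx in aL.
- by rewrite leq_cfor.
move=> st2 f2 [J1 J2]; split=> // r1; rewrite /= J1; split=> -[r' [j [r'F jr D e]]]; exists r', j; split=> //.
  by case: D => [h|[-> _]]; rewrite ltnS; [exact: ltnW | rewrite cr].
move: D; rewrite ltnS leq_eqVlt => /orP[/eqP rc|]; last by left.
by right; split; [apply: set_code_inj; rewrite rc | rewrite -(_ : r' = r) //; apply: set_code_inj; rewrite rc].
Qed.

Definition avg_sq (est : nat -> R) r : R :=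
  (\sum_(e < Q ^ #|r|) ((\sum_(j < #|r|) est ((fcode qs #|r| (set_code r) e * p
      + nth 0 (verts r) j) * L + t)%N) / #|r|%:R) ^+ 2)%R.

Definition cAVERAGE := 20 + cfor QL (cFCODE L + (20 + (cfor L (40 + 40) + 60))).

Lemma wp_AVERAGE st r : consts st -> narr st 20 0 = t -> #|r| <= L ->
  narr st 22 0 = set_code r ->
  wp AVERAGE cAVERAGE (fun st' => rarr st' 6 0 = avg_sq (rarr st 1) r) st.
Proof.
move=> C ht rLr hc; apply: wp_seq; apply: wp_setR => // f1.
set st1 := setR _ _ _ _ in f1 *; have C1 := consts_frame f1 isT isT C.
pose T (e : nat) : R := (((\sum_(j < #|r|) rarr st 1 ((fcode qs #|r| (set_code r) e * p
      + nth 0 (verts r) j) * L + t)%N) / #|r|%:R) ^+ 2)%R.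
apply: (wp_conseq (k := cfor (Q ^ #|r|) (cFCODE L + (20 + (cfor L (40 + 40) + 60))))
  (P := fun st' => rarr st' 6 0 = (\sum_(e < Q ^ #|r|) T e)%R)) => //; last first.
  by rewrite leq_cfor ?letters_bound.
apply: (@wp_for _ _ _ _ _ _ (fun J st' => rarr st' 6 0 = (\sum_(e < J) T e)%R)) => //.
- move=> st' fr; have C' := consts_frame fr isT isT C1.
  by rewrite (e_lets_val C' rLr) // (fr.1 22 isT).
- by rewrite big_ord0.
move=> e st2 eQ f2 he IH; have C2 := consts_frame f2 isT isT C1.
have hc2 : narr st2 22 0 = set_code r by rewrite (f2.1 22 isT).
apply: wp_seq; apply: (wp_conseq (wp_FCODE C2 rLr hc2 he)) => // st3 f3 h3 _.
have C3 := consts_frame f3 isT isT C2.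
apply: wp_seq; apply: wp_setR => // f4; set st4 := setR _ _ _ _ in f4 *.
have C4 := consts_frame f4 isT isT C3.
pose E j := rarr st 1 ((fcode qs #|r| (set_code r) e * p + nth 0 (verts r) j) * L + t)%N.
apply: wp_seq; apply: (wp_conseq (k := cfor #|r| (40 + 40))
  (P := fun st' => rarr st' 7 0 = (\sum_(j < #|r|) E j)%R)).
- apply: (@wp_for _ _ _ _ _ _ (fun J st' => rarr st' 7 0 = (\sum_(j < J) E j)%R)) => //.
  + move=> st' fr; have C' := consts_frame fr isT isT C4.
    by rewrite (e_len_val C' rLr) // (fr.1 22 isT) (f4.1 22 isT) (f3.1 22 isT).
  + by rewrite big_ord0.
  move=> j st5 jr f5 hj IH5; have C5 := consts_frame f5 isT isT C4.
  have jL : j <= L by apply: leq_trans (ltnW jr) rLr.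
  have hc5 : narr st5 22 0 = set_code r by rewrite (f5.1 22 isT) (f4.1 22 isT) (f3.1 22 isT).
  apply: wp_seq; apply: wp_setN => //; set st6 := setN _ _ _ _ => f6.
  have C6 := consts_frame f6 isT isT C5.
  have hu6 : narr st6 24 0 = nth 0 (verts r) j.
    rewrite /st6 /= /upd /= hj hc5 (c_W C5) // (c_p C5) addn1.
    by have := set_code_digit r j; rewrite jr /digit => ->; rewrite subn1.
  apply: wp_setR => //; rewrite big_ord_recr -IH5 /E.
  rewrite -[LHS]/(rarr st6 7 0 + rarr st6 1 (neval st6 e_est))%R.
  rewrite (f6.2 7 isT) (f6.2 1 isT) (f5.2 1 isT) (f4.2 1 isT) (f3.2 1 isT) (f2.2 1 isT).
  congr (_ + _)%R; rewrite -[rarr st1 1]/(rarr st 1); congr (rarr st 1 _).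
  rewrite -[neval st6 e_est]/((narr st6 29 0 * narr st6 0 0 + narr st6 24 0) * narr st6 0 1 + narr st6 20 0).
  rewrite (c_p C6) (c_L C6) hu6 (f6.1 29 isT) (f5.1 29 isT) (f4.1 29 isT) h3.
  by rewrite (f6.1 20 isT) (f5.1 20 isT) (f4.1 20 isT) (f3.1 20 isT) (f2.1 20 isT) ht.
- by rewrite leq_cfor.
move=> st5 f5 h5 _; have C5 := consts_frame f5 isT isT C4.
apply: wp_setR => //.
have hc5 : narr st5 22 0 = set_code r by rewrite (f5.1 22 isT) (f4.1 22 isT) (f3.1 22 isT).
have el := e_len_val C5 rLr hc5.
rewrite -[LHS]/(rarr st5 6 0 + (rarr st5 7 0 / (neval st5 e_len)%:R) *
  (rarr st5 7 0 / (neval st5 e_len)%:R))%R.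
by rewrite big_ord_recr -IH h5 el /T expr2 (f5.2 6 isT) (f4.2 6 isT) (f3.2 6 isT).
Qed.

Definition kept (est : nat -> R) r : Prop :=
  marked r \/ ~~ (avg_sq est r < alpha * alpha / 4%:R)%R.

Definition cPRUNE := cfor (p.+1 ^ L) (100 + (100 + (cAVERAGE + (100 + 60)))).

Definition flags (a : nat) (st : store R) : Prop := forall r, 0 < narr st a (set_code r * L.+1 + t) <-> marked r.

Lemma mem_cell (st' : store R) c : consts st' -> narr st' 22 0 = c -> narr st' 20 0 = t ->
  neval st' e_fam = c * L.+1 + t.
Proof. by move=> C /= -> ->; rewrite (c_L C) addn1. Qed.

Lemma wp_PRUNE st : consts st -> narr st 20 0 = t -> t < L -> family st -> flags 12 st ->
  (forall x, narr st 4 (x * L.+1 + t.+1) = 0) ->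
  wp PRUNE cPRUNE (fun st' =>
    (forall c, 0 < narr st' 4 (c * L.+1 + t.+1) <->
       exists r, [/\ r \in F, c = set_code r & kept (rarr st 1) r]) /\
    (forall a, a %% L.+1 != t.+1 -> narr st' 4 a = narr st 4 a)) st.
Proof.
move=> C ht tL fam fl z.
pose Inv J (st' : store R) :=
    (forall c, 0 < narr st' 4 (c * L.+1 + t.+1) <->
       exists r, [/\ r \in F, c = set_code r, c < J & kept (rarr st 1) r]) /\
    (forall a, a %% L.+1 != t.+1 -> narr st' 4 a = narr st 4 a).
apply: (wp_conseq (k := cPRUNE) (P := Inv (p.+1 ^ L))) => //; last first.
  move=> st' _ [h1 h2]; split=> // c; rewrite h1; split=> [[r [rF cr _ kr]]|[r [rF cr kr]]].
    by exists r.
  by exists r; split=> //; rewrite cr; apply: set_code_lt; exact: rL.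
apply: (@wp_for _ _ _ _ _ _ Inv) => //.
- by move=> st' fr; have C' := consts_frame fr isT isT C; rewrite /= (c_L C') (c_W C').
- by split=> // c; rewrite /= /upd /= z; split=> // -[r []].
move=> c st1 cP f1 hc [I1 I2]; have C1 := consts_frame f1 isT isT C.
have ht1 : narr st1 20 0 = t by rewrite (f1.1 20 isT).
have ad := mem_cell C1 hc ht1.
have nt : (c * L.+1 + t) %% L.+1 != t.+1.
  by rewrite modnMDl modn_small ?ltnS ?(ltnW tL) // neq_ltn ltnSn.
have mem : neval st1 (NGet 4 e_fam) = narr st 4 (c * L.+1 + t) by rewrite -I2 // -ad.
have skip st' : narr st' 4 = narr st1 4 ->
    (forall r, r \in F -> c = set_code r -> ~ kept (rarr st 1) r) ->
    Inv c.+1 (setN st' 22 0 c.+1).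
  move=> e nk; split=> [c'|a aL]; rewrite /= /upd /= e ?I1 ?I2 //.
  split=> -[r [rF cr lt kr]]; exists r; split=> //; first exact: ltnW.
  move: lt; rewrite ltnS leq_eqVlt => /orP[/eqP cc|//].
  by case: (nk r rF _ kr); rewrite -cr.
have keep st' r : consts st' -> narr st' 4 = narr st1 4 -> narr st' 22 0 = c -> narr st' 20 0 = t ->
    r \in F -> c = set_code r -> kept (rarr st 1) r ->
    wp KEEP 60 (fun st'' => Inv c.+1 (setN st'' 22 0 c.+1)) st'.
  move=> C' e hc' ht' rF cr kr; apply: wp_setN => //.
  have ad' : neval st' (NAdd e_fam (NConst 1)) = c * L.+1 + t.+1.
    by rewrite -[LHS]/(neval st' e_fam + 1) (mem_cell C' hc' ht') -addnA addn1.
  rewrite ad'; split=> [c'|a aL]; rewrite /= /upd /= e.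
    rewrite col_eq // eqxx andbT; case: eqVneq => [->|ne]; first by split=> // _; exists r.
    rewrite I1; split=> -[r' [r'F cr' lt kr']]; exists r'; split=> //; first exact: ltnW.
    by move: lt; rewrite ltnS leq_eqVlt (negbTE ne).
  case: eqVneq => [aE|_]; last exact: I2.
  by rewrite aE modnMDl modn_small // eqxx in aL.
apply: wp_if => //; rewrite -[teval st1 e_member]/(0 < neval st1 (NGet 4 e_fam)) mem => T; last first.
  apply: wp_skip; first by rewrite !addnA addn_gt0 orbT.
  by apply: skip => // r rF cr; have := fam.2 r rF; rewrite -cr (negbTE T).
have [r rF cr] := fam.1 c cP T; have rLr := rL rF.
have f12 : neval st1 (NGet 12 e_fam) = narr st 12 (set_code r * L.+1 + t).
  by rewrite -cr -(f1.1 12 isT) -ad.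
apply: wp_if => //; rewrite -[teval st1 _]/(0 < neval st1 (NGet 12 e_fam)) f12 => M.
  apply: (wp_conseq (keep st1 r C1 _ hc ht1 rF cr _)) => //; first by left; apply/fl.
  by rewrite !addnA leq_addl.
have hcr : narr st1 22 0 = set_code r by rewrite hc.
apply: wp_seq; apply: (wp_conseq (wp_AVERAGE C1 ht1 rLr hcr)) => // st2 f2 av _.
have C2 := consts_frame f2 isT isT C1.
have T2 : teval st2 (RLess (rvar 6) e_threshold) = (avg_sq (rarr st 1) r < alpha * alpha / 4%:R)%R.
  rewrite -[LHS]/(rarr st2 6 0 < rarr st2 0 0 * rarr st2 0 0 / 4%:R)%R av (c_alpha C2).
  by rewrite (f1.2 1 isT).
apply: wp_if => //; rewrite T2 => T3.
  apply: wp_skip => //; apply: skip; first by rewrite (f2.1 4 isT).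
  move=> r' _ cr' [mk|]; last by rewrite -(set_code_inj (etrans (esym cr) cr')) T3.
  by case/negP: M; apply/fl; rewrite (set_code_inj (etrans (esym cr) cr')).
apply: (keep st2 r C2) => //; rewrite ?(f2.1 4 isT) ?(f2.1 22 isT) ?(f2.1 20 isT) //.
by right.
Qed.

Definition cOUTPUT := cfor (p.+1 ^ L) (100 + (100 + 60)).

Lemma wp_OUTPUT st : consts st -> narr st 20 0 = t -> t <= L -> family st -> flags 12 st ->
  (forall x, narr st 3 x = 0) ->
  wp OUTPUT cOUTPUT (fun st' =>
    forall c, 0 < narr st' 3 c <-> exists r, [/\ r \in F, c = set_code r & ~ marked r]) st.
Proof.
move=> C ht tL fam fl z.
pose Inv J (st' : store R) := forall c, 0 < narr st' 3 c <->
  exists r, [/\ r \in F, c = set_code r, c < J & ~ marked r].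
apply: (wp_conseq (k := cOUTPUT) (P := Inv (p.+1 ^ L))) => //; last first.
  move=> st' _ h1 c; rewrite h1; split=> [[r [rF cr _ kr]]|[r [rF cr kr]]].
    by exists r.
  by exists r; split=> //; rewrite cr; apply: set_code_lt; exact: rL.
apply: (@wp_for _ _ _ _ _ _ Inv) => //.
- by move=> st' fr; have C' := consts_frame fr isT isT C; rewrite /= (c_L C') (c_W C').
- by move=> c; rewrite /= /upd /= z; split=> // -[r []].
move=> c st1 cP f1 hc I1; have C1 := consts_frame f1 isT isT C.
have ht1 : narr st1 20 0 = t by rewrite (f1.1 20 isT).
have ad := mem_cell C1 hc ht1.
have mem : neval st1 (NGet 4 e_fam) = narr st 4 (c * L.+1 + t).
  by rewrite -(f1.1 4 isT) -ad.
have skip : (forall r, r \in F -> c = set_code r -> marked r) ->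
    Inv c.+1 (setN st1 22 0 c.+1).
  move=> nk c'; rewrite /= /upd /= I1.
  split=> -[r [rF cr lt kr]]; exists r; split=> //; first exact: ltnW.
  move: lt; rewrite ltnS leq_eqVlt => /orP[/eqP cc|//].
  by case: kr; apply: (nk r rF); rewrite -cr.
apply: wp_if => //; rewrite -[teval st1 e_member]/(0 < neval st1 (NGet 4 e_fam)) mem => T; last first.
  apply: wp_skip => //.
  by apply: skip => // r rF cr; have := fam.2 r rF; rewrite -cr (negbTE T).
have [r rF cr] := fam.1 c cP T.
have f12 : neval st1 (NGet 12 e_fam) = narr st 12 (set_code r * L.+1 + t).
  by rewrite -cr -(f1.1 12 isT) -ad.
apply: wp_if => //; rewrite -[teval st1 _]/(0 < neval st1 (NGet 12 e_fam)) f12 => M.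
  apply: wp_skip => //; apply: skip => r' _ cr'.
  by rewrite -(set_code_inj (etrans (esym cr) cr')); apply/fl.
apply: wp_setN => // c'; rewrite /= /upd /= hc; case: eqVneq => [->|ne].
  split=> // _; exists r; split=> // mk; by case/negP: M; apply/fl.
rewrite I1; split=> -[r' [r'F cr' lt kr']]; exists r'; split=> //; first exact: ltnW.
by move: lt; rewrite ltnS leq_eqVlt (negbTE ne).
Qed.

End Rounds.

Section Families.
Variables (p : nat).
Implicit Types (r c : {set 'I_p}) (F : {set {set 'I_p}}).

Definition downclosed F : Prop :=
  forall r (x : {set 'I_p}), r \in F -> x \subset r -> x != finset.set0 -> x \in F.

Lemma factor_sets_downclosed L : downclosed (factor_sets p L).
Proof.
move=> r x; rewrite !inE => /andP[_ rL] xr x0; rewrite card_gt0 x0.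
exact: leq_trans (subset_leq_card xr) rL.
Qed.

Lemma maximal_setsE F c : (c \in maximal_sets F) = (c \in F) && [forall r in F, ~~ (c \proper r)].
Proof.
rewrite inE; apply/maxsetP/andP => [[cF mx]|[cF /forallP mx]]; split=> //.
  apply/forallP => r; apply/implyP => rF; apply/negP => cr.
  by have := mx r rF (proper_sub cr) => rc; rewrite rc fintype.properxx in cr.
move=> r rF cr; apply/eqP; rewrite eq_sym; have /implyP/(_ rF) := mx r.
by rewrite finset.properEneq cr andbT negbK.
Qed.

(** A member strictly above [c] has an element [i] outside [c], and [i |: c] is a member by downward
    closure, which marks [c]. *)
Lemma markedE F c : downclosed F -> c \in F -> marked F c <-> c \notin maximal_sets F.
Proof.
move=> dF cF; rewrite maximal_setsE cF /= negb_forall; split.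
  move=> [r [i [rF ir ->]]]; apply/existsP; exists r.
  by rewrite negb_imply rF negbK properD1.
case/existsP => r; rewrite negb_imply negbK => /andP[rF /properP[cr [i ir ic]]].
exists (i |: c), i; split; last by rewrite finset.setU1K.
  apply: (dF r) => //; first by rewrite finset.subUset finset.sub1set ir.
  by apply/set0Pn; exists i; rewrite finset.setU11.
by rewrite finset.setU11.
Qed.

(** Only maximal sets are removed, and a maximal set contained in the member [r] is [r] itself,
    which was kept. *)
Lemma prune_downclosed F (D : pred {set 'I_p}) : downclosed F ->
  downclosed (F :\: [set c in maximal_sets F | D c]).
Proof.
move=> dF r x; rewrite !finset.in_setD => /andP[nr rF] xr x0; rewrite (dF r) // andbT.
move: nr; rewrite !inE -!/(x \in maximal_sets F); apply: contra => /andP[mx Dx].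
have /maxsetP[_ /(_ r rF xr) ->] := mx.
by rewrite mx.
Qed.

Lemma big_verts (R : pzRingType) (f : nat -> R) r :
  (\sum_(j < #|r|) f (nth 0%N (verts r) j) = \sum_(u in r) f u)%R.
Proof.
rewrite -(big_enum _ _ r (fun u : 'I_p => f u)) -(big_map val xpredT f) (big_nth 0%N).
by rewrite -/(verts r) size_verts big_mkord.
Qed.

End Families.

Definition ROUNDS : cmd :=
  CFor 20 sL (OPTIMIZE ;;; MARK ;;; PRUNE) ;;; MARK ;;; OUTPUT.

(** * The rounds form a run of the algorithm *)

Section Run.
Variables (R : realType) (p : nat) (qs : 'I_p -> nat) (L n K : nat).
Variables (w : {ffun 'I_n -> config qs}) (alpha gh eps : R).
Hypothesis qpos : forall i, 0 < qs i.
Local Notation Q := (\max_(j < p) qs j).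
Hypothesis Q0 : 0 < Q.
Hypotheses (n0 : 0 < n) (gh0 : (0 < gh)%R) (alpha0 : (0 < alpha)%R).
Local Notation QL := (Q ^ L).
Hypothesis QK : (0 < K -> QL ^ 2 <= K).
Local Notation consts := (consts L K w alpha gh).
Implicit Types (r : {set 'I_p}) (u : 'I_p).
Local Notation fs := (factor_sets p L).
Hypothesis min : forall (F : {set {set 'I_p}}) u (X : param R qs), F \subset fs ->
  fw_inv L w gh K u F K X -> eps_minimizer L w gh eps F u (curp K X).

Lemma avg_sqE t (est : nat -> R) (th : 'I_p -> param R qs) r :
  (forall u (s : letters qs r), est ((factor_code s * p + u) * L + t)%N = th u r s) ->
  (forall u e, e < Q ^ #|r| -> ~~ lvalid qs r e -> est (est_addr qs L t u r e) = 0%R) ->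
  avg_sq qs L t est r = (\sum_s (theta_avg th (r := r) s) ^+ 2)%R.
Proof.
move=> h z; rewrite /avg_sq.
pose g e := (((\sum_(u in r) est (est_addr qs L t u r e)) / #|r|%:R) ^+ 2)%R.
rewrite (eq_bigr (fun e : 'I__ => g e)); last first.
  move=> e _; rewrite /g -(big_verts (fun v => est (est_addr qs L t v r e))).
  by [].
rewrite -(sum_lcode qpos (r := r) (g := g)); last first.
  move=> e eQ ve; rewrite /g big1 ?mul0r ?expr0n // => u _; exact: z.
apply: eq_bigr => s _; rewrite /g /theta_avg mulrC; congr ((_ * _) ^+ 2)%R.
by apply: eq_bigr => u _; rewrite -h /est_addr fcode_lcode.
Qed.

Definition pruned F (th : 'I_p -> param R qs) : {set {set 'I_p}} :=
  F :\: [set c in maximal_sets F | (l2norm (theta_avg th (r := c)) < alpha / 2)%R].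

Lemma keptE t F (est : nat -> R) th r : downclosed F -> r \in F ->
  (forall u r (s : letters qs r), est ((factor_code s * p + u) * L + t)%N = th u r s) ->
  (forall u r e, e < Q ^ #|r| -> ~~ lvalid qs r e -> est (est_addr qs L t u r e) = 0%R) ->
  kept qs L alpha F t est r <-> r \in pruned F th.
Proof.
move=> dF rF h z; rewrite /kept (avg_sqE (fun u s => h u r s) (fun u e => @z u r e)).
rewrite finset.in_setD rF andbT inE negb_and l2norm_lt ?divr_gt0 //.
rewrite expr_div_n -natrX -[(2 ^ 2)%N]/4 -expr2 (markedE dF rF).
by split=> [[->|->]//|/orP[|]]; rewrite ?orbT //; [left | right].
Qed.

Lemma modn_col b x t : t < b -> (x * b + t) %% b = t.
Proof. by move=> tb; rewrite modnMDl modn_small. Qed.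

(** Each round owns a column of natural arrays 4 and 12 and of real array 1. Future columns must
    still be zero, since the program only sets flags and adds to estimates. *)
Definition round_inv J (st : store R) : Prop :=
  [/\ consts st, narr st 20 0 = J,
    exists (Fs : nat -> {set {set 'I_p}}) (th : nat -> 'I_p -> param R qs),
     [/\ Fs 0 = fs,
         forall t, t <= J -> [/\ Fs t \subset fs, downclosed (Fs t) & family L (Fs t) t st] &
         forall t, t < J -> [/\ forall u, eps_minimizer L w gh eps (Fs t) u (th t u),
           Fs t.+1 = pruned (Fs t) (th t) &
           forall u r (s : letters qs r),
             rarr st 1 ((factor_code s * p + u) * L + t)%N = th t u r s]] &
    [/\ forall t x, J < t <= L -> narr st 4 (x * L.+1 + t) = 0,
        forall t x, J <= t <= L -> narr st 12 (x * L.+1 + t) = 0 &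
        forall t x, J <= t < L -> rarr st 1 (x * L + t) = 0%R]].

Lemma family_eq (F : {set {set 'I_p}}) t (st st' : store R) :
  (forall x, narr st' 4 (x * L.+1 + t) = narr st 4 (x * L.+1 + t)) ->
  family L F t st -> family L F t st'.
Proof. by move=> e [h1 h2]; split=> [c cW|r rF]; rewrite e; [exact: h1 | exact: h2]. Qed.

Definition cROUND := cOPT qs L n K + (cMARK p L + cPRUNE qs L).

Lemma wp_ROUND J st : J < L -> round_inv J st ->
  wp (OPTIMIZE ;;; MARK ;;; PRUNE) cROUND (fun st' => round_inv J.+1 (setN st' 20 0 J.+1)) st.
Proof.
move=> JL [C hJ [Fs [th [F0 hF hth]]] [z4 z12 z1]].
have [FF dF fam] := hF J (leqnn J).
have JLL : J <= L by exact: ltnW.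
apply: wp_seq; apply: (wp_conseq (wp_OPTIMIZE qpos Q0 n0 gh0 QK FF JL C hJ fam _)) => //.
  by move=> x; apply: z1; rewrite leqnn.
move=> st1 f1 [[X hX] [inval frz]] _; have C1 := consts_frame f1 isT isT C.
have hJ1 : narr st1 20 0 = J by rewrite (f1.1 20 isT).
have fam1 : family L (Fs J) J st1 by apply: family_eq fam => x; rewrite (f1.1 4 isT).
apply: wp_seq; apply: (wp_conseq (wp_MARK FF C1 hJ1 JLL fam1 _)) => //.
  by move=> x; rewrite (f1.1 12 isT) z12 ?leqnn.
move=> st2 f2 [mk m12] _; have C2 := consts_frame f2 isT isT C1.
have hJ2 : narr st2 20 0 = J by rewrite (f2.1 20 isT).
have fam2 : family L (Fs J) J st2 by apply: family_eq fam1 => x; rewrite (f2.1 4 isT).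
apply: (wp_conseq (wp_PRUNE Q0 FF C2 hJ2 JL fam2 mk _)) => //.
  by move=> x; rewrite (f2.1 4 isT) (f1.1 4 isT) z4 // ltnSn.
move=> st3 f3 [pr p4].
pose thJ u : param R qs := curp K (X u).
pose Fs' t := if t == J.+1 then pruned (Fs J) thJ else Fs t.
pose th' t := if t == J then thJ else th t.
have FsE t : t <= J -> Fs' t = Fs t by move=> tJ; rewrite /Fs' ltn_eqF.
have thE t : t < J -> th' t = th t by move=> tJ; rewrite /th' ltn_eqF.
have estJ u r (s : letters qs r) : rarr st1 1 ((factor_code s * p + u) * L + J)%N = thJ u r s.
  by have [_ _ ->] := hX u.
have r1 : rarr (setN st3 20 0 J.+1) 1 = rarr st1 1 by rewrite -[LHS]/(rarr st3 1) (f3.2 1 isT) (f2.2 1 isT).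
have n12 : narr (setN st3 20 0 J.+1) 12 = narr st2 12 by rewrite -[LHS]/(narr st3 12) (f3.1 12 isT).
have n4 x t : t <= L -> t != J.+1 ->
    narr (setN st3 20 0 J.+1) 4 (x * L.+1 + t) = narr st 4 (x * L.+1 + t).
  move=> tL tJ; rewrite -[LHS]/(narr st3 4 (x * L.+1 + t)) p4 ?modn_col //.
  by rewrite (f2.1 4 isT) (f1.1 4 isT).
split; first by apply: (consts_frame (c := CSetN 20 (NConst 0) (NConst 0)) _ isT isT
  (consts_frame f3 isT isT C2)); apply: frame_setN; exact: mem_head.
- by rewrite /= /upd /=.
- exists Fs', th'; split.
  + by rewrite FsE.
  + move=> t; rewrite leq_eqVlt => /orP[/eqP ->|]; last first.
      rewrite ltnS => tJ; have [h1 h2 h3] := hF t tJ; rewrite FsE //; split=> //.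
      apply: family_eq h3 => x; apply: n4; first exact: leq_trans tJ JLL.
      by rewrite ltn_eqF.
    rewrite /Fs' eqxx; split.
    * by apply: fintype.subset_trans FF; rewrite finset.subsetDl.
    * exact: prune_downclosed.
    split=> [c _|r rF]; rewrite -[narr _ 4]/(narr st3 4) pr.
      move=> [r [rF cr kr]]; exists r => //; move: kr; rewrite (f2.2 1 isT).
      by move/(keptE dF rF estJ inval).
    have rFJ : r \in Fs J by move: rF; rewrite finset.in_setD => /andP[].
    by exists r; split=> //; rewrite (f2.2 1 isT); apply/(keptE dF rFJ estJ inval).
  move=> t; rewrite ltnS leq_eqVlt => /orP[/eqP ->|tJ].
    rewrite FsE // /Fs' /th' !eqxx; split=> //; last by move=> u r s; rewrite r1 estJ.
    by move=> u; have [fw _ _] := hX u; apply: min.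
  have [h1 h2 h3] := hth t tJ; rewrite thE // !FsE //; last exact: ltnW.
  split=> // u r s; rewrite r1 frz ?h3 // modn_col; first by rewrite ltn_eqF.
  exact: ltn_trans tJ JL.
- split=> t x /andP[Jt tL].
  + rewrite n4 //; last by rewrite gtn_eqF.
    by apply: z4; rewrite tL (ltn_trans _ Jt).
  + rewrite n12 m12; first by rewrite (f1.1 12 isT) z12 // tL ltnW.
    by rewrite modn_col // gtn_eqF.
  + rewrite r1 frz; first by rewrite z1 // tL ltnW.
    by rewrite modn_col // gtn_eqF.
Qed.

Definition cROUNDS := cfor L cROUND + (cMARK p L + cOUTPUT p L).

Lemma wp_ROUNDS st : consts st ->
  (forall x, narr st 3 x = 0) ->
  (forall t x, 0 < t <= L -> narr st 4 (x * L.+1 + t) = 0) ->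
  (forall x, narr st 12 x = 0) -> (forall x, rarr st 1 x = 0%R) ->
  family L fs 0 st ->
  wp ROUNDS cROUNDS (fun st' => suprise_run L w alpha gh eps
      (decode_families p L st') (decode_estimates L st') (decode_output p L st')) st.
Proof.
move=> C z3 z4 z12 z1 fam0.
apply: wp_seq; apply: (wp_conseq (k := cfor L cROUND) (P := round_inv L)) => //.
  apply: (@wp_for _ _ _ _ _ _ round_inv) => //.
  - by move=> st' fr; exact: c_L (consts_frame fr isT isT C).
  - split=> //; last by split=> [t x h|t x _|t x _]; [exact: z4 | exact: z12 | exact: z1].
      by apply: (consts_frame (c := CSetN 20 (NConst 0) (NConst 0)) _ isT isT C);
         apply: frame_setN; exact: mem_head.
    exists (fun=> fs), (fun _ _ _ _ => 0%R); split=> // t; rewrite leqn0 => /eqP ->.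
    by split=> //; exact: factor_sets_downclosed.
  by move=> j st' jL _ _ inv; exact: wp_ROUND.
move=> st1 f1 [C1 h1 [Fs [th [F0 hF hth]]] [_ z12' _]] _.
have [FF dF fam] := hF L (leqnn L).
apply: wp_seq; apply: (wp_conseq (wp_MARK FF C1 h1 (leqnn L) fam _)) => //.
  by move=> x; rewrite z12' ?leqnn.
move=> st2 f2 [mk _] _; have C2 := consts_frame f2 isT isT C1.
have fam2 : family L (Fs L) L st2 by apply: family_eq fam => x; rewrite (f2.1 4 isT).
apply: (wp_conseq (wp_OUTPUT FF C2 _ (leqnn L) fam2 mk _)) => //.
- by rewrite (f2.1 20 isT).
- by move=> x; rewrite (f2.1 3 isT) (f1.1 3 isT).
move=> st3 f3 h3.
have dfE t : t <= L -> decode_families p L st3 t = Fs t.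
  move=> tL; have [FFt _ [a1 a2]] := hF t tL; apply/setP => c; rewrite inE.
  rewrite (f3.1 4 isT) (f2.1 4 isT) -lt0n; apply/andP/idP => [[cF]|cF].
    have cW : set_code c < p.+1 ^ L by apply: set_code_lt; move: cF; rewrite inE => /andP[].
    by move/(a1 _ cW) => [r rF /set_code_inj ->].
  by rewrite (fintype.subsetP FFt) // a2.
have deE t : t < L -> decode_estimates L st3 t = th t.
  move=> tL; have [_ _ h] := hth t tL; apply: funext => u.
  apply: functional_extensionality_dep => r; apply: funext => s.
  by rewrite /decode_estimates (f3.2 1 isT) (f2.2 1 isT) h.
split.
- by rewrite dfE.
- by move=> t tL u; rewrite dfE ?deE //; [have [h _ _] := hth t tL; exact: h | exact: ltnW].
- move=> t tL; rewrite !dfE ?deE //; last exact: ltnW.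
  by have [_ -> _] := hth t tL.
rewrite dfE //; apply/setP => c; rewrite inE -lt0n; apply/andP/idP => [[_ /h3]|cm].
  move=> [r [rF /set_code_inj -> nm]]; rewrite -[_ \in _]negbK; apply/negP.
  by move/(markedE dF rF).
have cF : c \in Fs L by move: cm; rewrite maximal_setsE => /andP[].
split; first exact: (fintype.subsetP FF).
by apply/h3; exists c; split=> // /(markedE dF cF); rewrite cm.
Qed.

End Run.

Lemma nth_allpairs_pair (S T : Type) (f : S -> T -> nat) x0 y0 s t i j :
  i < size s -> j < size t ->
  nth 0 [seq f x y | x <- s, y <- t] (i * size t + j) = f (nth x0 s i) (nth y0 t j).
Proof.
elim: s i => [//|x s IH] [|i] /= is_ jt; rewrite nth_cat size_map.
  by rewrite mul0n add0n jt (nth_map y0).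
by rewrite mulSn -addnA ltnNge leq_addr /= addKn IH.
Qed.

Lemma set_code_lt_card p L (r : {set 'I_p}) : set_code r < p.+1 ^ L -> #|r| <= L.
Proof.
move=> rL; rewrite leqNgt; apply/negP => lt.
by have := set_code_digit r L; rewrite lt /digit divn_small.
Qed.

Lemma set_code_gt0 p (r : {set 'I_p}) : 0 < set_code r -> 0 < p.
Proof.
rewrite lt0n set_code_eq0 => /finset.set0Pn [i _].
exact: leq_ltn_trans (leq0n i) (ltn_ord i).
Qed.

Section WhilePow.
Variable R : realType.
Implicit Types (st : store R).

Lemma frame_seq c1 c2 st st1 st2 : frame c1 st st1 -> frame c2 st1 st2 ->
  frame (CSeq c1 c2) st st2.
Proof.
move=> [n1 r1] [n2 r2]; split=> a; rewrite /= mem_cat negb_or => /andP[h1 h2].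
  by rewrite n2 // n1.
by rewrite r2 // r1.
Qed.

(** Termination is part of the step: whenever the test succeeds after [j] passes, [j < N] must
    follow. *)
Lemma wp_while b c k N (Inv : nat -> store R -> Prop) st : tcost b <= 99 ->
  (forall j st', frame c st st' -> Inv j st' -> teval st' b ->
     j < N /\ wp c k (Inv j.+1) st') ->
  Inv 0 st ->
  wp (CWhile b c) (N * (k + 100) + 100)
    (fun st' => ~~ teval st' b /\ exists2 j, j <= N & Inv j st') st.
Proof.
move=> cb step I0.
have loop m j st' : N - j = m -> j <= N -> frame c st st' -> Inv j st' ->
    wp (CWhile b c) (m * (k + 100) + 100)
      (fun st' => ~~ teval st' b /\ exists2 j, j <= N & Inv j st') st'.
  elim: m j st' => [|m IH] j st' mE jN fst Ij; have [T|T] := boolP (teval st' b).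
  - have [lt _] := step j st' fst Ij T.
    by move: lt; rewrite -subn_gt0 mE.
  - exists st', (tcost b).+1; split; first exact: ExecWhileFalse.
      by rewrite add0n ltnS.
    by split=> //; exists j.
  - have [lt [st1 [k1 [ex1 le1 I1]]]] := step j st' fst Ij T.
    have m1 : N - j.+1 = m by rewrite subnS mE.
    have [st2 [k2 [ex2 le2 h2]]] := IH j.+1 st1 m1 lt (frame_trans fst (exec_frame ex1)) I1.
    exists st2, (tcost b + k1 + k2).+1; split=> //; first exact: ExecWhileTrue T ex1 ex2.
    rewrite mulSn; move: (m * (k + 100)) le2 le1 cb => x; clear; lia.
  - exists st', (tcost b).+1; split; first exact: ExecWhileFalse.
      by rewrite (leq_trans _ (leq_addl _ _)).
    by split=> //; exists j.
exact: loop N 0 st (subn0 N) (leq0n N) (frame_refl c st) I0.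
Qed.

(** A table of powers, with which extracting a digit takes a bounded number of operations. *)
Definition POW (a : nat) (bound base : nexp) : cmd :=
  CSetN a (NConst 0) (NConst 1) ;;;
  CFor 23 bound
    (CSetN a (NAdd (nvar 23) (NConst 1)) (NMul (NGet a (nvar 23)) base)).

Lemma wp_POW a bound base N b st : a != 23 -> ncost bound <= 40 -> ncost base <= 40 ->
  (forall st', frame (POW a bound base) st st' -> neval st' bound = N) ->
  (forall st', frame (POW a bound base) st st' -> neval st' base = b) ->
  wp (POW a bound base) (10 + cfor N 60) (fun st' => forall j, j <= N -> narr st' a j = b ^ j) st.
Proof.
move=> a23 cb cb' hN hb; apply: wp_seq; apply: wp_setN => // f1.
apply: (@wp_for _ _ _ _ _ _ (fun J st' => forall j, j <= J -> narr st' a j = b ^ j)) => //.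
- by rewrite inE eq_sym.
- by move=> st' f2; apply: hN; exact: frame_seq f1 f2.
- by move=> j; rewrite leqn0 => /eqP ->; rewrite /= /upd eqxx /= (negbTE a23) /= eqxx.
move=> j st1 jN f2 hj IH; apply: wp_setN => /=.
  by move: cb'; clear; lia.
move=> i; rewrite leq_eqVlt ltnS => ij; rewrite /= /upd (negbTE a23) /= eqxx hj addn1.
rewrite (hb _ (frame_seq f1 f2)) IH // -expnSr.
case: eqVneq ij => [->//|ne /= ij]; exact: IH.
Qed.

End WhilePow.

Definition QMAX : cmd :=
  CFor 23 sP (CIf (NLess sQ (NGet 1 (nvar 23))) (set0N 5 (NGet 1 (nvar 23))) CSkip).

(* Positive exactly when the positive number [nvar 22] is the code of a set. *)
Definition e_valid : nexp :=
  let c' := NDiv (nvar 22) sP1 in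
  NMul (NMul (nvar 22) (NMul (NGet 8 c') (NMod (nvar 22) sP1)))
    (NAdd (NSub (NConst 1) c') (NSub (NMod c' sP1) (NMod (nvar 22) sP1))).

(** Codes are treated in increasing order, so the entry of the quotient by [p + 1] is final when it
    is read. The recursion of [set_code_rec] starts at 0, the code of the empty set, which is
    flagged by hand. *)
Definition CODES : cmd :=
  CSetN 8 (NConst 0) (NConst 1) ;;;
  CFor 22 (NGet 6 sL)
    (CIf (NLess (NConst 0) e_valid)
      (CSetN 8 (nvar 22) (NConst 1) ;;;
       CSetN 9 (nvar 22) (NAdd (NGet 9 (NDiv (nvar 22) sP1)) (NConst 1)) ;;;
       CSetN 4 (NMul (nvar 22) (NAdd sL (NConst 1))) (NConst 1))
      CSkip).

Definition e_precision : rexp :=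
  let gh := RGet 0 (NConst 1) in
  RAdd (RMul (RMul (ROfNat (NConst 16)) (RMul gh gh)) (RExp (RMul (ROfNat (NConst 3)) gh)))
       (RMul (RMul (RMul (ROfNat (NConst 2)) gh) (RExp gh))
             (ROfNat (NMul (NGet 7 sL) (NGet 7 sL)))).

(** The machine cannot round a real to a natural, so the number of steps is found by counting up.
    The start is the lower bound on [K] demanded by [atom_cover]; at tolerance zero [K] stays 0. *)
Definition NSTEPS : cmd :=
  CIf (RLess (ROfNat (NConst 0)) (RGet 0 (NConst 2)))
    (set0N 10 (NMul (NGet 7 sL) (NGet 7 sL)) ;;;
     set0R 7 e_precision ;;;
     CWhile (RLess (RMul (ROfNat (nvar 10)) (RGet 0 (NConst 2))) (rvar 7))
       (set0N 10 (NAdd (nvar 10) (NConst 1))))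
    CSkip.

Definition SETUP : cmd :=
  QMAX ;;; POW 6 sL sP1 ;;; POW 7 sL sQ ;;; CODES ;;; NSTEPS ;;;
  POW 11 (NGet 7 sL) sB ;;;
  set0R 8 (RDiv (RGet 0 (NConst 1)) (ROfNat (nvar 10))).

(** * Correctness of the initialization *)

Section Setup.
Variables (R : realType) (p : nat) (qs : 'I_p -> nat) (L n : nat).
Variables (w : {ffun 'I_n -> config qs}) (alpha gh eps : R).
Local Notation Q := (\max_(j < p) qs j).
Local Notation QL := (Q ^ L).
Implicit Types (r : {set 'I_p}) (u : 'I_p) (st : store R).
Local Notation st0 := (suprise_input L w alpha gh eps).

Record inputs st : Prop := Inputs {
  i_n : forall a, a <= 2 -> narr st a = narr st0 a;
  i_r : rarr st 0 = rarr st0 0 }.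

Lemma inputs_frame c st st' : frame c st st' -> all [predC nwr c] [:: 0; 1; 2] ->
  0 \notin rwr c -> inputs st -> inputs st'.
Proof.
move=> [fn fr] /allP hn hr [h1 h2]; split; last by rewrite fr.
by move=> a a2; rewrite fn ?h1 //; apply: hn; case: a a2 => [|[|[]]].
Qed.

Lemma i_p st : inputs st -> narr st 0 0 = p. Proof. by move=> h; rewrite (i_n h). Qed.
Lemma i_L st : inputs st -> narr st 0 1 = L. Proof. by move=> h; rewrite (i_n h). Qed.

Lemma inputs_w (m : 'I_n) (i : 'I_p) : narr st0 2 (m * p + i) = w m i.
Proof.
have := @nth_allpairs_pair _ _ (fun m i => nat_of_ord (w m i)) m i (enum 'I_n) (enum 'I_p) m i.
by rewrite !size_enum_ord !ltn_ord !nth_ord_enum => h; exact: h.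
Qed.

Lemma wp_QMAX st : inputs st -> narr st 5 0 = 0 ->
  wp QMAX (cfor p (100 + 20)) (fun st' => narr st' 5 0 = Q) st.
Proof.
move=> C z; apply: (wp_conseq (k := cfor p (100 + 20))
  (P := fun st' => narr st' 5 0 = \max_(j < p) qn qs j)) => //; last first.
  by move=> st' _ ->; apply: eq_bigr => i _; rewrite qnE.
apply: (@wp_for _ _ _ _ _ _ (fun J st' => narr st' 5 0 = \max_(j < J) qn qs j)) => //.
- by move=> st' f; rewrite /= (i_p (inputs_frame f isT isT C)).
- by rewrite big_ord0.
move=> j st1 jp f hj IH; have C1 := inputs_frame f isT isT C.
have e1 : narr st1 1 = qn qs by rewrite (i_n C1).
apply: wp_if => //=; rewrite hj e1 IH => T.
  apply: wp_setN => //=; rewrite /upd /= hj e1 big_ord_recr /=; apply/esym/maxn_idPr; exact: ltnW.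
apply: wp_skip => //=; rewrite /upd /= IH big_ord_recr /=; apply/esym/maxn_idPl.
by rewrite leqNgt.
Qed.

Lemma wp_CODES st : inputs st -> narr st 6 L = p.+1 ^ L ->
  (forall x, narr st 4 x = 0) -> (forall x, narr st 8 x = 0) -> (forall x, narr st 9 x = 0) ->
  wp CODES (10 + cfor (p.+1 ^ L) (100 + (20 + (40 + 40)))) (fun st' =>
    [/\ forall r, #|r| <= L -> narr st' 9 (set_code r) = #|r|,
        family L (factor_sets p L) 0 st' &
        forall a, a %% L.+1 != 0 -> narr st' 4 a = 0]) st.
Proof.
move=> C hW z4 z8 z9; apply: wp_seq; apply: wp_setN => // f1.
have C1 := inputs_frame f1 isT isT C.
pose Inv J (st' : store R) :=
  [/\ forall c, 0 < narr st' 8 c <-> c = 0 \/ c < J /\ exists r, set_code r = c,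
      forall r, (set_code r < J) || (set_code r == 0) -> narr st' 9 (set_code r) = #|r|,
      forall c, 0 < narr st' 4 (c * L.+1) <-> [/\ 0 < c, c < J & exists r, set_code r = c] &
      forall a, a %% L.+1 != 0 -> narr st' 4 a = 0].
apply: (wp_conseq (k := cfor (p.+1 ^ L) (100 + (20 + (40 + 40)))) (P := Inv (p.+1 ^ L))) => //; last first.
  move=> st' _ [_ h9 h4 h4']; split=> //.
    by move=> r rL; apply: h9; rewrite set_code_lt.
  split=> [c cW|r]; rewrite addn0 h4.
    move=> [c0 _ [r rc]]; exists r => //; rewrite inE set_code_lt_card ?rc // andbT card_gt0.
    by rewrite -set_code_eq0 rc -lt0n.
  rewrite inE => /andP[r0 rL]; split; [|exact: set_code_lt|by exists r].
  by rewrite lt0n set_code_eq0 -card_gt0.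
apply: (@wp_for _ _ _ _ _ _ Inv) => //.
- move=> st' f; have C' := inputs_frame f isT isT C1.
  by rewrite /= (i_L C') (f.1 6 isT) (f1.1 6 isT).
- split=> [c|r|c|a _]; rewrite /= /upd /= ?z4 ?z9 //.
  + case: eqVneq => [->|c0]; first by split=> // _; left.
    by rewrite z8; split=> // -[e|[]//]; rewrite e in c0.
  + by rewrite set_code_eq0 => /eqP ->; rewrite cards0.
  + by split=> // -[].
move=> c st1 cW f2 hc [I8 I9 I4 I4']; have C2 := inputs_frame f2 isT isT C1.
have vE : neval st1 e_valid = c * (narr st1 8 (c %/ p.+1) * (c %% p.+1)) *
    (1 - c %/ p.+1 + ((c %/ p.+1) %% p.+1 - c %% p.+1)).
  by rewrite /= hc (i_p C2) !addn1.
have vP : 0 < neval st1 e_valid <-> 0 < c /\ exists r, set_code r = c.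
  rewrite vE !muln_gt0 addn_gt0 !subn_gt0 ltnS leqn0; split.
    move=> /andP[/andP[c0 /andP[v m]] o]; split=> //; apply/set_code_rec => //; split=> //.
    by move/I8: v => [->|[]//]; exists finset.set0; exact: set_code0.
  move=> [c0 /(set_code_rec _ c0) [[r rc] -> ->]]; rewrite c0 !andbT /=.
  apply/I8; case: (eqVneq (c %/ p.+1) 0) => [|ne]; [by left | right].
  split; last by exists r.
  by rewrite ltn_Pdiv // ltnS (set_code_gt0 (r := r)) // rc lt0n.
apply: wp_if => //; rewrite -[teval st1 _]/(0 < neval st1 e_valid) => T; last first.
  apply: wp_skip => //; have nc : c = 0 \/ ~ exists r, set_code r = c.
    have [->|c0] := posnP c; [by left | right => h].
    by case/negP: T; apply/vP.
  split=> [c'|r|c'|a aL] /=; rewrite /upd /=.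
  + rewrite I8 ltnS; split=> [[->|[lt h]]|[->|[le h]]]; [by left| |by left|].
      by right; split=> //; exact: ltnW.
    move: le; rewrite leq_eqVlt => /orP[/eqP cc|lt]; last by right.
    by left; case: nc => [<-//|[]]; rewrite -cc.
  + rewrite ltnS leq_eqVlt => h; apply: I9; move: h => /orP[/orP[/eqP cc|->]|->]; rewrite ?orbT //.
    by case: nc => [c0|[]]; [rewrite cc c0 eqxx orbT | exists r].
  + rewrite I4 ltnS; split=> -[c0 le h]; split=> //; first exact: ltnW.
    move: le; rewrite leq_eqVlt => /orP[/eqP cc|//].
    by case: nc => [c00|[]]; [rewrite cc c00 in c0 | rewrite -cc].
  + exact: I4'.
have [c0 [r rc]] := (iffLR vP) T.
have r0 : r != finset.set0 by rewrite -set_code_eq0 rc -lt0n.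
have [[r' r'c] _ _] := (iffLR (set_code_rec p c0)) (ex_intro _ r rc).
have cr : #|r| = #|r'|.+1 by apply: card_set_code => //; rewrite rc r'c.
have lt' : set_code r' < c.
  by rewrite r'c ltn_Pdiv // ltnS (set_code_gt0 (r := r)) // rc.
apply: wp_seq; apply: wp_setN => //; set st2 := setN _ _ _ _ => f3.
apply: wp_seq; apply: wp_setN => //; set st3 := setN _ _ _ _ => f4.
have s2 : st2 = setN st1 8 c 1 by rewrite /st2 /= hc.
have e22 : neval st2 (nvar 22) = c by rewrite s2.
have e9 : neval st2 (NAdd (NGet 9 (NDiv (nvar 22) sP1)) (NConst 1)) = #|r|.
  by rewrite s2 /= /upd /= hc (i_p C2) [p + 1]addn1 -r'c I9 ?lt' // cr addn1.
have s4 : st3 = setN st2 9 c #|r| by rewrite /st3 e22 e9.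
apply: wp_setN => //.
have -> : neval st3 (NMul (nvar 22) (NAdd sL (NConst 1))) = c * L.+1.
  by rewrite s4 s2 /= /upd /= hc (i_L C2) addn1.
rewrite s4 s2; split=> [c'|r1|c'|a aL] /=; rewrite /upd /=.
- case: eqVneq => [->|ne]; first by split=> // _; right; split=> //; exists r.
  by rewrite I8 [c' < c.+1]ltnS [c' <= c]leq_eqVlt (negbTE ne).
- case: (eqVneq (set_code r1) c) => [cc _|ne]; first by rewrite (set_code_inj (etrans cc (esym rc))).
  by rewrite ltnS leq_eqVlt (negbTE ne) /=; exact: I9.
- rewrite eqn_pmul2r //; case: eqVneq => [->|ne]; first by split=> // _; split=> //; exists r.
  by rewrite I4 [c' < c.+1]ltnS [c' <= c]leq_eqVlt (negbTE ne).
- case: eqVneq => [ac|_]; last exact: I4'.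
  by rewrite ac modnMl in aL.
Qed.

Definition precision : R :=
  (16 * gh ^+ 2 * expR (3 * gh) + 2 * gh * expR gh * ((Q ^ L) ^ 2)%:R)%R.

Variable N : nat.
Hypothesis precN : (0 < eps -> precision <= N%:R * eps)%R.

Definition steps_ok K : Prop :=
  if (0 < eps)%R then [/\ QL ^ 2 <= K, K <= QL ^ 2 + N & (precision <= K%:R * eps)%R] else K = 0.

Definition cNSTEPS := 100 + (20 + (90 + (N * (20 + 100) + 100))).

Lemma wp_NSTEPS st : inputs st -> narr st 7 L = QL -> narr st 10 0 = 0 ->
  wp NSTEPS cNSTEPS (fun st' => steps_ok (narr st' 10 0)) st.
Proof.
move=> C h7 z10; have er : rarr st 0 2 = eps by rewrite (i_r C).
apply: wp_if => //; rewrite -[teval st _]/(0 < rarr st 0 2)%R er => T; last first.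
  by apply: wp_skip; rewrite ?z10 /steps_ok ?(negbTE T) // addn_gt0.
apply: wp_seq; apply: wp_setN => // f1; set st1 := setN _ _ _ _ in f1 *.
have C1 := inputs_frame f1 isT isT C.
have h10 : narr st1 10 0 = QL ^ 2 by rewrite /st1 /= /upd /= (i_L C) h7.
apply: wp_seq; apply: wp_setR => // f2; set st2 := setR _ _ _ _ in f2 *.
have C2 := inputs_frame f2 isT isT C1.
have h7r : rarr st2 7 0 = precision.
  rewrite -[LHS]/(16%:R * (rarr st 0 1 * rarr st 0 1) * expR (3%:R * rarr st 0 1) +
    2%:R * rarr st 0 1 * expR (rarr st 0 1) * (narr st 7 (narr st 0 1) * narr st 7 (narr st 0 1))%:R)%R.
  by rewrite (i_r C) (i_L C) h7 /precision expr2 mulnn.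
apply: (wp_conseq (@wp_while _ _ _ 20 N (fun j st' => narr st' 10 0 = QL ^ 2 + j) st2 _ _ _)) => //.
- move=> j st3 f3 h; have C3 := inputs_frame f3 isT isT C2.
  rewrite -[teval _ _]/((narr st3 10 0)%:R * rarr st3 0 2 < rarr st3 7 0)%R.
  rewrite (f3.2 7 isT) h7r h (i_r C3) => lt; split.
    have := lt_le_trans lt (precN T); rewrite -[rarr st0 0 2]/eps ltr_pM2r // ltr_nat.
    exact: leq_ltn_trans (leq_addl _ _).
  by apply: wp_setN => //; rewrite /= /upd /= h addn1 addnS.
- by rewrite addn0.
move=> st3 f3 [nT [j jN h]]; rewrite /steps_ok T h leq_addr leq_add2l; split=> //.
move: nT; rewrite -[teval _ _]/((narr st3 10 0)%:R * rarr st3 0 2 < rarr st3 7 0)%R.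
by rewrite (f3.2 7 isT) h7r h (i_r (inputs_frame f3 isT isT C2)) -leNgt.
Qed.

Definition cSETUP := cfor p (100 + 20) + (10 + cfor L 60 + (10 + cfor L 60 +
  (10 + cfor (p.+1 ^ L) (100 + (20 + (40 + 40))) + (cNSTEPS + (10 + cfor QL 60 + 20))))).

Lemma wp_SETUP :
  wp SETUP cSETUP (fun st' => exists K,
    [/\ steps_ok K, consts L K w alpha gh st', family L (factor_sets p L) 0 st' &
        forall a, a %% L.+1 != 0 -> narr st' 4 a = 0]) st0.
Proof.
have C0 : inputs st0 by [].
apply: wp_seq; apply: (wp_conseq (wp_QMAX C0 _)) => // st1 f1 h5 _.
have C1 := inputs_frame f1 isT isT C0.
apply: wp_seq; apply: (wp_conseq (@wp_POW _ 6 sL sP1 L p.+1 st1 _ _ _ _ _)) => //.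
- by move=> st' f; exact: i_L (inputs_frame f isT isT C1).
- by move=> st' f; rewrite /= (i_p (inputs_frame f isT isT C1)) addn1.
move=> st2 f2 h6 _; have C2 := inputs_frame f2 isT isT C1.
apply: wp_seq; apply: (wp_conseq (@wp_POW _ 7 sL sQ L Q st2 _ _ _ _ _)) => //.
- by move=> st' f; exact: i_L (inputs_frame f isT isT C2).
- by move=> st' f; rewrite /= (f.1 5 isT) (f2.1 5 isT).
move=> st3 f3 h7 _; have C3 := inputs_frame f3 isT isT C2.
apply: wp_seq; apply: (wp_conseq (wp_CODES C3 _ _ _ _)) => //.
- by rewrite (f3.1 6 isT) h6.
- by move=> x; rewrite (f3.1 4 isT) (f2.1 4 isT) (f1.1 4 isT).
- by move=> x; rewrite (f3.1 8 isT) (f2.1 8 isT) (f1.1 8 isT).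
- by move=> x; rewrite (f3.1 9 isT) (f2.1 9 isT) (f1.1 9 isT).
move=> st4 f4 [h9 fam h4] _; have C4 := inputs_frame f4 isT isT C3.
apply: wp_seq; apply: (wp_conseq (wp_NSTEPS C4 _ _)) => //.
- by rewrite (f4.1 7 isT) h7.
- by rewrite (f4.1 10 isT) (f3.1 10 isT) (f2.1 10 isT) (f1.1 10 isT).
move=> st5 f5 hK _; have C5 := inputs_frame f5 isT isT C4; set K := narr st5 10 0 in hK.
apply: wp_seq; apply: (wp_conseq (@wp_POW _ 11 (NGet 7 sL) sB QL (2 * K).+1 st5 _ _ _ _ _)) => //.
- move=> st' f; rewrite /= (i_L (inputs_frame f isT isT C5)).
  by rewrite (f.1 7 isT) (f5.1 7 isT) (f4.1 7 isT) h7.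
- by move=> st' f; rewrite /= (f.1 10 isT) addn1.
move=> st6 f6 h11 _; have C6 := inputs_frame f6 isT isT C5.
apply: wp_setR => //; exists K; split=> //.
- split=> /=.
  + exact: i_p C6.
  + exact: i_L C6.
  + by rewrite (i_n C6).
  + by move=> x; rewrite (i_n C6).
  + by move=> m i; rewrite (i_n C6) // inputs_w.
  + by rewrite (f6.1 5 isT) (f5.1 5 isT) (f4.1 5 isT) (f3.1 5 isT) (f2.1 5 isT).
  + by move=> j jL; rewrite (f6.1 6 isT) (f5.1 6 isT) (f4.1 6 isT) (f3.1 6 isT) h6.
  + by move=> j jL; rewrite (f6.1 7 isT) (f5.1 7 isT) (f4.1 7 isT) h7.
  + by move=> r rL; rewrite (f6.1 9 isT) (f5.1 9 isT) h9.
  + by rewrite (f6.1 10 isT).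
  + exact: h11.
  + by rewrite /upd /= (i_r C6).
  + by rewrite /upd /= (i_r C6).
  + by rewrite /upd /= (i_r C6) (f6.1 10 isT).
- by split=> [c cW|r rF] /=; rewrite (f6.1 4 isT) (f5.1 4 isT); [exact: fam.1 | exact: fam.2].
- by move=> a aL /=; rewrite (f6.1 4 isT) (f5.1 4 isT) h4.
Qed.

End Setup.

(** * Complexity *)

Section Growth.
Variables (L q K0 N0 : nat).
Hypothesis L0 : 0 < L.

(** All that varies between instances, packed into one argument, so that a bound in [big_oh] has a
    constant uniform in it. [L], [q], [K0] and [N0] are fixed. *)
Record size_data := SizeData { sd_p : nat; sd_qs : 'I_sd_p -> nat; sd_n : nat; sd_K : nat; sd_N : nat }.
Implicit Types (x : size_data).

Definition bounded_data x : Prop :=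
  [/\ 0 < sd_p x, \max_(j < sd_p x) sd_qs j <= q, 0 < sd_n x, sd_K x <= K0 & sd_N x <= N0].

Definition big_oh (X f : size_data -> nat) : Prop :=
  exists C, forall x, bounded_data x -> f x <= C * X x.

Definition positive (X : size_data -> nat) : Prop := forall x, bounded_data x -> 0 < X x.

Lemma big_oh_cst X k : positive X -> big_oh X (fun=> k).
Proof. by move=> X0; exists k => x ok; rewrite leq_pmulr // X0. Qed.

Lemma big_oh_add X f g : big_oh X f -> big_oh X g -> big_oh X (fun x => f x + g x).
Proof. by move=> [C hC] [D hD]; exists (C + D) => x ok; rewrite mulnDl leq_add ?hC ?hD. Qed.

Lemma big_oh_mul X Y f g : big_oh X f -> big_oh Y g ->
  big_oh (fun x => X x * Y x) (fun x => f x * g x).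
Proof. by move=> [C hC] [D hD]; exists (C * D) => x ok; rewrite mulnACA leq_mul ?hC ?hD. Qed.

Lemma big_oh_le X Y f : (forall x, bounded_data x -> X x <= Y x) -> big_oh X f -> big_oh Y f.
Proof.
move=> XY [C hC]; exists C => x ok; apply: leq_trans (hC x ok) _.
by rewrite leq_mul2l XY ?orbT.
Qed.

Lemma big_oh_for X Y f g : positive X -> positive Y -> big_oh X f -> big_oh Y g ->
  big_oh (fun x => X x * Y x) (fun x => cfor (f x) (g x)).
Proof.
move=> X0 Y0 hf hg; apply: big_oh_add; last first.
  by apply: big_oh_cst => x ok; rewrite muln_gt0 X0 ?Y0.
by apply: big_oh_mul => //; apply: big_oh_add => //; exact: big_oh_cst.
Qed.

Let one : size_data -> nat := fun=> 1.
Let P x := (sd_p x).+1 ^ L.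
Let n := sd_n.

Let one0 : positive one. Proof. by []. Qed.
Let P0 : positive P. Proof. by move=> x _; rewrite expn_gt0. Qed.
Let n0 : positive n. Proof. by move=> x []. Qed.
Let Pn x := P x * n x.
Let Pn0 : positive Pn. Proof. by move=> x ok; rewrite muln_gt0 P0 ?n0. Qed.

Lemma big_oh_for_cst X f g : positive X -> big_oh one f -> big_oh X g ->
  big_oh X (fun x => cfor (f x) (g x)).
Proof.
move=> X0 hf hg; have := big_oh_for one0 X0 hf hg.
by apply: big_oh_le => x _; rewrite mul1n.
Qed.

Lemma big_oh_for_body X f g : positive X -> big_oh X f -> big_oh one g ->
  big_oh X (fun x => cfor (f x) (g x)).
Proof.
move=> X0 hf hg; have := big_oh_for X0 one0 hf hg.
by apply: big_oh_le => x _; rewrite muln1.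
Qed.

Lemma big_oh_self X : big_oh X X.
Proof. by exists 1 => x _; rewrite mul1n. Qed.

Lemma big_oh_one X f : positive X -> big_oh one f -> big_oh X f.
Proof. by move=> X0; apply: big_oh_le => x /X0. Qed.

Let lift_P f : big_oh P f -> big_oh Pn f.
Proof. by apply: big_oh_le => x ok; rewrite leq_pmulr // n0. Qed.

Let bp : big_oh P sd_p.
Proof.
exists 1 => x _; rewrite mul1n; apply: leq_trans (leqnSn _) _.
by rewrite -[X in X <= _]expn1 leq_pexp2l.
Qed.

Local Notation Qx x := (\max_(j < sd_p x) sd_qs j).

Let bQ : big_oh one (fun x => Qx x ^ L).
Proof. by exists (q ^ L) => x [_ h _ _ _]; rewrite muln1 leq_exp2r. Qed.

Let bK : big_oh one sd_K.
Proof. by exists K0 => x [_ _ _ h _]; rewrite muln1. Qed.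

Let bN : big_oh one sd_N.
Proof. by exists N0 => x [_ _ _ _ h]; rewrite muln1. Qed.

Let bB : big_oh one (fun x => (2 * sd_K x).+1 ^ (Qx x ^ L)).
Proof.
exists ((2 * K0).+1 ^ (q ^ L)) => x [_ hQ _ hK _]; rewrite muln1.
apply: (@leq_trans ((2 * K0).+1 ^ (Qx x ^ L))).
  case: (posnP (Qx x ^ L)) => [->//|l0]; by rewrite leq_exp2r // ltnS leq_mul2l hK orbT.
by rewrite leq_pexp2l // leq_exp2r.
Qed.

Ltac bo := repeat first [exact: big_oh_cst | exact: bQ | exact: bB | exact: bK | exact: bN
  | apply: big_oh_for_cst; [by [] | |] | apply: big_oh_add].

Let bATOM : big_oh one (fun x => cATOM (@sd_qs x) L).
Proof. rewrite /cATOM; bo. Qed.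

Let bVAL : big_oh n (fun x => cVAL L (sd_n x)).
Proof.
rewrite /cVAL; apply: big_oh_add; first exact: big_oh_cst.
by apply: big_oh_for_body => //; [exact: big_oh_self | exact: big_oh_cst].
Qed.

Let bTRY : big_oh n (fun x => cTRY (@sd_qs x) L (sd_n x)).
Proof.
rewrite /cTRY; apply: big_oh_add; first exact: big_oh_one.
apply: big_oh_add; first by apply: big_oh_one => //; rewrite /cNORM; bo.
apply: big_oh_add; first exact: big_oh_cst.
by apply: big_oh_add; [exact: bVAL | exact: big_oh_cst].
Qed.

Let bSEARCH : big_oh Pn (fun x => cSEARCH (@sd_qs x) L (sd_n x) (sd_K x)).
Proof.
apply: big_oh_for => //; first exact: big_oh_self.
apply: big_oh_add; first exact: big_oh_cst.
apply: big_oh_for_cst => //; first exact: big_oh_cst.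
by apply: big_oh_add; [exact: big_oh_cst | apply: big_oh_for_cst].
Qed.

Let bRESET : big_oh Pn (fun x => cRESET (sd_p x) L (sd_n x)).
Proof.
apply: big_oh_for => //; apply: big_oh_add; first exact: big_oh_cst.
apply: big_oh_add; first exact: big_oh_cst.
by apply: big_oh_add; [exact: bVAL | exact: big_oh_cst].
Qed.

Let bUPDATE : big_oh Pn (fun x => cUPDATE (@sd_qs x) L (sd_n x)).
Proof.
apply: big_oh_for => //; apply: big_oh_add; first exact: big_oh_cst.
apply: big_oh_add; first exact: big_oh_cst.
apply: big_oh_add; first exact: big_oh_one.
apply: big_oh_add; last by bo.
by apply: big_oh_for_body => //; [exact: big_oh_self | exact: big_oh_cst].
Qed.

Let bOPT : big_oh Pn (fun x => cOPT (@sd_qs x) L (sd_n x) (sd_K x)).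
Proof.
apply: big_oh_add.
  apply: big_oh_for_body => //; last exact: big_oh_cst.
  by apply: big_oh_mul => //; exact: big_oh_self.
apply: big_oh_for_cst => //; apply: big_oh_add; first exact: bRESET.
by apply: big_oh_add.
Qed.

Let bMARK : big_oh Pn (fun x => cMARK (sd_p x) L).
Proof. by apply: lift_P; apply: big_oh_for_body => //; [exact: big_oh_self | exact: big_oh_cst]. Qed.

Let bPRUNE : big_oh Pn (fun x => cPRUNE (@sd_qs x) L).
Proof.
apply: lift_P; apply: big_oh_for_body => //; first exact: big_oh_self.
by rewrite /cAVERAGE; bo.
Qed.

Lemma run_cost : exists C, forall p (qs : 'I_p -> nat) n K N,
  0 < p -> \max_(j < p) qs j <= q -> 0 < n -> K <= K0 -> N <= N0 ->
  cSETUP qs L N + cROUNDS qs L n K <= C * (p.+1 ^ L * n).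
Proof.
suff [C hC] : big_oh Pn (fun x => cSETUP (@sd_qs x) L (sd_N x) +
    cROUNDS (@sd_qs x) L (sd_n x) (sd_K x)).
  by exists C => p qs n' K N *; exact: (hC (SizeData qs n' K N)).
have bW k : big_oh Pn (fun x => cfor ((sd_p x).+1 ^ L) k).
  by apply: lift_P; apply: big_oh_for_body => //; [exact: big_oh_self | exact: big_oh_cst].
apply: big_oh_add.
  apply: big_oh_add; first by apply: lift_P; apply: big_oh_for_body => //; exact: big_oh_cst.
  apply: big_oh_add; first exact: big_oh_cst.
  apply: big_oh_add; first exact: big_oh_cst.
  apply: big_oh_add; first by apply: big_oh_add; [exact: big_oh_cst | exact: bW].
  apply: big_oh_one => //; apply: big_oh_add; last by bo.
  rewrite /cNSTEPS; bo.
  have : big_oh (fun x => one x * one x) (fun x => sd_N x * (20 + 100)).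
    by apply: big_oh_mul => //; exact: big_oh_cst.
  by apply: big_oh_le.
apply: big_oh_add.
  apply: big_oh_for_cst => //; first exact: big_oh_cst.
  by apply: big_oh_add; [exact: bOPT | apply: big_oh_add].
by apply: big_oh_add; [exact: bMARK | exact: bW].
Qed.

End Growth.

Local Open Scope ring_scope.

Definition SUPRISE : cmd := SETUP ;;; ROUNDS.

Section Execution.
Variables (R : realType) (p : nat) (qs : 'I_p -> nat) (L n N : nat).
Variables (w : {ffun 'I_n -> config qs}) (alpha gh eps : R).
Hypotheses (p0 : (0 < p)%N) (qpos : forall i, (0 < qs i)%N) (n0 : (0 < n)%N).
Hypotheses (gh0 : 0 < gh) (alpha0 : 0 < alpha).
Local Notation Q := (\max_(j < p) qs j).
Hypothesis precN : 0 < eps -> precision qs L gh <= N%:R * eps.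
Hypothesis eps_pos : 0 < eps \/ (eps = 0 /\ forall u r (x : letters qs r -> R),
  r \in factor_sets p L -> u \in r -> centered x -> forall s, x s = 0).

(** With tolerance zero an exact minimizer is required; it exists because all feasible points agree
    on the factor sets through [u]. *)
Lemma trivial_minimizer (F : {set {set 'I_p}}) u (y : param R qs) : eps = 0 ->
  (forall u r (x : letters qs r -> R),
     r \in factor_sets p L -> u \in r -> centered x -> forall s, x s = 0) ->
  (forall r s, y r s = 0) -> eps_minimizer L w gh eps F u y.
Proof.
move=> -> triv y0; split; first split.
- by move=> r _ _ i s; rewrite big1.
- rewrite /l1norm big1 ?ltW // => r _; rewrite big1 // => s _; by rewrite y0 normr0.
- by move=> r _ _ _ s.
move=> x [cx _ _]; rewrite addr0 le_eqVlt; apply/orP; left; apply/eqP.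
congr (_ * _); apply: eq_bigr => m _; congr (expR (- _)).
apply: eq_bigr => r /andP[rF ur]; apply: eq_bigr => s _.
by rewrite y0 (triv u r (x r)) //; exact: cx.
Qed.

Lemma exec_SUPRISE : exists K st cost,
  [/\ (K <= (Q ^ L) ^ 2 + N)%N, exec SUPRISE (suprise_input L w alpha gh eps) st cost,
      suprise_run L w alpha gh eps (decode_families p L st) (decode_estimates L st)
        (decode_output p L st) &
      (cost <= cSETUP qs L N + cROUNDS qs L n K)%N].
Proof.
have Q0 : (0 < Q)%N.
  by apply: leq_trans (qpos (Ordinal p0)) _; exact: leq_bigmax.
have [st1 [k1 [ex1 le1 [K [ok C fam z4]]]]] := wp_SETUP w alpha precN.
have f1 := exec_frame ex1.
have [KN QK min] : [/\ (K <= (Q ^ L) ^ 2 + N)%N, (0 < K -> (Q ^ L) ^ 2 <= K)%N &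
    forall (F : {set {set 'I_p}}) u (X : param R qs), F \subset factor_sets p L ->
      fw_inv L w gh K u F K X -> eps_minimizer L w gh eps F u (curp K X)].
  move: ok; rewrite /steps_ok; case: eps_pos => [e0|[e0 triv]].
    rewrite e0 => -[QK KN prec]; split=> // F u X _ fw; apply: fw_final fw prec.
    by apply: leq_trans QK; rewrite expn_gt0 expn_gt0 Q0.
  (* Here [K = 0], and [curp] is identically zero because division by zero gives zero. *)
  rewrite e0 ltxx => ->; split=> // F u X _ _; rewrite -e0; apply: trivial_minimizer => // r s.
  by rewrite /curp mul0n invr0 mulr0 mul0r.
have [st2 [k2 [ex2 le2 run]]] : wp ROUNDS (cROUNDS qs L n K) (fun st' =>
    suprise_run L w alpha gh eps (decode_families p L st') (decode_estimates L st')
      (decode_output p L st')) st1.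
  apply: (wp_ROUNDS qpos Q0 n0 gh0 alpha0 QK min C) => //.
  - by move=> x; rewrite (f1.1 3%N isT).
  - by move=> t x /andP[t0 tL]; rewrite z4 // modn_col // -lt0n.
  - by move=> x; rewrite (f1.1 12%N isT).
  - by move=> x; rewrite (f1.2 1%N isT).
exists K, st2, (k1 + k2)%N; split=> //; first exact: ExecSeq ex1 ex2.
exact: leq_add.
Qed.

End Execution.

Lemma log_factor_le (R : realType) (L q p : nat) (delta : R) :
  (0 < L)%N -> (0 < q)%N -> (0 < p)%N -> 0 < delta ->
  log_factor L q p delta <=
    (`|ln (4 * L%:R * q%:R ^+ (2 * L)%N / delta)| + (2 * L)%:R) * (1 + ln p%:R).
Proof.
move=> L0 q0 p0 d0; rewrite /log_factor; set B := 4 * _ * _ / _.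
have B0 : 0 < B by rewrite divr_gt0 // !mulr_gt0 ?exprn_gt0 ?ltr0n.
have pR : 0 < p%:R :> R by rewrite ltr0n.
have -> : 4 * L%:R * q%:R ^+ (2 * L)%N * p%:R ^+ (2 * L - 1)%N / delta =
    B * p%:R ^+ (2 * L - 1)%N by rewrite /B mulrAC.
rewrite lnM ?posrE ?exprn_gt0 // lnXn //.
have lp : 0 <= ln p%:R :> R by rewrite ln_ge0 // ler1n.
have h1 : ln p%:R *+ (2 * L - 1) <= (2 * L)%:R * ln p%:R :> R.
  by rewrite mulr_natl; apply: ler_wpMn2l => //; exact: leq_subr.
rewrite mulrDl !mulrDr !mulr1; apply: lerD.
  by apply: le_trans (ler_norm _) _; rewrite lerDl mulr_ge0.
by apply: le_trans h1 _; rewrite lerDr.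
Qed.

Theorem corollary3 (R : realType) :
  (forall (L q p : nat) (qs : 'I_p -> nat) (theta : param R qs)
          (alpha gamma gammahat delta : R) (n : nat),
      (0 < L)%N -> (0 < p)%N ->
      (forall i, (0 < qs i <= q)%N) ->
      globally_centered L theta ->
      interaction_strength L theta = gamma ->
      0 < gammahat ->
      (forall u, l1norm L u theta <= gammahat) ->
      0 < alpha ->
      (forall c, c \in structure L theta -> alpha <= l2norm (theta c)) ->
      0 < delta -> delta < 1 ->
      sample_bound L q p alpha gamma gammahat delta <= n%:R ->
      1 - delta <=
        prob_samples L theta
          (fun w : {ffun 'I_n -> config qs} =>
             forall Shat : {set {set 'I_p}},
               suprise_output L w alpha gammahat
                 (suprise_eps L q theta alpha gammahat) Shat <->
               Shat = structure L theta))
  /\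
  (exists prog : cmd,
    forall (L q : nat) (alpha gamma gammahat delta : R),
      (0 < L)%N -> 0 < gammahat -> 0 < alpha -> 0 < delta -> delta < 1 ->
      exists (C : R) (k : nat),
      forall (p : nat) (qs : 'I_p -> nat) (theta : param R qs) (n : nat),
      (0 < p)%N ->
      (forall i, (0 < qs i <= q)%N) ->
      globally_centered L theta ->
      interaction_strength L theta = gamma ->
      (forall u, l1norm L u theta <= gammahat) ->
      (forall c, c \in structure L theta -> alpha <= l2norm (theta c)) ->
      sample_bound L q p alpha gamma gammahat delta <= n%:R ->
      (forall n' : nat,
          sample_bound L q p alpha gamma gammahat delta <= n'%:R -> (n <= n')%N) ->
      forall w : {ffun 'I_n -> config qs},
      exists (st : store R) (cost : nat),
        [/\ exec prog
              (suprise_input L w alpha gammahat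
                 (suprise_eps L q theta alpha gammahat)) st cost,
            suprise_run L w alpha gammahat
              (suprise_eps L q theta alpha gammahat)
              (decode_families p L st) (decode_estimates L st)
              (decode_output p L st) &
            cost%:R <= C * p%:R ^+ L * (1 + ln p%:R) ^+ k]).
Proof.
split=> [L q p qs theta alpha gamma gammahat delta n|]; first exact: suprise_recovers.
exists SUPRISE => L q alpha gamma gh delta L0 gh0 a0 d0 d1.
pose X : R := 16 * gh ^+ 2 * expR (3 * gh) + 2 * gh * expR gh * ((q ^ L) ^ 2)%:R.
(* [X] bounds the required precision with [q] in place of the largest alphabet. Dividing by
   [eps_floor] instead of the actual tolerance makes [N] independent of [p] and of the model. *)
pose N := (Num.truncn (X / eps_floor L q alpha gamma gh)).+1.
have [C1 hC1] := run_cost q ((q ^ L) ^ 2 + N) N L0.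
pose A := sample_scale L q alpha gamma gh.
pose B : R := `|ln (4 * L%:R * q%:R ^+ (2 * L)%N / delta)| + (2 * L)%:R.
(* [C1] comes from [run_cost], [2 ^ L] from [p + 1 <= 2 * p], and [A * B + 1] from the sample size,
   which contributes the single logarithm. *)
exists (C1%:R * 2 ^+ L * (A * B + 1)), 1%N.
move=> p qs theta n p0 qsq tc g_eq l1 l2 nbig nmin w.
have qpos i : (0 < qs i)%N by have /andP[] := qsq i.
have q0 : (0 < q)%N by have /andP[h1 h2] := qsq (Ordinal p0); exact: leq_trans h1 h2.
have Qq : (\max_(j < p) qs j <= q)%N by apply/bigmax_leqP => i _; have /andP[] := qsq i.
have sb0 := sample_bound_gt0 gamma L0 q0 p0 gh0 a0 d0 d1.
have n0 : (0 < n)%N by rewrite -(ltr0n R); exact: lt_le_trans sb0 nbig.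
have fl0 := eps_floor_gt0 L gamma q0 a0 gh0.
have QL : (((\max_(j < p) qs j) ^ L) ^ 2 <= (q ^ L) ^ 2)%N by rewrite leq_exp2r // leq_exp2r.
have precX : precision qs L gh <= X.
  rewrite lerD2l ler_wpM2l ?ler_nat // !mulr_ge0 ?expR_ge0 //; exact: ltW.
have low := eps_lower_or_trivial L theta p0 qsq gh0 a0; rewrite g_eq in low.
have precN : 0 < suprise_eps L q theta alpha gh ->
    precision qs L gh <= N%:R * suprise_eps L q theta alpha gh.
  case: low => [lo e0|[-> _]]; last by rewrite ltxx.
  apply: le_trans precX (le_trans _ (ler_wpM2l _ lo)) => //.
  by rewrite -ler_pdivrMr //; apply: ltW; exact: truncnS_gt.
have eps_pos := eps_ge0_or_trivial L theta p0 qsq gh0 a0.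
have [K [st [cost [KN ex run cb]]]] :=
  exec_SUPRISE w p0 qpos n0 gh0 a0 precN eps_pos.
exists st, cost; split=> //.
have {cb}cost_le : (cost <= C1 * (p.+1 ^ L * n))%N.
  apply: leq_trans cb (hC1 _ _ _ _ _ p0 Qq n0 _ _) => //.
  by apply: leq_trans KN _; rewrite leq_add2r.
have lp : 0 <= ln p%:R :> R by rewrite ln_ge0 // ler1n.
have A0 : 0 < A by exact: sample_scale_gt0.
have B0 : 0 <= B by rewrite addr_ge0.
(* By minimality [n] is at most the integer part of the sample bound plus one. *)
have n_le : n%:R <= (A * B + 1) * (1 + ln p%:R).
  have /andP[tl tg] := truncn_itv (ltW sb0).
  have := nmin _ (ltW tg); rewrite -(ler_nat R) => /le_trans; apply.
  rewrite -natr1 [leRHS]mulrDl mul1r lerD ?lerDl //; apply: le_trans tl _.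
  rewrite sample_boundE -[A * B * _]mulrA; apply: ler_wpM2l; first exact: ltW.
  exact: log_factor_le.
have p_le : (p.+1 ^ L)%:R <= 2 ^+ L * p%:R ^+ L :> R.
  by rewrite -exprMn -!natrM -natrX ler_nat leq_exp2r // mul2n -addnn -addn1 leq_add2l.
apply: (@le_trans _ _ (C1%:R * ((p.+1 ^ L)%:R * n%:R))); first by rewrite -!natrM ler_nat.
move: (A * B + 1) n_le => E n_le.
apply: (@le_trans _ _ (C1%:R * ((2 ^+ L * p%:R ^+ L) * (E * (1 + ln p%:R))))).
  by rewrite ler_wpM2l // ler_pM.
by rewrite le_eqVlt; apply/orP; left; apply/eqP; ring.
Qed.
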